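(* Consider the Newey and Robins plug-in estimator $\hat\psi^{\mathrm{NR}}_k$ without sample splitting of $\psi(\mathbb P)=\mathbb E_{\mathbb P}[\mathrm{Cov}_{\mathbb P}(A,Y\mid X)]$ over $\mathcal P_{(\alpha,\beta)}$ defined in the context, and suppose we choose the prediction-optimal resolution $k=k_2^{\mathrm{pred}}$, where $k_2^{\mathrm{pred}}=c_2n^{\frac d{2\beta+d}}$ for fixed $c_2>0$. Then $\hat\psi^{\mathrm{NR}}_{k_2^{\mathrm{pred}}}$ achieves its best rate for estimating $\psi(\mathbb P)$ (i.e. $n^{-1}$ when $\frac{\alpha+\beta}2\ge\frac d2$ and $n^{-\frac{2\alpha+2\beta}{\alpha+\beta+d}}$ when $\frac{\alpha+\beta}2<\frac d2$) if and only if $\alpha\wedge\beta\ge\frac d2$ or $\alpha=\beta$.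
   Context: Notation. $a\vee b=\max(a,b)$, $a\wedge b=\min(a,b)$; integrals are over $[0,1]^d$. For nonnegative sequences, $a_n\lesssim b_n$ means there is a constant $C>0$ with $a_n\le Cb_n$ for all $n\ge n_0$; $a_n\gtrsim b_n$ means $b_n\lesssim a_n$; $a_n\asymp b_n$ means both. The resolution $k$ is a sequence that may depend on $n$. Wavelets. Fix a compactly supported Cohen–Daubechies–Vial type orthonormal wavelet basis $\{\Phi_{J_0m},\Psi^{\iota}_{lm'}: m\in\mathcal Z_{J_0},\,m'\in\mathcal Z_l,\,\iota\in\{0,1\}^d\setminus\{0\},\,l\ge J_0\}$ of $L^2([0,1]^d)$ of regularity $S\ge1$, $S>\alpha\vee\beta$, with $2^{J_0}\ge S$, $|\mathcal Z_l|\asymp 2^{ld}$. For $j\ge J_0$ let $V_j=\mathrm{span}\{\Phi_{jm}:m\in\mathcal Z_j\}$ ($\{\Phi_{jm}\}_m$ the orthonormal scaling functions at level $j$; the $V_j$ are nested). A resolution is a number $k=2^{jd}$, $j\ge J_0$ (so prescribed values such as $c\,n^a$ are understood up to bounded constant factors); write $V_k,\Phi_{km},\mathcal Z_k$ for $V_j,\Phi_{jm},\mathcal Z_j$. Standard properties: $|\Phi_{km}|\lesssim\sqrt k$ uniformly with support in a set of Lebesgue measure $O(1/k)$; $V_k$ contains all polynomials of degree at most $S-1$. The projection kernel is $K_{V_k}(x,y)=\sum_{m\in\mathcal Z_k}\Phi_{km}(x)\Phi_{km}(y)$. Hölder ball. $H(\alpha,M)$ is the set of uniformly continuous $h:[0,1]^d\to\mathbb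 R$ with $2^{J_0(\alpha+d/2)}\max_m|\langle h,\Phi_{J_0m}\rangle|+\sup_{l\ge J_0,m\in\mathcal Z_l,\iota}2^{l(\alpha+d/2)}|\langle h,\Psi^\iota_{lm}\rangle|\le M$. Model. $\mathcal P_{(\alpha,\beta)}$ is the set of distributions $\mathbb P$ of $(X,A,Y)\in[0,1]^d\times\mathbb R\times\mathbb R$ with $X\sim\mathrm{Uniform}([0,1]^d)$, $A,Y\in[C_1,C_2]$ a.s., $p(x):=\mathbb E_{\mathbb P}[A\mid X=x]\in H(\alpha,M)$ and $b(x):=\mathbb E_{\mathbb P}[Y\mid X=x]\in H(\beta,M)$, where $C_1,C_2\in\mathbb R$, $\alpha,\beta,M>0$ are fixed known constants. The functional is $\psi(\mathbb P)=\mathbb E_{\mathbb P}[\mathrm{Cov}_{\mathbb P}(A,Y\mid X)]$. Estimator. Let $\mathcal D_1$ be a sample of $n$ i.i.d. observations from $\mathbb P$. Put $\hat b_k(x)=\frac1n\sum_{i\in\mathcal D_1}Y_iK_{V_k}(X_i,x)$ and $\hat\psi^{\mathrm{NR}}_k=\frac1n\sum_{i\in\mathcal D_1}A_i(Y_i-\hat b_k(X_i))$. Rates. For a given resolution sequence let $R_n=\sup_{\mathbb P\in\mathcal P_{(\alpha,\beta)}}\mathbb E_{\mathbb P}[(\hat\psi^{\mathrm{NR}}_k-\psi(\mathbb P))^2]$. The best rate is $r_n$ if some choice of $k$ gives $R_n\lesssim r_n$ while every choice gives $R_n\gtrsim r_n$. A choice of $k$ achieves the best rate if it gives $R_n\lesssim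 r_n$.
   Formalization: The formal theorem additionally assumes C_1 < C_2 and that the class P_(α,β) is nonempty already for some radius M_0 < M; without these the claim fails (e.g. C_1 = C_2 = 0 makes every risk zero). *)

(* Defs.v *)
From HB Require Import structures.
From mathcomp Require Import all_boot all_order all_algebra.
From mathcomp Require Import all_classical all_reals all_analysis.

Set Implicit Arguments.
Unset Strict Implicit.
Unset Printing Implicit Defensive.

Import Order.TTheory GRing.Theory Num.Theory.
Import numFieldNormedType.Exports.

Local Open Scope classical_set_scope.
Local Open Scope ring_scope.

(* The tuple space carries the sigma-algebra generated by the coordinates; the
   n-fold product measure is obtained by pushing the binary product forward
   along the cons map. *)
Section power_probability.
Context d (T : measurableType d) (R : realType).

Definition tuple_cons n (x : T * n.-tuple T) : n.+1.-tuple T :=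
  [the n.+1.-tuple T of x.1 :: x.2].

Lemma measurable_tuple_cons n : measurable_fun setT (@tuple_cons n).
Proof. exact: measurable_cons. Qed.

HB.instance Definition _ n := @isMeasurableFun.Build _ _ _ _
  (@tuple_cons n) (@measurable_tuple_cons n).

Fixpoint pow_prob (P : probability T R) n : probability (n.-tuple T) R :=
  if n is n'.+1 then
    [the probability _ _ of
      distribution [the probability _ _ of (P \x pow_prob P n')%E]
        [the {mfun _ >-> _} of @tuple_cons n']]
  else [the probability _ _ of \d_[tuple]].

End power_probability.

Section cube.
Context (R : realType) (d : nat).

Definition Rpt := d.-tuple (measurableTypeR R).

Definition cube : set Rpt := [set x | forall i, 0 <= tnth x i <= 1].

Definition unif_cube : probability Rpt R :=
  pow_prob [the probability _ _ of uniform_prob (@ltr01 R)] d.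

(* Since unif_cube is Lebesgue measure on the unit cube and gives no mass to its
   complement, this is the L^2([0,1]^d) inner product. *)
Definition inner (f g : Rpt -> R) : R := \int[unif_cube]_x (f x * g x).

Definition unif_continuous_on_cube (h : Rpt -> R) :=
  forall e : R, 0 < e -> exists2 r : R, 0 < r &
    forall x y, cube x -> cube y ->
      (forall i, `|tnth x i - tnth y i| < r) -> `|h x - h y| < e.

End cube.

Section wavelets.
Context (R : realType) (d : nat).
Local Notation X := (Rpt R d).

Definition subband := {i : {ffun 'I_d -> bool} | i != [ffun=> false]}.

Record wavelet_system := WaveletSystem {
  idx : nat -> finType ;
  scaling : forall l, idx l -> X -> R ;
  wavelet : forall l, subband -> idx l -> X -> R }.

Variable W : wavelet_system.
Local Notation Z := (idx W).

Definition resolution (j : nat) : nat := (2 ^ (j * d))%N.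

Definition in_V (j : nat) (f : X -> R) :=
  exists a : Z j -> R,
    {ae unif_cube R d, forall x, f x = \sum_m a m * scaling m x}.

Definition in_VW (j : nat) (f : X -> R) :=
  exists (a : Z j -> R) (c : subband -> Z j -> R),
    {ae unif_cube R d, forall x,
      f x = \sum_m a m * scaling m x
            + \sum_(i : subband) \sum_m c i m * wavelet i m x}.

Definition basis_combination J0 (L : nat) (a : Z J0 -> R)
    (c : forall l, subband -> Z l -> R) (x : X) : R :=
  \sum_m a m * scaling m x
  + \sum_(J0 <= l < L) \sum_(i : subband) \sum_m c l i m * wavelet i m x.

(* A family of functions at level l that is bounded by a multiple of 2^(l d/2),
   each member being supported in a box of side O(2^(-l)) and each point lying
   in the support of boundedly many members. *)
Definition compactly_localized (I : nat -> finType)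
    (F : forall l, I l -> X -> R) (J0 : nat) :=
  exists2 C : R, 0 < C & forall l, (J0 <= l)%N ->
    [/\ forall m x, cube x -> `|F l m x| <= C * Num.sqrt (resolution l)%:R,
        forall m, exists z : X, forall x, cube x -> F l m x != 0 ->
          forall i, `|tnth x i - tnth z i| <= C / 2 ^+ l
      & forall x, cube x -> #|[pred m | F l m x != 0]|%:R <= C].

(* Compactly supported orthonormal wavelet basis of L^2([0,1]^d) of
   Cohen-Daubechies-Vial type, with coarsest level J0. The regularity S is the
   order of polynomial reproduction of the V_j. No smoothness of the wavelets is
   required; for S = 1 the Haar system is included. *)
Record cdv_basis (S J0 : nat) : Prop := CDVBasis {
  scaling_measurable : forall l (m : Z l), (J0 <= l)%N ->
    measurable_fun setT (scaling m) ;
  wavelet_measurable : forall l i (m : Z l), (J0 <= l)%N ->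
    measurable_fun setT (wavelet i m) ;
  idx_card : exists2 C : R, 0 < C & forall l, (J0 <= l)%N ->
    C^-1 * (resolution l)%:R <= #|Z l|%:R <= C * (resolution l)%:R ;
  scaling_localized : compactly_localized (@scaling W) J0 ;
  wavelet_localized : forall i,
    compactly_localized (fun l => @wavelet W l i) J0 ;
  scaling_orthonormal : forall l (m m' : Z l), (J0 <= l)%N ->
    inner (scaling m) (scaling m') = (m == m')%:R ;
  wavelet_orthonormal : forall l i i' (m m' : Z l), (J0 <= l)%N ->
    inner (wavelet i m) (wavelet i' m') = ((i == i') && (m == m'))%:R ;
  wavelet_orthogonal : forall l l' i i' (m : Z l) (m' : Z l'),
    (J0 <= l < l')%N -> inner (wavelet i m) (wavelet i' m') = 0 ;
  scaling_wavelet_orthogonal : forall l i (m : Z J0) (m' : Z l),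
    (J0 <= l)%N -> inner (scaling m) (wavelet i m') = 0 ;
  basis_total : forall f : X -> R, f \in Lfun (unif_cube R d) 2%:E ->
    forall e : R, 0 < e ->
    exists (L : nat) (a : Z J0 -> R) (c : forall l, subband -> Z l -> R),
      ('N[unif_cube R d]_2%:E
         [EFin \o (f \- basis_combination L a c)%R] < e%:E)%E ;
  scaling_nested : forall l (m : Z l), (J0 <= l)%N -> in_V l.+1 (scaling m) ;
  wavelet_next : forall l i (m : Z l), (J0 <= l)%N -> in_V l.+1 (wavelet i m) ;
  scaling_split : forall l (m : Z l.+1), (J0 <= l)%N -> in_VW l (scaling m) ;
  polynomial_reproduction : forall l (e : 'I_d -> nat), (J0 <= l)%N ->
    (\sum_i e i < S)%N -> in_V l (fun x => \prod_i tnth x i ^+ e i) }.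

Definition holder_norm (J0 : nat) (alpha : R) (h : X -> R) : \bar R :=
  ((2 `^ (J0%:R * (alpha + d%:R / 2))
      * \big[Num.max/0]_(m : Z J0) `|inner h (scaling m)|)%:E
   + ereal_sup [set y | exists l (i : subband) (m : Z l), (J0 <= l)%N /\
       y = (2 `^ (l%:R * (alpha + d%:R / 2))
              * `|inner h (wavelet i m)|)%:E])%E.

Definition holder_ball (J0 : nat) (alpha M : R) : set (X -> R) :=
  [set h | unif_continuous_on_cube h /\ (holder_norm J0 alpha h <= M%:E)%E].

Definition projection_kernel (j : nat) (x y : X) : R :=
  \sum_(m : Z j) scaling m x * scaling m y.

End wavelets.

Section model.
Context (R : realType) (d : nat).

Definition obs := (Rpt R d * measurableTypeR R * measurableTypeR R)%type.
Definition obsX (o : obs) : Rpt R d := o.1.1.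
Definition obsA (o : obs) : R := o.1.2.
Definition obsY (o : obs) : R := o.2.

Definition is_cond_exp (P : probability obs R) (T : obs -> R)
    (g : Rpt R d -> R) :=
  [/\ P.-integrable setT (EFin \o T),
      measurable_fun setT g,
      P.-integrable setT (EFin \o (g \o obsX))
    & forall B, measurable B ->
      (\int[P]_(o in obsX @^-1` B) (T o)%:E
       = \int[P]_(o in obsX @^-1` B) (g (obsX o))%:E)%E].

(* A version of x |-> E[T | X = x]; versions agree outside a null set of X. *)
Definition cond_exp (P : probability obs R) (T : obs -> R) : Rpt R d -> R :=
  xget (fun=> 0) [set g | is_cond_exp P T g].

Definition cond_cov (P : probability obs R) (T U : obs -> R) :
    Rpt R d -> R :=
  cond_exp P (fun o =>
    (T o - cond_exp P T (obsX o)) * (U o - cond_exp P U (obsX o))).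

Definition psi (P : probability obs R) : R :=
  fine 'E_P[fun o => cond_cov P obsA obsY (obsX o)].

(* Membership of a conditional expectation in a Hoelder ball means that one of
   its versions lies in the ball. *)
Definition model (W : wavelet_system R d) (J0 : nat)
    (C1 C2 alpha beta M : R) : set (probability obs R) :=
  [set P : probability obs R |
    [/\ forall B, measurable B -> P (obsX @^-1` B) = unif_cube R d B,
        {ae P, forall o, C1 <= obsA o <= C2 /\ C1 <= obsY o <= C2},
        exists2 p, is_cond_exp P obsA p & holder_ball W J0 alpha M p
      & exists2 b, is_cond_exp P obsY b & holder_ball W J0 beta M b]].

Definition b_hat (W : wavelet_system R d) (j n : nat)
    (D : n.-tuple obs) (x : Rpt R d) : R :=
  n%:R^-1 * \sum_(i < n)
    obsY (tnth D i) * projection_kernel W j (obsX (tnth D i)) x.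

Definition psi_NR (W : wavelet_system R d) (j n : nat) (D : n.-tuple obs) : R :=
  n%:R^-1 * \sum_(i < n)
    obsA (tnth D i) * (obsY (tnth D i) - b_hat W j D (obsX (tnth D i))).

(* Resolutions are parametrised by their level: k = 2^(j d). *)
Definition max_risk (W : wavelet_system R d) (J0 : nat)
    (C1 C2 alpha beta M : R) (j : nat -> nat) (n : nat) : \bar R :=
  ereal_sup
    [set ('E_(pow_prob P n)[fun D => ((psi_NR W (j n) D - psi P) ^+ 2)%R])%E
    | P in model W J0 C1 C2 alpha beta M].

End model.

Section rates.
Context (R : realType).

Definition lesssim (a b : nat -> \bar R) :=
  exists2 C : R, 0 < C & \forall n \near \oo, (a n <= C%:E * b n)%E.

Definition asymp (a b : nat -> \bar R) := lesssim a b /\ lesssim b a.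

Definition levels (J0 : nat) : set (nat -> nat) :=
  [set j | forall n, (J0 <= j n)%N].

Definition achieves (risk : (nat -> nat) -> nat -> \bar R) (r : nat -> R)
    (j : nat -> nat) :=
  lesssim (risk j) (EFin \o r).

Definition best_rate (J0 : nat) (risk : (nat -> nat) -> nat -> \bar R)
    (r : nat -> R) :=
  (exists2 j, levels J0 j & achieves risk r j) /\
  (forall j, levels J0 j -> lesssim (EFin \o r) (risk j)).

(* The levels j realise the prescribed resolutions k up to bounded constant
   factors. *)
Definition realizes (d : nat) (j : nat -> nat) (k : nat -> R) :=
  asymp (fun n => (resolution d (j n))%:R%:E) (EFin \o k).

Definition NR_rate (d : nat) (alpha beta : R) (n : nat) : R :=
  if d%:R / 2 <= (alpha + beta) / 2 then n%:R^-1
  else n%:R `^ (- ((2 * alpha + 2 * beta) / (alpha + beta + d%:R))).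

Definition k2_pred (d : nat) (beta c2 : R) (n : nat) : R :=
  c2 * n%:R `^ (d%:R / (2 * beta + d%:R)).

End rates.

(* Main.v *)
Require Import Defs.
From HB Require Import structures.
From mathcomp Require Import all_boot all_order all_algebra.
From mathcomp Require Import all_classical all_reals all_analysis.
From mathcomp Require Import measurable_realfun ring lra.

(** Up to constants, the maximal risk at resolution k = 2^(jd) is

  k^(-2s/d) + 1/n + (k/n)^2,     s = alpha + beta,

and the theorem reads off the best exponent and the exponents attained by
k = n^(d/(2 beta + d)).

The estimator is the empirical mean of AY minus a sum, over the scaling
functions phi_m of level j, of products of the empirical means of A phi_m and
Y phi_m ([psi_NR_plugin]). With p and b the regression functions of A and Y,
its bias is the inner product of the residuals of p and b after projection on
V_j, plus a term of order k/n due to the pairs (i, i) of equal observations.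

Upper bound ([max_risk_le]). The residual inner product is a tail of the
wavelet expansion, and the Hoelder bounds on the coefficients make it
O(2^(-js)) ([approx_bias_le]). A Hoeffding decomposition of the statistic
([risk_le]) leaves centred linear terms, of variance O(1/n), and a product of
two centred k-dimensional vectors of empirical means, of second moment
O((k/n)^2) because the kernel K(x, x) is O(k) ([kernel_diag_le]).

Lower bounds ([risk_lower]). Given X the law takes A = p(X) + eta e and
Y = b(X) + eta e e' with independent signs e, e' ([law]), so that p, b and psi
are prescribed independently of each other.
- (k/n)^2: the diagonal pairs contribute a bias proportional to
  psi k/n, whose sign can be chosen through the mean of e'.
- 1/n: Cauchy-Schwarz against the sum over the sample of the product of the two
  noises, the score for the conditional covariance.
- k^(-2s/d): the bias is bilinear in (p, b), so that perturbing both along one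
  function f yields, as a mixed second difference, the bias of (f, f). The
  function f must have a residual of norm bounded below after projection on V_j
  and 2^(-j alpha) f must stay in a fixed alpha-Hoelder ball for every
  alpha <= S. The wavelets may be discontinuous, so f is not taken among them:
  it is a signed sum of polynomial bumps on dyadic cells a fixed number of
  levels finer than j. There are more bumps than V_j has dimensions, so some
  choice of signs leaves a large residual ([rough_function]), and since V_l
  reproduces polynomials of degree less than S, the Taylor expansion of the
  bumps bounds the wavelet coefficients of f ([combo_coef_le]).

The last two bounds need k <= c n; beyond that, (k/n)^2 is bounded below.
Balancing k^(-2s/d) with (k/n)^2 gives the best exponent min(1, 2s/(s+d)). For
k = n^(d/(2 beta + d)) the three terms are n^(-2s/(2 beta + d)), 1/n and
n^(-4 beta/(2 beta + d)); comparing exponents gives the stated condition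
([prediction_exponent_condition]). *)

Import Order.TTheory GRing.Theory Num.Theory.
Import numFieldNormedType.Exports.

Set Implicit Arguments.
Unset Strict Implicit.
Unset Printing Implicit Defensive.

Local Open Scope classical_set_scope.
Local Open Scope ring_scope.

(** * Essentially bounded functions and their means *)

(** All functions integrated below are measurable and essentially bounded. The
class is stable under sums and products, so that integrability needs no separate
argument. *)
Definition ebd d (T : measurableType d) (R : realType) (P : probability T R)
    (f : T -> R) :=
  measurable_fun setT f /\ exists C : R, {ae P, forall x, `|f x| <= C}.

Definition mean d (T : measurableType d) (R : realType) (P : probability T R)
    (f : T -> R) : R := \int[P]_x f x.

Section ess_bounded.
Context d (T : measurableType d) (R : realType) (P : probability T R).
Implicit Types f g : T -> R.

Lemma ebd_cst (c : R) : ebd P (fun=> c).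
Proof.
split; first exact: measurable_cst.
by exists `|c|; apply: aeW.
Qed.

Lemma ebdD f g : ebd P f -> ebd P g -> ebd P (fun x => f x + g x).
Proof.
move=> [mf [C hC]] [mg [D hD]]; split; first exact: measurable_funD.
exists (C + D); apply: filterS2 hC hD => x fx gx.
by rewrite (le_trans (ler_normD _ _))// lerD.
Qed.

Lemma ebdN f : ebd P f -> ebd P (fun x => - f x).
Proof.
move=> [mf [C hC]]; split; first exact: measurableT_comp.
by exists C; apply: filterS hC => x; rewrite normrN.
Qed.

Lemma ebdB f g : ebd P f -> ebd P g -> ebd P (fun x => f x - g x).
Proof. by move=> hf hg; apply: ebdD => //; exact: ebdN. Qed.

Lemma ebdM f g : ebd P f -> ebd P g -> ebd P (fun x => f x * g x).
Proof.
move=> [mf [C hC]] [mg [D hD]]; split; first exact: measurable_funM.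
exists (C * D); apply: filterS2 hC hD => x fx gx.
by rewrite normrM ler_pM.
Qed.

Lemma ebdX f n : ebd P f -> ebd P (fun x => f x ^+ n).
Proof.
move=> hf; elim: n => [|n IHn].
  by under eq_fun do rewrite expr0; exact: ebd_cst.
by under eq_fun do rewrite exprS; exact: ebdM.
Qed.

Lemma ebd_sum (I : Type) (r : seq I) (Q : pred I) (F : I -> T -> R) :
  (forall i, ebd P (F i)) -> ebd P (fun x => \sum_(i <- r | Q i) F i x).
Proof.
move=> hF; elim: r => [|i r IHr].
  by under eq_fun do rewrite big_nil; exact: ebd_cst.
under eq_fun do rewrite big_cons; case: (Q i) => //.
exact: ebdD.
Qed.

Lemma ebd_integrable f : ebd P f -> P.-integrable setT (EFin \o f).
Proof.
move=> [mf [C hC]].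
apply/integrableP; split; first exact/measurable_EFinP.
apply: (@le_lt_trans _ _ (\int[P]_x (`|C|%:E))%E).
  apply: ae_ge0_le_integral => //=.
  - apply/measurable_EFinP; exact: measurableT_comp.
  - by apply: filterS hC => x fx _; rewrite lee_fin (le_trans fx)// ler_norm.
by rewrite integral_cst// [X in (_ * X)%E]probability_setT mule1 ltry.
Qed.

Lemma mean_cst (c : R) : mean P (fun=> c) = c.
Proof.
by rewrite /mean /Rintegral/= integral_cst//= [X in (_ * X)%E]probability_setT mule1.
Qed.

Lemma meanD f g : ebd P f -> ebd P g ->
  mean P (fun x => f x + g x) = mean P f + mean P g.
Proof. by move=> hf hg; apply: RintegralD => //; exact: ebd_integrable. Qed.

Lemma meanB f g : ebd P f -> ebd P g ->
  mean P (fun x => f x - g x) = mean P f - mean P g.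
Proof. by move=> hf hg; apply: RintegralB => //; exact: ebd_integrable. Qed.

Lemma meanZ (c : R) f : ebd P f -> mean P (fun x => c * f x) = c * mean P f.
Proof. by move=> hf; apply: RintegralZl => //; exact: ebd_integrable. Qed.

Lemma mean_sum (I : Type) (r : seq I) (Q : pred I) (F : I -> T -> R) :
  (forall i, ebd P (F i)) ->
  mean P (fun x => \sum_(i <- r | Q i) F i x) =
  \sum_(i <- r | Q i) mean P (F i).
Proof.
move=> hF; elim: r => [|i r IHr].
  by under eq_fun do rewrite big_nil; rewrite mean_cst big_nil.
under eq_fun do rewrite big_cons; rewrite big_cons; case: (Q i) => //.
by rewrite meanD ?IHr//; exact: ebd_sum.
Qed.

Lemma eq_mean f g : f =1 g -> mean P f = mean P g.
Proof. by move=> /funext ->. Qed.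

Lemma ae_eq_mean f g : measurable_fun setT f -> measurable_fun setT g ->
  {ae P, forall x, f x = g x} -> mean P f = mean P g.
Proof.
move=> mf mg fg; rewrite /mean /Rintegral; congr fine.
apply: ae_eq_integral => //; try exact/measurable_EFinP.
by apply: filterS fg => x -> _.
Qed.

Lemma mean_ge0 f : ebd P f -> {ae P, forall x, 0 <= f x} -> 0 <= mean P f.
Proof.
move=> [mf hf] f0.
rewrite (@ae_eq_mean f (fun x => `|f x|))//.
- exact: Rintegral_ge0.
- exact: measurableT_comp.
- by apply: filterS f0 => x x0; rewrite ger0_norm.
Qed.

Lemma le_mean f g : ebd P f -> ebd P g -> {ae P, forall x, f x <= g x} ->
  mean P f <= mean P g.
Proof.
move=> hf hg fg; rewrite -subr_ge0 -meanB//; apply: mean_ge0.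
  exact: ebdB.
by apply: filterS fg => x; rewrite subr_ge0.
Qed.

Lemma ebd_norm f : ebd P f -> ebd P (fun x => `|f x|).
Proof.
move=> [mf [C hC]]; split; first exact: measurableT_comp.
by exists C; apply: filterS hC => x; rewrite normr_id.
Qed.

Lemma ler_norm_mean f : ebd P f -> `|mean P f| <= mean P (fun x => `|f x|).
Proof.
by move=> hf; apply: le_normr_Rintegral => //; exact: ebd_integrable.
Qed.

Lemma mean_sqr_ge0 f : ebd P f -> 0 <= mean P (fun x => f x ^+ 2).
Proof.
move=> hf; apply: mean_ge0; first exact: ebdX.
by apply: aeW => x; exact: sqr_ge0.
Qed.

End ess_bounded.

Ltac ebd_with tac := repeat match goal with
  | |- ebd _ (fun _ => ?c) => exact: ebd_cst
  | |- ebd _ (fun x => @GRing.add _ (@?f x) (@?g x)) => apply: ebdD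
  | |- ebd _ (fun x => @GRing.opp _ (@?f x)) => apply: ebdN
  | |- ebd _ (fun x => @GRing.mul _ (@?f x) (@?g x)) => apply: ebdM
  | |- ebd _ (fun x => @GRing.exp _ (@?f x) _) => apply: ebdX
  | |- ebd _ (fun x => @Num.norm _ _ (@?f x)) => apply: ebd_norm
  | |- ebd _ (fun x => bigop.body _ _ _) => apply: ebd_sum => ?
  | |- _ => first [assumption | tac | match goal with H : forall _, ebd _ _ |- _ => exact: H end]
  end.
Ltac ebd := ebd_with ltac:(fail).

Section second_moments.
Context d (T : measurableType d) (R : realType) (P : probability T R).

(** The quadratic form of the second moments of f and g is nonnegative. *)
Lemma mean_CS f g : ebd P f -> ebd P g ->
  mean P (fun x => f x * g x) ^+ 2
  <= mean P (fun x => f x ^+ 2) * mean P (fun x => g x ^+ 2).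
Proof.
move=> hf hg; set a := mean P (fun x => f x ^+ 2).
set b := mean P (fun x => f x * g x); set c := mean P (fun x => g x ^+ 2).
have hff : ebd P (fun x => f x ^+ 2) by exact: ebdX.
have hgg : ebd P (fun x => g x ^+ 2) by exact: ebdX.
have hfg : ebd P (fun x => f x * g x) by exact: ebdM.
(* With s = - b and t = a below this is the discriminant inequality; a = 0 is
   treated apart. *)
have Q (s t : R) : 0 <= s ^+ 2 * a + (2 * s * t) * b + t ^+ 2 * c.
  rewrite -!meanZ// -?meanD//; try by ebd.
  apply: mean_ge0; first by ebd.
  apply: aeW => x.
  have -> : s ^+ 2 * f x ^+ 2 + 2 * s * t * (f x * g x) + t ^+ 2 * g x ^+ 2
    = (s * f x + t * g x) ^+ 2 by ring.
  exact: sqr_ge0.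
have a0 : 0 <= a by exact: mean_sqr_ge0.
have c0 : 0 <= c by exact: mean_sqr_ge0.
have [aE|an0] := eqVneq a 0.
  have := Q (- (c + 1)) b; rewrite aE => q.
  rewrite mul0r; nra.
have := Q (- b) a => q.
have : 0 <= a * (a * c - b ^+ 2).
  by apply: le_trans q _; rewrite le_eqVlt; apply/orP; left; apply/eqP; ring.
by rewrite pmulr_rge0 ?subr_ge0// lt_def an0.
Qed.

End second_moments.

Section pushforward.
Context d1 d2 (T1 : measurableType d1) (T2 : measurableType d2) (R : realType).
Variables (P : probability T1 R) (Q : probability T2 R) (h : T1 -> T2).
Hypothesis mh : measurable_fun setT h.
Hypothesis PQ : forall B, measurable B -> P (h @^-1` B) = Q B.

Lemma ae_pushforward (A : T2 -> Prop) :
  {ae Q, forall y, A y} -> {ae P, forall x, A (h x)}.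
Proof.
move=> [N [mN QN AN]]; exists (h @^-1` N); split.
- by rewrite -[X in measurable X]setTI; exact: mh.
- by rewrite PQ.
- by move=> x /= hx; apply: AN.
Qed.

Lemma ebd_pushforward f : ebd Q f -> ebd P (fun x => f (h x)).
Proof.
move=> [mf [C hC]]; split; first exact: measurableT_comp.
by exists C; exact: (@ae_pushforward (fun y => `|f y| <= C)).
Qed.

Lemma integral_transfer (f : T2 -> \bar R) : Q.-integrable setT f ->
  (\int[Q]_y f y = \int[P]_x f (h x))%E.
Proof.
move=> fi.
have QE : forall B, measurable B -> Q B = pushforward P h B.
  by move=> B mB; rewrite /pushforward PQ.
have /integrableP[mf _] := fi.
rewrite (eq_measure_integral (pushforward P h)); last by move=> B mB _; exact: QE.
rewrite integral_pushforward// preimage_setT.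
apply/integrableP; split; first exact: measurableT_comp.
have := fi => /integrableP[_].
rewrite (eq_measure_integral (pushforward P h)); last by move=> B mB _; exact: QE.
rewrite ge0_integral_pushforward//.
exact: measurableT_comp.
Qed.

Lemma mean_pushforward f : ebd Q f -> mean P (fun x => f (h x)) = mean Q f.
Proof.
move=> hf; rewrite /mean /Rintegral.
by rewrite -(@integral_transfer (EFin \o f))//; exact: ebd_integrable.
Qed.
End pushforward.

Lemma mean_indic d (T : measurableType d) (R : realType) (P : probability T R)
    (A : set T) : measurable A -> mean P (\1_A) = fine (P A).
Proof.
by move=> mA; rewrite /mean /Rintegral integral_indic// setIT.
Qed.

Lemma ebd_indic d (T : measurableType d) (R : realType) (P : probability T R)
    (A : set T) : measurable A -> ebd P (\1_A).
Proof.
move=> mA; split; first exact: measurable_indic.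
exists 1; apply: aeW => x; rewrite indicE.
by case: (_ \in _); rewrite ?normr1 ?normr0.
Qed.

(** * Moments of sums over a sample *)

Lemma sum_CauchySchwarz (R : realFieldType) (I : finType) (a b : I -> R) :
  (\sum_i a i * b i) ^+ 2 <= (\sum_i a i ^+ 2) * (\sum_i b i ^+ 2).
Proof.
rewrite -subr_ge0.
have : 0 <= \sum_i \sum_j (a i * b j - a j * b i) ^+ 2.
  by apply: sumr_ge0 => i _; apply: sumr_ge0 => j _; exact: sqr_ge0.
have -> : \sum_i \sum_j (a i * b j - a j * b i) ^+ 2 =
   2 * ((\sum_i a i ^+ 2) * (\sum_i b i ^+ 2) - (\sum_i a i * b i) ^+ 2).
  rewrite expr2 !big_distrlr/= mulrBr mulr_sumr mulr_sumr.
  have -> : \sum_i 2 * (\sum_j a i ^+ 2 * b j ^+ 2) =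
     \sum_i (\sum_j a i ^+ 2 * b j ^+ 2) + \sum_i (\sum_j a j ^+ 2 * b i ^+ 2).
    rewrite [X in _ + X]exchange_big/= -big_split/=; apply: eq_bigr => i _.
    by ring.
  rewrite -!big_split -sumrB/=; apply: eq_bigr => i _.
  rewrite mulr_sumr -big_split -sumrB/=; apply: eq_bigr => j _.
  by ring.
by rewrite pmulr_rge0.
Qed.

Section product.
Context d1 d2 (T1 : measurableType d1) (T2 : measurableType d2) (R : realType).
Variables (P : probability T1 R) (Q : probability T2 R).
Local Notation PQ := [the probability _ _ of (P \x Q)%E].

Lemma prod_fst B : measurable B -> PQ (fst @^-1` B) = P B.
Proof.
move=> mB; have -> : fst @^-1` B = B `*` [set: T2].
  by apply/seteqP; split => -[x y] //= [].
by rewrite /= product_measure1E// [X in (_ * X)%E]probability_setT mule1.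
Qed.

Lemma prod_snd B : measurable B -> PQ (snd @^-1` B) = Q B.
Proof.
move=> mB; have -> : snd @^-1` B = [set: T1] `*` B.
  by apply/seteqP; split => -[x y] //= [].
by rewrite /= product_measure1E// [X in (X * _)%E]probability_setT mul1e.
Qed.

Lemma ebd_fst u : ebd P u -> ebd PQ (fun z => u z.1).
Proof. by apply: ebd_pushforward => //; exact: prod_fst. Qed.

Lemma ebd_snd u : ebd Q u -> ebd PQ (fun z => u z.2).
Proof. by apply: ebd_pushforward => //; exact: prod_snd. Qed.

Lemma mean_prod u v : ebd P u -> ebd Q v ->
  mean PQ (fun z => u z.1 * v z.2) = mean P u * mean Q v.
Proof.
move=> hu hv.
have huv : ebd PQ (fun z => u z.1 * v z.2).
  by apply: ebdM; [exact: ebd_fst|exact: ebd_snd].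
have iuv := ebd_integrable huv.
have iu := ebd_integrable hu; have iv := ebd_integrable hv.
transitivity (fine (\int[P]_x ((\int[Q]_y v y)%:E * (u x)%:E)%E)).
  rewrite /mean {1}/Rintegral -(integral12_prod_meas1 iuv).
  congr fine; apply: eq_integral => x _; rewrite /fubini_F/=.
  under eq_integral do rewrite EFinM.
  rewrite (integralZl measurableT iv) [RHS]muleC; congr (_ * _)%E.
  by rewrite /Rintegral fineK//; exact: (integrable_fin_num measurableT iv).
rewrite integralZl// fineM//.
  by rewrite mulrC.
exact: (integrable_fin_num measurableT iu).
Qed.

Lemma mean_fst u : ebd P u -> mean PQ (fun z => u z.1) = mean P u.
Proof.
by move=> hu; apply: (mean_pushforward _ _ hu); [done|exact: prod_fst].
Qed.

Lemma mean_snd u : ebd Q u -> mean PQ (fun z => u z.2) = mean Q u.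
Proof.
by move=> hu; apply: (mean_pushforward _ _ hu); [done|exact: prod_snd].
Qed.

End product.

Section power.
Context d (T : measurableType d) (R : realType) (P : probability T R).

Lemma pow_prob_cons n B : measurable B ->
  (P \x pow_prob P n)%E (@tuple_cons _ T n @^-1` B) = pow_prob P n.+1 B.
Proof. by []. Qed.

Lemma tnth_tuple_cons0 n (z : T * n.-tuple T) : tnth (tuple_cons z) ord0 = z.1.
Proof. by []. Qed.

Lemma tnth_tuple_consS n (z : T * n.-tuple T) i :
  tnth (tuple_cons z) (lift ord0 i) = tnth z.2 i.
Proof. by rewrite /tuple_cons tnthS. Qed.

Lemma pow_prob_tnth n (i : 'I_n) B : measurable B ->
  pow_prob P n ((fun D => tnth D i) @^-1` B) = P B.
Proof.
elim: n i => [[]//|n IHn] i mB.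
have mt (j : 'I_n.+1) : measurable ((fun D : n.+1.-tuple T => tnth D j) @^-1` B).
  by rewrite -[X in measurable X]setTI; exact: measurable_tnth.
rewrite -pow_prob_cons//; have [j ->|->] := unliftP ord0 i.
  transitivity ((P \x pow_prob P n)%E (snd @^-1` ((fun D => tnth D j) @^-1` B))).
    congr ((P \x pow_prob P n)%E _).
    by apply/seteqP; split=> z; rewrite /preimage/= tnthS.
  rewrite prod_snd ?IHn//.
  by rewrite -[X in measurable X]setTI; exact: measurable_tnth.
by rewrite -(prod_fst P (pow_prob P n) mB).
Qed.

Lemma ebd_tnth n (i : 'I_n) u : ebd P u ->
  ebd (pow_prob P n) (fun D => u (tnth D i)).
Proof.
apply: ebd_pushforward; first exact: measurable_tnth.
exact: pow_prob_tnth.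
Qed.

Lemma ae_pow n (A : T -> Prop) : {ae P, forall x, A x} ->
  {ae pow_prob P n, forall D, forall i, A (tnth D i)}.
Proof.
move=> hA; apply: filter_forall => i.
apply: (ae_pushforward _ _ hA); first exact: measurable_tnth.
exact: pow_prob_tnth.
Qed.

Lemma mean_cons n F : ebd (pow_prob P n.+1) F ->
  mean (pow_prob P n.+1) F =
  mean [the probability _ _ of (P \x pow_prob P n)%E]
    (fun z => F (tuple_cons z)).
Proof.
move=> hF; symmetry.
apply: (mean_pushforward _ _ hF) => //; exact: measurable_tuple_cons.
Qed.

Lemma mean_prod_tnth n (u : 'I_n -> T -> R) : (forall i, ebd P (u i)) ->
  mean (pow_prob P n) (fun D => \prod_i u i (tnth D i)) = \prod_i mean P (u i).
Proof.
elim: n u => [|n IHn] u hu.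
  rewrite big_ord0; under eq_mean do rewrite big_ord0.
  exact: mean_cst.
have hprod m (v : 'I_m -> T -> R) : (forall i, ebd P (v i)) ->
    ebd (pow_prob P m) (fun D => \prod_i v i (tnth D i)).
  move=> hv; elim: (index_enum _) => [|i r IHr].
    by under eq_fun do rewrite big_nil; ebd.
  by under eq_fun do rewrite big_cons; apply: ebdM => //; exact: ebd_tnth.
rewrite mean_cons//; last exact: hprod.
under eq_mean => z.
  rewrite big_ord_recl tnth_tuple_cons0.
  under eq_bigr do rewrite tnth_tuple_consS.
  over.
rewrite (@mean_prod _ _ _ _ _ _ _ (u ord0)
  (fun D => \prod_i u (lift ord0 i) (tnth D i)))//; last first.
  exact: (hprod _ (fun i => u (lift ord0 i))).
by rewrite (IHn (fun i => u (lift ord0 i)))// big_ord_recl.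
Qed.

Definition Ssum n (f : T -> R) (D : n.-tuple T) : R := \sum_i f (tnth D i).

Lemma ebd_Ssum n f : ebd P f -> ebd (pow_prob P n) (Ssum f).
Proof. by move=> hf; apply: ebd_sum => i; exact: ebd_tnth. Qed.

Lemma Ssum_cons n f (z : T * n.-tuple T) :
  Ssum f (tuple_cons z) = f z.1 + Ssum f z.2.
Proof.
rewrite /Ssum big_ord_recl tnth_tuple_cons0; congr (_ + _).
by apply: eq_bigr => i _; rewrite tnth_tuple_consS.
Qed.

Lemma Ssum0 f (D : 0.-tuple T) : Ssum f D = 0.
Proof. by rewrite /Ssum big_ord0. Qed.

End power.

Ltac ebd2 := ebd_with ltac:(first [apply: ebd_Ssum | apply: ebd_fst | apply: ebd_snd]).

Section moments.
Context d (T : measurableType d) (R : realType) (P : probability T R).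

Local Notation Pn := (pow_prob P).
Local Notation PxPn n := [the probability _ _ of (P \x pow_prob P n)%E].

Lemma mean_Ssum n f : ebd P f -> mean (Pn n) (Ssum f) = n%:R * mean P f.
Proof.
move=> hf; elim: n => [|n IHn].
  by under eq_mean do rewrite Ssum0; rewrite mean_cst mul0r.
rewrite mean_cons; last by ebd2.
under eq_mean do rewrite Ssum_cons.
rewrite meanD; [|by ebd2..].
rewrite (mean_fst _ hf) (mean_snd P (ebd_Ssum n hf)) IHn.
by rewrite -natr1; ring.
Qed.

Lemma mean_Ssum2 n f g : ebd P f -> ebd P g ->
  mean (Pn n) (fun D => Ssum f D * Ssum g D) =
  n%:R * mean P (fun x => f x * g x) + n%:R * (n%:R - 1) * (mean P f * mean P g).
Proof.
move=> hf hg; elim: n => [|n IHn].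
  by under eq_mean do rewrite Ssum0 mul0r; rewrite mean_cst !mul0r addr0.
rewrite mean_cons; last by ebd2.
under eq_mean => z.
  rewrite !Ssum_cons.
  have -> : (f z.1 + Ssum f z.2) * (g z.1 + Ssum g z.2) =
    f z.1 * g z.1 + (f z.1 * Ssum g z.2 + (g z.1 * Ssum f z.2 +
      Ssum f z.2 * Ssum g z.2)) by ring.
  over.
rewrite meanD; [|by ebd2..].
rewrite meanD; [|by ebd2..].
rewrite meanD; [|by ebd2..].
rewrite (mean_fst _ (ebdM hf hg)) !mean_prod; [|by ebd2..].
rewrite (mean_snd P (ebdM (ebd_Ssum n hf) (ebd_Ssum n hg))) IHn !mean_Ssum//.
by rewrite -natr1; ring.
Qed.

(** As q is centred and uncorrelated with f and g, only the terms where the three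
sums visit the same observation survive. *)
Lemma mean_Ssum3 n f g q : ebd P f -> ebd P g -> ebd P q ->
  mean P q = 0 -> mean P (fun x => f x * q x) = 0 ->
  mean P (fun x => g x * q x) = 0 ->
  mean (Pn n) (fun D => Ssum f D * Ssum g D * Ssum q D) =
  n%:R * mean P (fun x => f x * g x * q x).
Proof.
move=> hf hg hq q0 fq0 gq0; elim: n => [|n IHn].
  by under eq_mean do rewrite Ssum0 !mul0r; rewrite mean_cst !mul0r.
rewrite mean_cons; last by ebd2.
under eq_mean => z.
  rewrite !Ssum_cons.
  have -> : (f z.1 + Ssum f z.2) * (g z.1 + Ssum g z.2) * (q z.1 + Ssum q z.2) =
    f z.1 * g z.1 * q z.1 + (f z.1 * q z.1 * Ssum g z.2 +
    (g z.1 * q z.1 * Ssum f z.2 + (q z.1 * (Ssum f z.2 * Ssum g z.2) +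
    (f z.1 * g z.1 * Ssum q z.2 + (f z.1 * (Ssum g z.2 * Ssum q z.2) +
     (g z.1 * (Ssum f z.2 * Ssum q z.2) +
     Ssum f z.2 * Ssum g z.2 * Ssum q z.2)))))) by ring.
  over.
do 7 (rewrite meanD; [|by ebd2..]).
have hS h : ebd P h -> ebd (Pn n) (Ssum h) by exact: ebd_Ssum.
rewrite (mean_fst _ (ebdM (ebdM hf hg) hq)).
rewrite (mean_prod (ebdM hf hq) (hS _ hg)) (mean_prod (ebdM hg hq) (hS _ hf)).
rewrite (mean_prod hq (ebdM (hS _ hf) (hS _ hg))).
rewrite (mean_prod (ebdM hf hg) (hS _ hq)).
rewrite (mean_prod hf (ebdM (hS _ hg) (hS _ hq))).
rewrite (mean_prod hg (ebdM (hS _ hf) (hS _ hq))).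
rewrite (mean_snd P (ebdM (ebdM (hS _ hf) (hS _ hg)) (hS _ hq))) IHn.
rewrite !mean_Ssum2// (mean_Ssum n hq) q0 fq0 gq0.
by rewrite -natr1; ring.
Qed.

Section fourth.
Variables (I : finType) (f : I -> T -> R) (B : R).
Hypotheses (hf : forall i, ebd P (f i)) (f0 : forall i, mean P (f i) = 0).
Hypothesis fB : {ae P, forall x, \sum_i f i x ^+ 2 <= B}.

Definition sqnorm n (D : n.-tuple T) : R := \sum_i Ssum (f i) D ^+ 2.

Lemma ebd_sqnorm n : ebd (Pn n) (@sqnorm n).
Proof. by apply: ebd_sum => i; apply: ebdX; exact: ebd_Ssum. Qed.

Lemma sqnorm_ge0 n (D : n.-tuple T) : 0 <= sqnorm D.
Proof. by apply: sumr_ge0 => i _; exact: sqr_ge0. Qed.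

Lemma mean_sqnorm n : mean (Pn n) (@sqnorm n) <= n%:R * B.
Proof.
rewrite mean_sum; last by move=> i; ebd2.
under eq_bigr => i _.
  under eq_mean do rewrite expr2.
  rewrite (mean_Ssum2 n (hf i) (hf i)) f0 !mulr0 addr0.
  over.
rewrite -mulr_sumr ler_wpM2l// -mean_sum; last by move=> i; ebd2.
rewrite -[leRHS](mean_cst P).
apply: le_mean; [by ebd2|by ebd2|].
by apply: filterS fB => x; under eq_bigr do rewrite expr2.
Qed.

(** Induction on the sample size. A new observation x turns the squared norm N
into r + 2 L + N, where r is at most B, L is linear in the old sums and, by
Cauchy-Schwarz, L ^ 2 <= r N; the terms in L N and r L have mean zero. The factor
3 is the one of a Gaussian fourth moment. *)
Lemma mean_sqnorm2 n :
  mean (Pn n) (fun D => sqnorm D ^+ 2) <= 3 * n%:R ^+ 2 * B ^+ 2.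
Proof.
have hN m : ebd (Pn m) (@sqnorm m) by exact: ebd_sqnorm.
elim: n => [|n IHn].
  rewrite (eq_mean _ (g := fun=> 0)) ?mean_cst ?expr0n/= ?mulr0 ?mul0r// => D.
  by rewrite /sqnorm big1 ?expr0n//= => i _; rewrite Ssum0 expr0n.
rewrite mean_cons; last by ebd2.
pose r x := \sum_i f i x ^+ 2.
have hr : ebd P r by rewrite /r; ebd2.
pose G (z : T * n.-tuple T) := sqnorm z.2 ^+ 2 + (6 * B * sqnorm z.2 + (B ^+ 2 +
  (\sum_i f i z.1 * (4 * (Ssum (f i) z.2 * sqnorm z.2)) +
   \sum_i (4 * f i z.1 * r z.1) * Ssum (f i) z.2))).
have hrB : {ae PxPn n, forall z, r z.1 <= B}.
  by apply: (ae_pushforward _ _ fB) => //; exact: prod_fst.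
apply: (@le_trans _ _ (mean (PxPn n) G)).
  apply: le_mean.
  - apply: (@ebd_pushforward _ _ _ _ _ (PxPn n) (Pn n.+1) _ _ _ (fun D => sqnorm D ^+ 2)) => //.
    exact: (ebdX 2 (hN n.+1)).
  - by rewrite /G; ebd2.
  apply: filterS hrB => z rB.
  set N := sqnorm z.2.
  pose L := \sum_i f i z.1 * Ssum (f i) z.2.
  have -> : sqnorm (tuple_cons z) = r z.1 + 2 * L + N.
    rewrite /sqnorm /r /L mulr_sumr -!big_split/=; apply: eq_bigr => i _.
    by rewrite Ssum_cons; ring.
  have -> : G z = N ^+ 2 + (6 * B * N + (B ^+ 2 + (4 * L * N + 4 * r z.1 * L))).
    rewrite /G -/N; do 3 congr (_ + _).
    rewrite /L; congr (_ + _); rewrite mulr_sumr ?mulr_suml; apply: eq_bigr => i _; ring.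
  have LrN : L ^+ 2 <= r z.1 * N by exact: sum_CauchySchwarz.
  have N0 : 0 <= N by exact: sqnorm_ge0.
  have r0 : 0 <= r z.1 by apply: sumr_ge0 => i _; exact: sqr_ge0.
  have : r z.1 * N <= B * N by rewrite ler_wpM2r.
  have : r z.1 ^+ 2 <= B ^+ 2 by rewrite lerXn2r// nnegrE (le_trans r0).
  move: LrN; move: (r z.1) => r1; clear; nra.
have E1 : mean (PxPn n)
    (fun z => \sum_i f i z.1 * (4 * (Ssum (f i) z.2 * sqnorm z.2))) = 0.
  rewrite mean_sum; last by move=> i; ebd2.
  apply: big1 => i _.
  rewrite (@mean_prod _ _ _ _ _ _ _ (f i) (fun D => 4 * (Ssum (f i) D * sqnorm D)));
    [|by ebd2..].
  by rewrite f0 mul0r.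
have E2 : mean (PxPn n)
    (fun z => \sum_i (4 * f i z.1 * r z.1) * Ssum (f i) z.2) = 0.
  rewrite mean_sum; last by move=> i; ebd2.
  apply: big1 => i _.
  rewrite (@mean_prod _ _ _ _ _ _ _ (fun x => 4 * f i x * r x)); [|by ebd2..].
  by rewrite (mean_Ssum n (hf i)) f0 !mulr0.
rewrite /G.
do 4 (rewrite meanD; [|by ebd2..]).
rewrite mean_cst meanZ; last by ebd2.
rewrite (mean_snd P (ebdX 2 (hN n))) (mean_snd P (hN n)).
rewrite E1 E2 !addr0.
have B0 : 0 <= B.
  have := @mean_ge0 _ _ _ P r hr _; rewrite /r => h.
  apply: (le_trans (h _)); first by apply: aeW => x; apply: sumr_ge0 => i _; exact: sqr_ge0.
  by rewrite -[leRHS](mean_cst P); apply: le_mean => //; ebd2.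
have : 6 * B * mean (Pn n) (@sqnorm n) <= 6 * B * (n%:R * B).
  by rewrite ler_wpM2l ?mulr_ge0// mean_sqnorm.
move: IHn; rewrite -[n.+1%:R]natr1.
move: (mean (Pn n) _) (mean (Pn n) _) (n%:R : R) B0 => m1 m2 t _; have := sqr_ge0 B; nra.
Qed.

End fourth.
End moments.

(** * Risk of a quadratic plug-in statistic *)

Section statistic.
Context d (T : measurableType d) (R : realType) (P : probability T R).
Variables (I : finType) (h : T -> R) (f g : I -> T -> R).

(** The products of empirical means keep the pairs of equal observations, as an
estimator without sample splitting does. *)
Definition plugin n (D : n.-tuple T) : R :=
  n%:R^-1 * Ssum h D
  - \sum_i (n%:R^-1 * Ssum (f i) D) * (n%:R^-1 * Ssum (g i) D).

Hypotheses (hh : ebd P h) (hf : forall i, ebd P (f i))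
  (hg : forall i, ebd P (g i)).

Local Notation Pn := (pow_prob P).

Lemma ebd_plugin n : ebd (Pn n) (@plugin n).
Proof. by rewrite /plugin; ebd2. Qed.

(** Of the n ^ 2 pairs of observations in a product of empirical means, the n
diagonal ones contribute the mean of the product instead of the product of the
means. *)
Lemma mean_plugin n : (0 < n)%N -> mean (Pn n) (@plugin n) =
  mean P h - (1 - n%:R^-1) * (\sum_i mean P (f i) * mean P (g i))
  - n%:R^-1 * \sum_i mean P (fun x => f i x * g i x).
Proof.
move=> n0; have n0' : n%:R != 0 :> R by rewrite pnatr_eq0 -lt0n.
rewrite /plugin meanB; [|by ebd2..].
rewrite meanZ; last by ebd2.
rewrite mean_Ssum// mulKf// -addrA; congr (_ + _).
rewrite mean_sum; last by move=> i; ebd2.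
rewrite -opprD; congr (- _); rewrite !mulr_sumr -big_split/=.
apply: eq_bigr => i _.
under eq_mean => D.
  have -> : n%:R^-1 * Ssum (f i) D * (n%:R^-1 * Ssum (g i) D) =
    n%:R^-1 ^+ 2 * (Ssum (f i) D * Ssum (g i) D) by ring.
  over.
rewrite meanZ; last by ebd2.
by rewrite mean_Ssum2//; field.
Qed.

Lemma mean_plugin_cov n q : (0 < n)%N -> ebd P q -> mean P q = 0 ->
  (forall i, mean P (fun x => f i x * q x) = 0) ->
  (forall i, mean P (fun x => g i x * q x) = 0) ->
  mean (Pn n) (fun D => plugin D * Ssum q D) =
  mean P (fun x => h x * q x)
  - n%:R^-1 * \sum_i mean P (fun x => f i x * g i x * q x).
Proof.
move=> n0 hq q0 fq0 gq0.
have n0' : n%:R != 0 :> R by rewrite pnatr_eq0 -lt0n.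
under eq_mean => D.
  rewrite /plugin mulrBl mulr_suml -mulrA.
  under eq_bigr => i _.
    have -> : n%:R^-1 * Ssum (f i) D * (n%:R^-1 * Ssum (g i) D) * Ssum q D =
      n%:R^-1 ^+ 2 * (Ssum (f i) D * Ssum (g i) D * Ssum q D) by ring.
    over.
  over.
rewrite /= meanB; [|by ebd2..].
rewrite meanZ; last by ebd2.
rewrite mean_Ssum2// q0 !mulr0 addr0 mulKf//; congr (_ - _).
rewrite mean_sum; last by move=> i; ebd2.
rewrite mulr_sumr; apply: eq_bigr => i _.
rewrite meanZ; last by ebd2.
by rewrite mean_Ssum3//; field.
Qed.

Lemma risk_ge_bias n (c : R) :
  (mean (Pn n) (@plugin n) - c) ^+ 2
  <= mean (Pn n) (fun D => (plugin D - c) ^+ 2).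
Proof.
have hp := ebd_plugin n.
have := mean_CS (ebdB hp (ebd_cst _ c)) (ebd_cst (Pn n) 1).
under eq_mean do rewrite mulr1.
rewrite meanB//; last exact: ebd_cst.
rewrite (mean_cst _ c) => /le_trans; apply.
by rewrite expr1n mean_cst mulr1.
Qed.

(** Cauchy-Schwarz with the sum of a centred q, which does not see the constant
c. *)
Lemma risk_ge_cov n (c : R) q : (0 < n)%N -> ebd P q -> mean P q = 0 ->
  mean (Pn n) (fun D => plugin D * Ssum q D) ^+ 2
  <= mean (Pn n) (fun D => (plugin D - c) ^+ 2)
     * (n%:R * mean P (fun x => q x ^+ 2)).
Proof.
move=> n0 hq q0; have hp := ebd_plugin n; have hS := ebd_Ssum n hq.
have := mean_CS (ebdB hp (ebd_cst _ c)) hS.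
under eq_mean do rewrite mulrBl.
rewrite meanB; [|by ebd2..].
rewrite meanZ// mean_Ssum// q0 !mulr0 subr0 => /le_trans; apply.
rewrite le_eqVlt; apply/orP; left; apply/eqP; congr (_ * _).
under eq_mean do rewrite expr2.
by rewrite mean_Ssum2// q0 !mulr0 addr0; congr (_ * _).
Qed.

Lemma mean_centered u : ebd P u -> mean P (fun x => u x - mean P u) = 0.
Proof.
by move=> hu; rewrite meanB ?mean_cst ?subrr//; exact: ebd_cst.
Qed.

Lemma mean_Ssum_centered n u : ebd P u ->
  mean (Pn n) (fun D => Ssum (fun x => u x - mean P u) D ^+ 2)
  <= n%:R * mean P (fun x => u x ^+ 2).
Proof.
move=> hu; under eq_mean do rewrite expr2.
have hc : ebd P (fun x => u x - mean P u) by ebd2.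
rewrite mean_Ssum2// mean_centered// !mulr0 addr0 ler_wpM2l//.
under eq_mean => x.
  have -> : (u x - mean P u) * (u x - mean P u) =
    u x ^+ 2 + (- (2 * mean P u)) * u x + mean P u ^+ 2 by ring.
  over.
rewrite meanD; [|by ebd2..].
rewrite meanD; [|by ebd2..].
rewrite mean_cst meanZ//.
have := sqr_ge0 (mean P u).
by move: (mean P u) => m ?; nra.
Qed.

Lemma Ssum_centered n (u : T -> R) (D : n.-tuple T) (c : R) :
  Ssum (fun x => u x - c) D = Ssum u D - n%:R * c.
Proof.
by rewrite /Ssum sumrB sumr_const card_ord mulr_natl.
Qed.

(** (u - m) ^ 2 <= 2 u ^ 2 + 2 m ^ 2, and the squared means are at most the
means of the squares. *)
Lemma sum_centered_le (F : I -> T -> R) (B : R) : (forall i, ebd P (F i)) ->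
  {ae P, forall x, \sum_i F i x ^+ 2 <= B} ->
  {ae P, forall x, \sum_i (F i x - mean P (F i)) ^+ 2 <= 4 * B}.
Proof.
move=> hF FB.
have mF : \sum_i mean P (F i) ^+ 2 <= B.
  rewrite -[leRHS](mean_cst P).
  apply: (@le_trans _ _ (mean P (fun x => \sum_i F i x ^+ 2))); last first.
    by apply: le_mean => //; ebd2.
  rewrite mean_sum; last by move=> i; ebd2.
  apply: ler_sum => i _.
  have := mean_CS (hF i) (ebd_cst P 1).
  under eq_mean do rewrite mulr1.
  by rewrite expr1n mean_cst mulr1.
apply: filterS FB => x xB.
apply: (@le_trans _ _ (2 * \sum_i F i x ^+ 2 + 2 * \sum_i mean P (F i) ^+ 2)).
  rewrite !mulr_sumr -big_split/=; apply: ler_sum => i _.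
  have := sqr_ge0 (F i x + mean P (F i)).
  by move: (F i x) (mean P (F i)) => a b; nra.
by lra.
Qed.

(** Hoeffding decomposition into the bias, three centred linear statistics and
the product of two vectors of centred empirical means. The factor 5 counts these
terms; 48 = 3 * 4 ^ 2 combines the fourth moment bound [mean_sqnorm2] with the
loss of 4 in centring. *)
Lemma risk_le n (c B : R) : (0 < n)%N ->
  {ae P, forall x, \sum_i f i x ^+ 2 <= B} ->
  {ae P, forall x, \sum_i g i x ^+ 2 <= B} ->
  mean (Pn n) (fun D => (plugin D - c) ^+ 2) <=
  5 * ((mean P h - \sum_i mean P (f i) * mean P (g i) - c) ^+ 2
       + n%:R^-1 * (mean P (fun x => h x ^+ 2)
         + mean P (fun x => (\sum_i mean P (f i) * g i x) ^+ 2)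
         + mean P (fun x => (\sum_i mean P (g i) * f i x) ^+ 2))
       + 48 * (B / n%:R) ^+ 2).
Proof.
move=> n0 fB gB.
have n0' : n%:R != 0 :> R by rewrite pnatr_eq0 -lt0n.
pose w x := \sum_i mean P (f i) * g i x.
pose v x := \sum_i mean P (g i) * f i x.
have hw : ebd P w by rewrite /w; ebd2.
have hv : ebd P v by rewrite /v; ebd2.
pose fc i x := f i x - mean P (f i).
pose gc i x := g i x - mean P (g i).
have hfc i : ebd P (fc i) by rewrite /fc; ebd2.
have hgc i : ebd P (gc i) by rewrite /gc; ebd2.
pose ctr u (D : n.-tuple T) := n%:R^-1 * Ssum (fun x => u x - mean P u) D.
have hctr u : ebd P u -> ebd (Pn n) (ctr u) by move=> hu; rewrite /ctr; ebd2.
pose N (F : I -> T -> R) (D : n.-tuple T) := sqnorm F D.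
have hN F : (forall i, ebd P (F i)) -> ebd (Pn n) (N F).
  by move=> hF; exact: ebd_sqnorm.
pose b := mean P h - \sum_i mean P (f i) * mean P (g i) - c.
have mctr u : ebd P u ->
    mean (Pn n) (fun D => ctr u D ^+ 2) <= n%:R^-1 * mean P (fun x => u x ^+ 2).
  move=> hu; rewrite /ctr; under eq_mean do rewrite exprMn.
  rewrite meanZ; last by ebd2.
  have -> : n%:R^-1 * mean P (fun x => u x ^+ 2) =
    n%:R^-1 ^+ 2 * (n%:R * mean P (fun x => u x ^+ 2)) by field.
  by rewrite ler_wpM2l ?sqr_ge0// mean_Ssum_centered.
have decomp D : plugin D - c = b + ctr h D - ctr w D - ctr v D
    - n%:R^-1 ^+ 2 * \sum_i Ssum (fc i) D * Ssum (gc i) D.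
  rewrite /plugin /b /ctr /fc /gc !Ssum_centered.
  have Sw : Ssum w D = \sum_i mean P (f i) * Ssum (g i) D.
    rewrite /Ssum /w exchange_big/=; apply: eq_bigr => i _.
    by rewrite mulr_sumr.
  have Sv : Ssum v D = \sum_i mean P (g i) * Ssum (f i) D.
    rewrite /Ssum /v exchange_big/=; apply: eq_bigr => i _.
    by rewrite mulr_sumr.
  have mw : mean P w = \sum_i mean P (f i) * mean P (g i).
    rewrite /w mean_sum; last by move=> i; ebd2.
    by apply: eq_bigr => i _; rewrite meanZ.
  have mv : mean P v = \sum_i mean P (f i) * mean P (g i).
    rewrite /v mean_sum; last by move=> i; ebd2.
    by apply: eq_bigr => i _; rewrite meanZ// mulrC.
  rewrite Sw Sv mw mv.
  have -> : \sum_i (n%:R^-1 * Ssum (f i) D) * (n%:R^-1 * Ssum (g i) D) =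
    n%:R^-1 * (\sum_i mean P (f i) * Ssum (g i) D)
    + n%:R^-1 * (\sum_i mean P (g i) * Ssum (f i) D)
    - \sum_i mean P (f i) * mean P (g i)
    + n%:R^-1 ^+ 2 * \sum_i (Ssum (fun x => f i x - mean P (f i)) D *
         Ssum (fun x => g i x - mean P (g i)) D).
    rewrite !mulr_sumr -!big_split -sumrB -big_split/=.
    by apply: eq_bigr => i _; rewrite !Ssum_centered; field.
  set s := n%:R^-1 ^+ 2 * _.
  rewrite -!/(Ssum _ _).
  by field.
pose G D := 5 * (b ^+ 2 + ctr h D ^+ 2 + ctr w D ^+ 2 + ctr v D ^+ 2
   + n%:R^-1 ^+ 4 / 2 * (N fc D ^+ 2 + N gc D ^+ 2)).
apply: (@le_trans _ _ (mean (Pn n) G)).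
  apply: le_mean.
  - by have := ebd_plugin n => ?; ebd2.
  - by rewrite /G; ebd_with ltac:(first [apply: hctr|apply: hN]).
  apply: aeW => D; rewrite decomp /G.
  set s := \sum_i _.
  have sN : (n%:R^-1 ^+ 2 * s) ^+ 2 <=
      n%:R^-1 ^+ 4 / 2 * (N fc D ^+ 2 + N gc D ^+ 2).
    have -> : (n%:R^-1 ^+ 2 * s) ^+ 2 = n%:R^-1 ^+ 4 * s ^+ 2 by ring.
    rewrite -mulrA ler_wpM2l ?exprn_ge0 ?invr_ge0//.
    have : s ^+ 2 <= N fc D * N gc D by exact: sum_CauchySchwarz.
    have := sqr_ge0 (N fc D - N gc D).
    by move: (N fc D) (N gc D) => x y; nra.
  move: sN; move: (n%:R^-1 ^+ 2 * s) (n%:R^-1 ^+ 4 / 2 * _) => t z tz.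
  have five (x1 x2 x3 x4 x5 : R) : (x1 + x2 - x3 - x4 - x5) ^+ 2 <=
      5 * (x1 ^+ 2 + x2 ^+ 2 + x3 ^+ 2 + x4 ^+ 2 + x5 ^+ 2).
    rewrite -subr_ge0.
    have -> : 5 * (x1 ^+ 2 + x2 ^+ 2 + x3 ^+ 2 + x4 ^+ 2 + x5 ^+ 2)
        - (x1 + x2 - x3 - x4 - x5) ^+ 2
      = (x1 - x2) ^+ 2 + (x1 + x3) ^+ 2 + (x1 + x4) ^+ 2 + (x1 + x5) ^+ 2
        + (x2 + x3) ^+ 2 + (x2 + x4) ^+ 2 + (x2 + x5) ^+ 2
        + (x3 - x4) ^+ 2 + (x3 - x5) ^+ 2 + (x4 - x5) ^+ 2 by ring.
    by rewrite !addr_ge0 ?sqr_ge0.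
  by apply: (le_trans (five _ _ _ _ _)); rewrite ler_wpM2l// lerD2l.
have mG : mean (Pn n) G = 5 * (b ^+ 2 + mean (Pn n) (fun D => ctr h D ^+ 2)
   + mean (Pn n) (fun D => ctr w D ^+ 2) + mean (Pn n) (fun D => ctr v D ^+ 2)
   + n%:R^-1 ^+ 4 / 2 * (mean (Pn n) (fun D => N fc D ^+ 2)
       + mean (Pn n) (fun D => N gc D ^+ 2))).
  have e1 := hctr _ hh; have e2 := hctr _ hw; have e3 := hctr _ hv.
  have e4 := hN _ hfc; have e5 := hN _ hgc.
  rewrite /G meanZ; last by ebd2.
  do 4 (rewrite meanD; [|by ebd2..]).
  rewrite mean_cst meanZ; last by ebd2.
  by rewrite meanD //; ebd2.
rewrite mG ler_wpM2l//.
have mh2 := mctr _ hh; have mw2 := mctr _ hw; have mv2 := mctr _ hv.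
have mfc i : mean P (fc i) = 0 by exact: mean_centered.
have mgc i : mean P (gc i) = 0 by exact: mean_centered.
have Nf := mean_sqnorm2 hfc mfc (sum_centered_le hf fB) n.
have Ng := mean_sqnorm2 hgc mgc (sum_centered_le hg gB) n.
have NN : n%:R^-1 ^+ 4 / 2 * (mean (Pn n) (fun D => N fc D ^+ 2)
       + mean (Pn n) (fun D => N gc D ^+ 2)) <= 48 * (B / n%:R) ^+ 2.
  apply: (@le_trans _ _ (n%:R^-1 ^+ 4 / 2 * (3 * n%:R ^+ 2 * (4 * B) ^+ 2
    + 3 * n%:R ^+ 2 * (4 * B) ^+ 2))).
    apply: ler_wpM2l; last exact: lerD Nf Ng.
    by rewrite mulr_ge0 ?exprn_ge0 ?invr_ge0.
  by rewrite le_eqVlt; apply/orP; left; apply/eqP; field.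
apply: lerD; last exact: NN.
rewrite -/b mulrDr mulrDr !addrA.
apply: lerD; last exact: mv2.
apply: lerD; last exact: mw2.
by apply: lerD; last exact: mh2.
Qed.

End statistic.

(** * Conditional expectations given X *)

Lemma integral_transfer_in d1 d2 (T1 : measurableType d1)
    (T2 : measurableType d2) (R : realType)
    (P : probability T1 R) (Q : probability T2 R) (h : T1 -> T2) D
    (f : T2 -> \bar R) :
  measurable_fun setT h ->
  (forall B, measurable B -> P (h @^-1` B) = Q B) ->
  measurable D -> Q.-integrable setT f ->
  (\int[Q]_(y in D) f y = \int[P]_(x in h @^-1` D) f (h x))%E.
Proof.
move=> mh PQ mD fi; rewrite integral_mkcond [RHS]integral_mkcond.
rewrite (integral_transfer mh PQ).
  by apply: eq_integral => x _; rewrite !patchE/=.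
apply/(integrable_mkcond _ _).1 => //.
exact: integrableS fi.
Qed.

Section cond_exp.
Context (R : realType) (d : nat).
Variable P : probability (obs R d) R.
Local Notation U := (unif_cube R d).
Hypothesis PX : forall B, measurable B -> P (@obsX R d @^-1` B) = U B.

Lemma measurable_obsX : measurable_fun setT (@obsX R d).
Proof. exact: measurableT_comp. Qed.

Lemma measurable_obsA : measurable_fun setT (@obsA R d).
Proof. exact: measurableT_comp. Qed.

Lemma measurable_obsY : measurable_fun setT (@obsY R d).
Proof. exact: measurable_snd. Qed.

Lemma measurable_preX B : measurable B -> measurable (@obsX R d @^-1` B).
Proof. by move=> mB; rewrite -[X in measurable X]setTI; exact: measurable_obsX. Qed.

Lemma ebd_X w : ebd U w -> ebd P (fun o => w (obsX o)).
Proof. exact: (ebd_pushforward measurable_obsX PX). Qed.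

Lemma mean_X w : ebd U w -> mean P (fun o => w (obsX o)) = mean U w.
Proof. exact: (mean_pushforward measurable_obsX PX). Qed.

(** Radon-Nikodym derivative, with respect to the law of X, of the image under X
of the charge of density T. *)
Lemma cond_exp_exists T : ebd P T -> exists g, is_cond_exp P T g.
Proof.
move=> hT; have iT := ebd_integrable hT.
pose nu := pushforward (induced_charge iT) (@obsX R d).
have nuU : nu `<< U.
  apply/null_content_dominatesP => A mA UA.
  rewrite /nu /pushforward /induced_charge.
  apply: null_set_integral; first exact: measurable_preX.
    apply: measurable_funTS; exact: measurable_int iT.
  exact: etrans (PX mA) UA.
pose nuc' : {charge set _ -> \bar R} := nu.
pose nuc := nuc' measurable_obsX.
pose g x := fine (Radon_Nikodym nuc U x).
have gE x : (g x)%:E = Radon_Nikodym nuc U x.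
  by rewrite fineK//; exact: Radon_Nikodym_fin_num.
have gi : U.-integrable setT (EFin \o g).
  rewrite (_ : EFin \o g = Radon_Nikodym nuc U); last exact/funext.
  exact: Radon_Nikodym_integrable.
have gm : measurable_fun setT g by apply/measurable_EFinP; exact: measurable_int gi.
exists g; split => //.
- apply/integrableP; split.
    by apply: measurableT_comp => //; apply: measurableT_comp => //; exact: measurable_obsX.
  have /integrableP[_] := gi.
  by rewrite -(integral_transfer measurable_obsX PX (integrable_abse gi)).
- move=> B mB.
  rewrite -(integral_transfer_in measurable_obsX PX mB gi).
  under [RHS]eq_integral do rewrite /= gE.
  by rewrite -Radon_Nikodym_integral.
Qed.

Lemma cond_expP T : ebd P T -> is_cond_exp P T (cond_exp P T).
Proof.
by move=> /cond_exp_exists h; rewrite /cond_exp; exact: xgetPex.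
Qed.

Section bounds.
Variables (T : obs R d -> R) (g : Rpt R d -> R).
Hypothesis Tg : is_cond_exp P T g.

(** On the event that g exceeds c, the integral of g - c is that of T - c, hence
nonpositive; being the integral of a positive function, it forces the event to be
null. *)
Lemma cond_exp_ub (c : R) : {ae P, forall o, T o <= c} -> {ae U, forall x, g x <= c}.
Proof.
case: Tg => iT mg ig TgE Tc.
pose B : set (Rpt R d) := [set x | c < g x].
have mB : measurable B.
  rewrite /B -[X in measurable X]setTI.
  by apply: measurable_fun_ltr => //; exact: measurable_cst.
have mXB := measurable_preX mB.
exists B; split => //; last by move=> x /= /negP; rewrite -ltNge.
rewrite -PX//.
have ic : P.-integrable (@obsX R d @^-1` B) (EFin \o cst c).
  apply: (integrableS measurableT) => //; exact: (ebd_integrable (ebd_cst P c)).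
have igB := integrableS measurableT mXB (@subsetT _ _) ig.
have iTB := integrableS measurableT mXB (@subsetT _ _) iT.
have igc : P.-integrable (@obsX R d @^-1` B)
    (fun o => (g (obsX o))%:E - c%:E)%E by exact: integrableB.
have iTc : P.-integrable (@obsX R d @^-1` B) (fun o => (T o)%:E - c%:E)%E.
  exact: integrableB.
have mTc := measurable_int _ iTc.
have le0 : (\int[P]_(o in @obsX R d @^-1` B) ((g (obsX o))%:E - c%:E) <= 0)%E.
  rewrite integralB// -TgE// -integralB//.
  rewrite -oppe_ge0 -integralN; last first.
    exact: integrable_add_def.
  have -> : (\int[P]_(o in @obsX R d @^-1` B) - ((T o)%:E - c%:E)
    = \int[P]_(o in @obsX R d @^-1` B) `|((T o)%:E - c%:E)|)%E.
    apply: ae_eq_integral => //.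
    - exact: measurableT_comp.
    - exact: measurableT_comp.
    - apply: filterS Tc => o To _ /=.
      by rewrite ler0_norm ?subr_le0.
  by apply: integral_ge0 => o _; exact: abse_ge0.
have eq0 : (\int[P]_(o in @obsX R d @^-1` B) `|(g (obsX o))%:E - c%:E| = 0)%E.
  apply/eqP; rewrite eq_le; apply/andP; split; last first.
    by apply: integral_ge0 => o _; exact: abse_ge0.
  apply: le_trans le0; rewrite le_eqVlt; apply/orP; left; apply/eqP.
  apply: eq_integral => o; rewrite inE/= => oB.
  by rewrite gtr0_norm ?subr_gt0.
have mgc := measurable_int _ igc.
have /(ae_eq_integral_abs _ mXB mgc) := eq0.
move=> [N [mN PN BN]].
apply: (subset_measure0 _ mN _ PN) => // o oB.
apply: BN => /= /(_ oB) /eqP.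
rewrite -EFinD eqe subr_eq0 => /eqP goc.
by move: oB; rewrite /B/= goc ltxx.
Qed.

End bounds.

Lemma is_cond_expN T g : is_cond_exp P T g ->
  is_cond_exp P (fun o => - T o) (fun x => - g x).
Proof.
move=> [iT mg ig TgE]; split.
- rewrite (_ : EFin \o _ = (\- (EFin \o T))%E); last exact/funext.
  exact: integrableN.
- exact: measurableT_comp.
- rewrite (_ : EFin \o _ = (\- (EFin \o (g \o @obsX R d)))%E); last exact/funext.
  exact: integrableN.
- move=> B mB; have mXB := measurable_preX mB.
  have igB := integrableS measurableT mXB (@subsetT _ _) ig.
  have iTB := integrableS measurableT mXB (@subsetT _ _) iT.
  under eq_integral do rewrite EFinN.
  under [RHS]eq_integral do rewrite EFinN.
  rewrite integralN; last exact: integrable_add_def.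
  rewrite integralN; last exact: integrable_add_def.
  by rewrite TgE.
Qed.

Lemma cond_exp_lb T g (c : R) : is_cond_exp P T g ->
  {ae P, forall o, c <= T o} -> {ae U, forall x, c <= g x}.
Proof.
move=> /is_cond_expN /cond_exp_ub h cT.
have : {ae P, forall o, - T o <= - c} by apply: filterS cT => o; rewrite lerN2.
by move=> /h; apply: filterS => x; rewrite lerN2.
Qed.

Lemma cond_exp_ebd T g : ebd P T -> is_cond_exp P T g -> ebd U g.
Proof.
move=> [mT [C TC]] Tg; have [_ mg _ _] := Tg; split => //.
exists C.
have /(cond_exp_ub Tg) h1 : {ae P, forall o, T o <= C}.
  by apply: filterS TC => o; rewrite ler_norml => /andP[].
have /(cond_exp_lb Tg) h2 : {ae P, forall o, - C <= T o}.
  by apply: filterS TC => o; rewrite ler_norml => /andP[].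
by apply: filterS2 h1 h2 => x x1 x2; rewrite ler_norml x1 x2.
Qed.

Lemma mean_indic_X T B : ebd P T -> measurable B ->
  (mean P (fun o => T o * \1_B (obsX o)))%:E
  = (\int[P]_(o in @obsX R d @^-1` B) (T o)%:E)%E.
Proof.
move=> hT mB; have mXB := measurable_preX mB.
rewrite integral_mkcond /mean /Rintegral fineK.
  apply: eq_integral => o _; rewrite patchE indicE/=.
  have -> : (o \in @obsX R d @^-1` B) = (obsX o \in B).
    by apply/idP/idP; rewrite !inE.
  by case: (_ \in _); rewrite ?mulr1 ?mulr0.
apply: integrable_fin_num => //.
apply: (ebd_integrable (f := fun o => T o * \1_B (obsX o))).
by apply: ebdM => //; exact: ebd_X (ebd_indic U mB).
Qed.

(** Passage from indicators to bounded functions: w is within e of a finite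
combination of the indicators of the sets where w + C lies between consecutive
multiples of e. *)
Lemma mean_mul_X_eq0 Z w : ebd P Z -> ebd U w ->
  (forall B, measurable B -> mean P (fun o => Z o * \1_B (obsX o)) = 0) ->
  mean P (fun o => Z o * w (obsX o)) = 0.
Proof.
move=> hZ hw Z0; have [mw [C wC]] := hw.
have hwX := ebd_X hw.
have hZn := ebd_norm hZ.
suff key (e : R) : 0 < e ->
    `|mean P (fun o => Z o * w (obsX o))| <= e * mean P (fun o => `|Z o|).
  apply/eqP; rewrite -normr_le0; apply/ler_addgt0Pl => e e0.
  have Z1 : 0 < mean P (fun o => `|Z o|) + 1.
    by rewrite ltr_wpDl// mean_ge0//; apply: aeW => o.
  have := key (e / (mean P (fun o => `|Z o|) + 1)) (divr_gt0 e0 Z1).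
  move=> /le_trans; apply; rewrite addr0 mulrAC ler_pdivrMr// ler_pM2l//.
  by rewrite lerDl.
move=> e0.
(* w + C takes values in [0, 2 C]. *)
pose K := (Num.truncn ((C + C) / e)).+1.
pose B (k : 'I_K) : set (Rpt R d) := [set x | k%:R * e <= w x + C < k.+1%:R * e].
have mwC : measurable_fun setT (fun x => w x + C) by exact: measurable_funD.
have mB k : measurable (B k).
  have -> : B k = (fun x => w x + C) @^-1` `[k%:R * e, k.+1%:R * e[%classic.
    by apply/seteqP; split => x /=; rewrite in_itv.
  by rewrite -[X in measurable X]setTI; exact: mwC.
have h1 A : measurable A -> ebd P (fun o => \1_A (obsX o : Rpt R d) : R).
  by move=> mA; exact: ebd_X (ebd_indic U mA).
pose wN o := \sum_(k < K) (k%:R * e - C) * \1_(B k) (obsX o).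
have hB k := h1 _ (mB k).
have hwN : ebd P wN by rewrite /wN; ebd2.
have ZwN : mean P (fun o => Z o * wN o) = 0.
  under eq_mean => o.
    rewrite /wN mulr_sumr.
    under eq_bigr do rewrite mulrCA.
    over.
  rewrite mean_sum; last by move=> k; ebd2.
  apply: big1 => k _; rewrite meanZ; last by ebd2.
  by rewrite Z0// mulr0.
rewrite -[X in `|X|]subr0 -ZwN -meanB; [|by ebd2..].
apply: (le_trans (ler_norm_mean _)); first by ebd2.
rewrite -meanZ//; apply: le_mean; [by ebd2|by ebd2|].
have : {ae P, forall o, `|w (obsX o)| <= C}.
  exact: (ae_pushforward measurable_obsX PX wC).
apply: filterS => o; rewrite ler_norml => /andP[Cw wC'].
rewrite -mulrBr normrM mulrC ler_wpM2r//.
set y := w (obsX o) + C.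
have y0 : 0 <= y / e by apply: divr_ge0; [rewrite /y; lra|exact: ltW].
have /andP[ty yt] := truncn_itv y0.
have tK : (Num.truncn (y / e) < K)%N.
  rewrite /K ltnS; apply: le_truncn.
  by rewrite ler_pM2r ?invr_gt0// lerD2r.
pose k0 := Ordinal tK.
have oB k : (obsX o \in B k) = (k == k0).
  apply/idP/eqP; last first.
    move=> ->; rewrite inE /B/= -/y; rewrite ler_pdivlMr// in ty.
    by rewrite ty/= -ltr_pdivrMr.
  rewrite inE /B/= -/y => /andP[k1 k2]; apply/val_inj => /=.
  apply/esym/truncn_def.
  by rewrite ler_pdivlMr// k1/= ltr_pdivrMr.
have -> : wN o = k0%:R * e - C.
  rewrite /wN (bigD1 k0)//= indicE oB eqxx mulr1 big1 ?addr0// => k kk0.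
  by rewrite indicE oB (negbTE kk0) mulr0.
rewrite /= opprB addrA -/y ler_norml.
rewrite ler_pdivlMr// in ty; rewrite ltr_pdivrMr// in yt.
rewrite -natr1 mulrDl mul1r in yt.
by apply/andP; split; lra.
Qed.

Lemma cond_exp_mul T g w : ebd P T -> is_cond_exp P T g -> ebd U w ->
  mean P (fun o => T o * w (obsX o)) = mean U (fun x => g x * w x).
Proof.
move=> hT Tg hw; have hg := cond_exp_ebd hT Tg.
have hgX := ebd_X hg; have hwX := ebd_X hw.
rewrite -mean_X; last by ebd2.
apply/eqP; rewrite -subr_eq0 -meanB; [|by ebd2..].
under eq_mean do rewrite -mulrBl.
apply/eqP; apply: mean_mul_X_eq0 => //; first by ebd2.
move=> B mB; have [_ _ _ TgE] := Tg.
have hB : ebd P (fun o => \1_B (obsX o : Rpt R d) : R).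
  exact: ebd_X (ebd_indic U mB).
under eq_mean do rewrite mulrBl.
rewrite meanB; [|by ebd2..].
by apply/EFin_inj; rewrite EFinB !mean_indic_X// TgE// subee// -mean_indic_X.
Qed.

(** The definition of psi uses one particular version of each regression
function. Two versions have the same inner product with any bounded function, so
that p and b can be put in place one after the other. *)
Lemma psiE p b : ebd P (@obsA R d) -> ebd P (@obsY R d) ->
  is_cond_exp P (@obsA R d) p -> is_cond_exp P (@obsY R d) b ->
  psi P = mean P (fun o => obsA o * obsY o) - mean U (fun x => p x * b x).
Proof.
move=> hA hY Ap Yb.
have hp := cond_exp_ebd hA Ap; have hb := cond_exp_ebd hY Yb.
have Ap' := cond_expP hA; have Yb' := cond_expP hY.
have hp' := cond_exp_ebd hA Ap'; have hb' := cond_exp_ebd hY Yb'.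
set p' := cond_exp P _ in Ap' hp'; set b' := cond_exp P _ in Yb' hb'.
have hpX := ebd_X hp'; have hbX := ebd_X hb'.
pose Z o := (obsA o - p' (obsX o)) * (obsY o - b' (obsX o)).
have hZ : ebd P Z by rewrite /Z; ebd2.
have [_ _ _ ZE] := cond_expP hZ.
have -> : psi P = mean P Z.
  rewrite /psi unlock /cond_cov /mean /Rintegral -/p' -/b' -/Z.
  by have := ZE setT measurableT; rewrite preimage_setT => ->.
have -> : mean P Z = mean P (fun o => obsA o * obsY o)
    - mean P (fun o => obsA o * b' (obsX o))
    - mean P (fun o => obsY o * p' (obsX o))
    + mean P (fun o => p' (obsX o) * b' (obsX o)).
  rewrite -meanB; [|by ebd2..].
  rewrite -meanB; [|by ebd2..].
  rewrite -meanD; [|by ebd2..].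
  by apply: eq_mean => o; rewrite /Z; ring.
rewrite (cond_exp_mul hA Ap' hb') (cond_exp_mul hY Yb' hp').
rewrite (mean_X (ebdM hp' hb')).
have -> : mean U (fun x => b' x * p' x) = mean U (fun x => p' x * b' x).
  by apply: eq_mean => x; rewrite mulrC.
rewrite subrK; congr (_ - _).
rewrite -(cond_exp_mul hA Ap' hb') (cond_exp_mul hA Ap hb').
transitivity (mean U (fun x => b' x * p x)).
  by apply: eq_mean => x; rewrite mulrC.
rewrite -(cond_exp_mul hY Yb' hp) (cond_exp_mul hY Yb hp).
by apply: eq_mean => x; rewrite mulrC.
Qed.

End cond_exp.

(** * The uniform law on the cube and orthogonal projections *)

Lemma uniform_itv (R : realType) (a b : R) : 0 <= a -> a <= b -> b <= 1 ->
  uniform_prob (@ltr01 R) `[a, b]%classic = (b - a)%:E.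
Proof.
move=> a0 ab b1; rewrite /uniform_prob integral_uniform_pdf.
rewrite setIidl; last first.
  move=> x /=; rewrite !in_itv/= => /andP[ax xb].
  by rewrite (le_trans a0 ax) (le_trans xb b1).
rewrite (eq_integral (fun=> 1%E)); last first.
  move=> x; rewrite inE/= in_itv/= /uniform_pdf => /andP[ax xb].
  by rewrite (le_trans a0 ax) (le_trans xb b1) subr0 invr1.
rewrite integral_cst//= mul1e lebesgue_measure_itv/= lte_fin.
by case: ltgtP ab => // -> _; rewrite subrr.
Qed.

Section cube.
Context (R : realType) (d : nat).
Local Notation U := (unif_cube R d).
Local Notation u01 := [the probability _ _ of uniform_prob (@ltr01 R)].

Lemma ae_cube : {ae U, forall x, cube x}.
Proof.
apply: (@ae_pow _ _ _ u01 d (fun t => 0 <= t <= 1)).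
exists (~` `[0, 1]%classic); split.
- exact: measurableC.
- rewrite (@probability_setC _ _ _ u01)//= uniform_itv// subr0.
  by rewrite subee.
- by move=> t /=; apply: contra_not; rewrite in_itv.
Qed.

Definition box (a b : 'I_d -> R) : set (Rpt R d) :=
  [set x | forall i, a i <= tnth x i <= b i].

Lemma measurable_coord (i : 'I_d) : measurable_fun setT (fun x : Rpt R d => tnth x i).
Proof. exact: measurable_tnth. Qed.

Lemma box_indic a b (x : Rpt R d) :
  \1_(box a b) x = \prod_i \1_(`[a i, b i]%classic) (tnth x i) :> R.
Proof.
rewrite indicE; have [|] := boolP (x \in box a b).
  rewrite inE => xb; rewrite big1// => i _.
  by rewrite indicE mem_set//= in_itv/=; exact: xb.
rewrite notin_setE => /existsNP[i xi].
by rewrite (bigD1 i)//= indicE memNset ?mul0r//= in_itv.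
Qed.

Lemma measurable_box a b : measurable (box a b).
Proof.
have -> : box a b = \bigcap_(i in [set: 'I_d])
    (fun x : Rpt R d => tnth x i) @^-1` `[a i, b i]%classic.
  apply/seteqP; split=> [x xb i _|x xb i]/=; first by rewrite in_itv; exact: xb.
  by have := xb i I; rewrite /= in_itv.
apply: fin_bigcap_measurable => // i _.
by rewrite -[X in measurable X]setTI; exact: measurable_coord.
Qed.

Lemma mean_box a b : (forall i, 0 <= a i) -> (forall i, a i <= b i) ->
  (forall i, b i <= 1) -> mean U (\1_(box a b)) = \prod_i (b i - a i).
Proof.
move=> a0 ab b1; under eq_mean do rewrite box_indic.
rewrite (@mean_prod_tnth _ _ _ u01 d (fun i => \1_(`[a i, b i]%classic))).
  by apply: eq_bigr => i _; rewrite mean_indic//= uniform_itv.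
by move=> i; exact: ebd_indic.
Qed.

(** The box may stick out of the cube, hence the clipped endpoints a' and b'. *)
Lemma mean_box_le a b (r : R) : 0 <= r -> (forall i, b i - a i <= r) ->
  mean U (\1_(box a b)) <= r ^+ d.
Proof.
move=> r0 abr; under eq_mean do rewrite box_indic.
rewrite (@mean_prod_tnth _ _ _ u01 d (fun i => \1_(`[a i, b i]%classic))); last first.
  by move=> i; exact: ebd_indic.
have -> : r ^+ d = \prod_(i < d) r by rewrite prodr_const card_ord.
apply: ler_prod => i _; rewrite mean_indic//= fine_ge0//=.
pose a' := Num.min 1 (Num.max 0 (a i)); pose b' := Num.max a' (Num.min 1 (b i)).
have H : (uniform_prob (@ltr01 R) `[a i, b i]%classic
    <= uniform_prob (@ltr01 R) `[a', b']%classic)%E.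
  rewrite /uniform_prob integral_uniform_pdf [leRHS]integral_uniform_pdf.
  apply: ge0_subset_integral => //=; try exact: measurableI.
  - apply/measurable_EFinP/measurable_funTS; exact: measurable_uniform_pdf.
  - by move=> x _; rewrite lee_fin uniform_pdf_ge0.
  - move=> x [/=]; rewrite !in_itv/= => /andP[ax xb] /andP[x0 x1]; split; last first.
      by rewrite x0 x1.
    apply/andP; split; rewrite /b' /a'.
      by rewrite ge_min ge_max x0 ax orbT.
    by rewrite le_max [X in _ || X]le_min x1 xb orbT.
rewrite -lee_fin fineK; last first.
  by rewrite ge0_fin_numE// (@le_lt_trans _ _ 1%E) ?ltry// (@probability_le1 _ _ _ u01).
apply: (le_trans H); rewrite uniform_itv.
- rewrite lee_fin /b' /a'; have := abr i.
  rewrite /Num.min /Num.max; repeat case: ifP; move=> *; lra.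
- by rewrite /a' le_min ler01 le_max lexx.
- by rewrite /b' le_max lexx.
- by rewrite /b' ge_max /a' !ge_min lexx.
Qed.

(** Bounded at every point of the cube; outside it nothing is known of the
wavelets. *)
Definition cbd (f : Rpt R d -> R) :=
  measurable_fun setT f /\ exists C : R, forall x, cube x -> `|f x| <= C.

Lemma cbd_ebd f : cbd f -> ebd U f.
Proof.
move=> [mf [C fC]]; split => //; exists C.
by apply: filterS ae_cube => x; exact: fC.
Qed.

Lemma innerE f g : inner f g = mean U (fun x => f x * g x).
Proof. by []. Qed.

Lemma innerC (f g : Rpt R d -> R) : inner f g = inner g f.
Proof. by apply: eq_mean => x; rewrite mulrC. Qed.

Lemma ae_innerl f f' g : measurable_fun setT f -> ebd U f' -> ebd U g ->
  {ae U, forall x, f x = f' x} -> inner f g = inner f' g.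
Proof.
move=> mf [mf' _] [mg _] ff'; apply: ae_eq_mean.
- exact: measurable_funM.
- exact: measurable_funM.
- by apply: filterS ff' => x ->.
Qed.

Lemma innerZl c f g : ebd U f -> ebd U g ->
  inner (fun x => c * f x) g = c * inner f g.
Proof.
move=> hf hg; rewrite !innerE -meanZ; last by ebd2.
by apply: eq_mean => x; rewrite mulrA.
Qed.

Lemma innerDl f f' g : ebd U f -> ebd U f' -> ebd U g ->
  inner (fun x => f x + f' x) g = inner f g + inner f' g.
Proof.
move=> hf hf' hg; rewrite !innerE -meanD; [|by ebd2..].
by apply: eq_mean => x; rewrite mulrDl.
Qed.

Lemma innerBl f f' g : ebd U f -> ebd U f' -> ebd U g ->
  inner (fun x => f x - f' x) g = inner f g - inner f' g.
Proof.
move=> hf hf' hg; rewrite !innerE -meanB; [|by ebd2..].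
by apply: eq_mean => x; rewrite mulrBl.
Qed.

Lemma inner_suml (I : Type) (r : seq I) (Q : pred I) (F : I -> Rpt R d -> R) g :
  (forall i, ebd U (F i)) -> ebd U g ->
  inner (fun x => \sum_(i <- r | Q i) F i x) g
  = \sum_(i <- r | Q i) inner (F i) g.
Proof.
move=> hF hg; rewrite innerE; under eq_mean do rewrite mulr_suml.
by rewrite mean_sum// => i; ebd2.
Qed.

Lemma inner_lin (I : finType) (a : I -> R) (F : I -> Rpt R d -> R) g :
  (forall i, ebd U (F i)) -> ebd U g ->
  inner (fun x => \sum_i a i * F i x) g = \sum_i a i * inner (F i) g.
Proof.
move=> hF hg; rewrite inner_suml//; last by move=> i; ebd2.
by apply: eq_bigr => i _; rewrite innerZl.
Qed.

Lemma inner_CS f g : ebd U f -> ebd U g ->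
  inner f g ^+ 2 <= inner f f * inner g g.
Proof.
move=> hf hg; have := mean_CS hf hg.
by rewrite (eq_mean _ (fun x => expr2 (f x))) (eq_mean _ (fun x => expr2 (g x))).
Qed.

Lemma inner_ge0 f : ebd U f -> 0 <= inner f f.
Proof.
move=> hf; have := mean_sqr_ge0 hf.
by rewrite (eq_mean _ (fun x => expr2 (f x))).
Qed.

Section orthonormal.
Variables (I : finType) (u : I -> Rpt R d -> R).
Hypotheses (hu : forall i, ebd U (u i))
  (uon : forall i j, inner (u i) (u j) = (i == j)%:R).

Definition lin (a : I -> R) x := \sum_i a i * u i x.

Lemma ebd_lin a : ebd U (lin a).
Proof. by rewrite /lin; ebd2. Qed.

Lemma inner_lin_u a i : inner (lin a) (u i) = a i.
Proof.
rewrite inner_lin// (bigD1 i)//= uon eqxx mulr1 big1 ?addr0// => j ji.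
by rewrite uon (negbTE ji) mulr0.
Qed.

Lemma inner_lin_lin a b : inner (lin a) (lin b) = \sum_i a i * b i.
Proof.
rewrite inner_lin//; last exact: ebd_lin.
by apply: eq_bigr => i _; rewrite innerC inner_lin_u.
Qed.

(** For an orthonormal family u this is the inner product of the residuals of f
and g after projection on the span of u; for f = g, a squared distance. *)
Definition resid f g := inner f g - \sum_i inner f (u i) * inner g (u i).

Lemma resid_proj f g : ebd U f -> ebd U g ->
  inner (fun x => f x - lin (fun i => inner f (u i)) x) g = resid f g.
Proof.
move=> hf hg; rewrite innerBl//; last exact: ebd_lin.
rewrite inner_lin//; congr (_ - _); apply: eq_bigr => i _.
by rewrite (innerC (u i)).
Qed.

Lemma dist_lin f a : ebd U f ->
  inner (fun x => f x - lin a x) (fun x => f x - lin a x)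
  = resid f f + \sum_i (inner f (u i) - a i) ^+ 2.
Proof.
move=> hf; have hl := ebd_lin a.
have hfl : ebd U (fun x => f x - lin a x) by ebd2.
have e : inner f (lin a) = \sum_i a i * inner f (u i).
  by rewrite innerC inner_lin//; apply: eq_bigr => i _; rewrite (innerC (u i)).
rewrite innerBl// (innerC f) (innerC (lin a)) !innerBl//.
rewrite (innerC (lin a) f) inner_lin_lin e /resid -[RHS]addrA -!addrA.
have -> : \sum_i (inner f (u i) - a i) ^+ 2 =
    \sum_i inner f (u i) * inner f (u i) - 2 * (\sum_i a i * inner f (u i))
    + \sum_i a i * a i.
  by rewrite mulr_sumr -sumrB -big_split/=; apply: eq_bigr => i _; ring.
by ring.
Qed.

Lemma resid_le_dist f a : ebd U f ->
  resid f f <= inner (fun x => f x - lin a x) (fun x => f x - lin a x).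
Proof.
by move=> hf; rewrite dist_lin// lerDl sumr_ge0// => i _; exact: sqr_ge0.
Qed.

Lemma dist_proj f : ebd U f -> let p := lin (fun i => inner f (u i)) in
  inner (fun x => f x - p x) (fun x => f x - p x) = resid f f.
Proof.
move=> hf; rewrite /= dist_lin// big1 ?addr0// => i _.
by rewrite subrr expr0n.
Qed.

Lemma resid_ge0 f : ebd U f -> 0 <= resid f f.
Proof.
move=> hf; rewrite -dist_proj//; apply: inner_ge0.
by have := ebd_lin (fun i => inner f (u i)) => ?; ebd2.
Qed.

Lemma resid_CS f g : ebd U f -> ebd U g ->
  resid f g ^+ 2 <= resid f f * inner g g.
Proof.
move=> hf hg; rewrite -resid_proj// -[X in _ <= X * _]dist_proj//.
apply: inner_CS => //.
by have := ebd_lin (fun i => inner f (u i)) => ?; ebd2.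
Qed.

Lemma bessel f : ebd U f -> \sum_i inner f (u i) ^+ 2 <= inner f f.
Proof.
move=> hf; rewrite -subr_ge0; have := resid_ge0 hf; rewrite /resid.
by under eq_bigr do rewrite -expr2.
Qed.

End orthonormal.

(** Each family is expanded in the other, with the same matrix of inner products
up to transposition. *)
Lemma same_span_resid (I J : finType) (u : I -> Rpt R d -> R)
    (v : J -> Rpt R d -> R) f g :
  (forall i, ebd U (u i)) -> (forall j, ebd U (v j)) ->
  (forall i i', inner (u i) (u i') = (i == i')%:R) ->
  (forall j j', inner (v j) (v j') = (j == j')%:R) ->
  (forall i, exists a, {ae U, forall x, u i x = lin v a x}) ->
  (forall j, exists a, {ae U, forall x, v j x = lin u a x}) ->
  ebd U f -> ebd U g -> resid u f g = resid v f g.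
Proof.
move=> hu hv uon von uv vu hf hg; rewrite /resid; congr (_ - _).
have uE i h : ebd U h -> inner h (u i) = \sum_j inner (u i) (v j) * inner h (v j).
  move=> hh; have [a ua] := uv i.
  have hl := ebd_lin hv a.
  rewrite innerC (ae_innerl (hu i).1 hl hh ua) inner_lin//.
  apply: eq_bigr => j _.
  rewrite (ae_innerl (hu i).1 hl (hv j) ua) inner_lin_u//.
  by rewrite (innerC h).
have vE j h : ebd U h -> inner h (v j) = \sum_i inner (u i) (v j) * inner h (u i).
  move=> hh; have [a va] := vu j.
  have hl := ebd_lin hu a.
  rewrite innerC (ae_innerl (hv j).1 hl hh va) inner_lin//.
  apply: eq_bigr => i _.
  rewrite (innerC (u i) (v j)) (ae_innerl (hv j).1 hl (hu i) va) inner_lin_u//.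
  by rewrite (innerC h).
under eq_bigr => i _ do rewrite (uE i f hf) mulr_suml.
rewrite exchange_big/=; apply: eq_bigr => j _.
rewrite [in RHS](vE j g)// mulr_sumr; apply: eq_bigr => i _.
by ring.
Qed.

End cube.

(** * Projection residuals in a wavelet basis *)

Lemma gt1_ltr_powR (R : realType) (a x y : R) :
  1 < a -> x < y -> a `^ x < a `^ y.
Proof.
move=> a1 xy; have a0 : 0 < a by exact: lt_trans a1.
by rewrite /powR gt_eqF// ltr_expR ltr_pM2r// ln_gt0.
Qed.

Lemma sum_cst (R : pzSemiRingType) (T : finType) (c : R) :
  \sum_(t : T) c = #|T|%:R * c.
Proof. by rewrite sumr_const mulr_natl; congr (_ *+ _); exact: eq_card. Qed.

Section wavelets.
Context (R : realType) (d : nat) (W : wavelet_system R d) (S J0 : nat).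
Hypothesis hW : cdv_basis W S J0.
Local Notation U := (unif_cube R d).
Local Notation Z := (idx W).
Local Notation phi l := (@scaling R d W l).

Lemma cbd_scaling l (m : Z l) : (J0 <= l)%N -> cbd (scaling m).
Proof.
move=> l0; split; first exact: (scaling_measurable hW).
have [C _ /(_ l l0)[+ _ _]] := scaling_localized hW => h.
by exists (C * Num.sqrt (resolution d l)%:R) => x; exact: h.
Qed.

Lemma cbd_wavelet l i (m : Z l) : (J0 <= l)%N -> cbd (wavelet i m).
Proof.
move=> l0; split; first exact: (wavelet_measurable hW).
have [C _ /(_ l l0)[+ _ _]] := wavelet_localized hW i => h.
by exists (C * Num.sqrt (resolution d l)%:R) => x; exact: h.
Qed.

Lemma ebd_scaling l (m : Z l) : (J0 <= l)%N -> ebd U (scaling m).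
Proof. by move=> l0; apply: cbd_ebd; exact: cbd_scaling. Qed.

Lemma ebd_wavelet l i (m : Z l) : (J0 <= l)%N -> ebd U (wavelet i m).
Proof. by move=> l0; apply: cbd_ebd; exact: cbd_wavelet. Qed.

(** A second orthonormal family spanning V_(l+1), adapted to the step from l to
l+1. *)
Definition VW l (k : Z l + subband d * Z l) : Rpt R d -> R :=
  match k with inl m => scaling m | inr im => wavelet im.1 im.2 end.

Lemma ebd_VW l (k : Z l + subband d * Z l) : (J0 <= l)%N -> ebd U (VW k).
Proof.
by move=> l0; case: k => [m|[i m]]; [exact: ebd_scaling|exact: ebd_wavelet].
Qed.

Lemma sum_VW l (F : Z l + subband d * Z l -> R) :
  \sum_k F k = \sum_m F (inl m) + \sum_i \sum_m F (inr (i, m)).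
Proof.
rewrite big_sumType/=; congr (_ + _); rewrite pair_big/=.
by apply: eq_bigr => -[].
Qed.

Lemma scaling_split_VW l (m : Z l.+1) : (J0 <= l)%N ->
  exists a, {ae U, forall x, scaling m x = lin (@VW l) a x}.
Proof.
move=> l0; have [a [c ac]] := scaling_split hW m l0.
exists (fun k => match k with inl m => a m | inr im => c im.1 im.2 end).
by apply: filterS ac => x ->; rewrite /lin sum_VW.
Qed.

(** By induction on l: [scaling_split] expresses the scaling functions of level
l+1 through those of level l and wavelets of level l. *)
Lemma scaling_orth_wavelet l l' (m : Z l) i (m' : Z l') :
  (J0 <= l)%N -> (l <= l')%N -> inner (scaling m) (wavelet i m') = 0.
Proof.
elim: l m => [|l IHl] m.
  rewrite leqn0 => /eqP J00 l'0.
  by move: m; rewrite -J00 => m; apply: (scaling_wavelet_orthogonal hW); rewrite J00.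
rewrite leq_eqVlt => /predU1P[J0l ll'|].
  by move: m; rewrite -J0l => m; apply: (scaling_wavelet_orthogonal hW); rewrite J0l.
rewrite ltnS => l0 ll'.
have l'0 : (J0 <= l')%N by apply: leq_trans ll'; exact: leqW.
have [a ma] := scaling_split_VW m l0.
have hVW k := @ebd_VW l k l0.
rewrite (ae_innerl _ (ebd_lin hVW a) (ebd_wavelet i m' l'0) ma); last first.
  exact: (scaling_measurable hW _ (leqW l0)).
rewrite (inner_lin _ hVW (ebd_wavelet i m' l'0)) big1// => -[m1|[i1 m1]] _ /=.
  by rewrite IHl ?mulr0// ltnW.
by rewrite (wavelet_orthogonal hW) ?mulr0// l0.
Qed.

Lemma VW_orthonormal l (k k' : Z l + subband d * Z l) : (J0 <= l)%N ->
  inner (VW k) (VW k') = (k == k')%:R.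
Proof.
move=> l0; case: k => [m|[i m]]; case: k' => [m'|[i' m']] //=.
- by rewrite (scaling_orthonormal hW).
- by rewrite scaling_orth_wavelet.
- by rewrite innerC scaling_orth_wavelet.
- by rewrite (wavelet_orthonormal hW).
Qed.

(** V_(l+1) is the orthogonal sum of V_l and of the wavelets of level l. *)
Lemma resid_step l f g : (J0 <= l)%N -> ebd U f -> ebd U g ->
  resid (phi l) f g = resid (phi l.+1) f g
    + \sum_(i : subband d) \sum_(m : Z l)
        inner f (wavelet i m) * inner g (wavelet i m).
Proof.
move=> l0 hf hg.
have -> : resid (phi l.+1) f g = resid (@VW l) f g.
  apply: same_span_resid => //.
  - by move=> m; apply: ebd_scaling; exact: leqW.
  - by move=> k; exact: ebd_VW.
  - by move=> m m'; apply: (scaling_orthonormal hW); exact: leqW.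
  - by move=> k k'; exact: VW_orthonormal.
  - by move=> m; exact: scaling_split_VW.
  - move=> [m|[i m]]; first exact: (scaling_nested hW).
    exact: (wavelet_next hW).
by rewrite /resid sum_VW/=; ring.
Qed.

Lemma in_VD l f g : in_V W l f -> in_V W l g -> in_V W l (fun x => f x + g x).
Proof.
move=> [a fa] [b gb]; exists (fun m => a m + b m).
apply: filterS2 fa gb => x -> ->; rewrite -big_split/=.
by apply: eq_bigr => m _; rewrite mulrDl.
Qed.

Lemma in_VZ l c f : in_V W l f -> in_V W l (fun x => c * f x).
Proof.
move=> [a fa]; exists (fun m => c * a m).
apply: filterS fa => x ->; rewrite mulr_sumr.
by apply: eq_bigr => m _; rewrite mulrA.
Qed.

Lemma in_V_sum l (I : Type) (r : seq I) (Q : pred I) (F : I -> Rpt R d -> R) :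
  (forall i, Q i -> in_V W l (F i)) -> in_V W l (fun x => \sum_(i <- r | Q i) F i x).
Proof.
move=> hF; elim: r => [|i r IHr].
  exists (fun=> 0); apply: aeW => x.
  by rewrite big_nil big1// => m _; rewrite mul0r.
have [Qi|Qi] := boolP (Q i).
  under eq_fun do rewrite big_cons Qi.
  by apply: in_VD => //; exact: hF.
by under eq_fun do rewrite big_cons (negbTE Qi).
Qed.

Lemma in_V_ae l f g : in_V W l g -> {ae U, forall x, f x = g x} -> in_V W l f.
Proof.
by move=> [a ga] fg; exists a; apply: filterS2 ga fg => x + ->.
Qed.

Lemma in_VS l f : (J0 <= l)%N -> in_V W l f -> in_V W l.+1 f.
Proof.
move=> l0 [a fa]; apply: (in_V_ae _ fa); apply: in_V_sum => m _.
by apply: in_VZ; exact: (scaling_nested hW).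
Qed.

Lemma in_V_le l l' f : (J0 <= l)%N -> (l <= l')%N -> in_V W l f -> in_V W l' f.
Proof.
move=> l0 ll' hf; rewrite -(subnKC ll'); elim: (l' - l)%N => [|k IHk].
  by rewrite addn0.
by rewrite addnS; apply: in_VS => //; rewrite (leq_trans l0)// leq_addr.
Qed.

Lemma in_V_combination L a c l : (J0 <= l)%N -> (L <= l)%N ->
  in_V W l (@basis_combination R d W J0 L a c).
Proof.
move=> l0 Ll; apply: in_VD.
  apply: (in_V_le (leqnn J0) l0); exists a; exact: aeW.
rewrite /basis_combination.
under eq_fun do rewrite big_nat.
apply: in_V_sum => l1 /andP[l1J l1L].
apply: in_V_sum => i _; apply: in_V_sum => m _; apply: in_VZ.
apply: (@in_V_le l1.+1); [exact: leqW|exact: leq_trans Ll|].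
exact: (wavelet_next hW).
Qed.

(** The big sum over levels is rewritten with a test, since wavelets below level
J0 are not known to be bounded. *)
Lemma ebd_combination L a c : ebd U (@basis_combination R d W J0 L a c).
Proof.
rewrite /basis_combination; apply: ebdD.
  apply: ebd_sum => m; apply: ebdM; first exact: ebd_cst.
  exact: ebd_scaling.
under eq_fun do rewrite big_nat.
have := ebd_sum (P := U) (index_iota J0 L) (fun l => J0 <= l < L)%N
  (F := fun l x => if (J0 <= l)%N then \sum_i \sum_m c l i m * wavelet i m x else 0).
move=> H; apply: eq_ind (H _) _ _.
  move=> l; have [l0|l0] := boolP (J0 <= l)%N; last exact: ebd_cst.
  apply: ebd_sum => i; apply: ebd_sum => m; apply: ebdM; first exact: ebd_cst.
  exact: ebd_wavelet.
by apply/funext => x; apply: eq_bigr => l /andP[-> _].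
Qed.

Lemma Lnorm2E f : ebd U f ->
  ('N[U]_2%:E [EFin \o f] = (inner f f `^ 2^-1)%:E)%E.
Proof.
move=> hf; have hff : ebd U (fun x => f x * f x) by ebd2.
rewrite unlock.
rewrite (eq_integral (fun x => (f x * f x)%:E)); last first.
  move=> x _; transitivity ((`|f x| `^ 2%:R)%:E) => //.
  by rewrite powR_mulrn// real_normK ?num_real// expr2.
rewrite -poweR_EFin /inner /Rintegral fineK//.
by apply: integrable_fin_num => //; exact: (ebd_integrable hff).
Qed.

Lemma Lfun2_ebd f : ebd U f -> f \in Lfun U 2%:E.
Proof.
move=> hf; rewrite inE; apply/andP; split; rewrite inE/=; first exact: hf.1.
by rewrite /finite_norm Lnorm2E// ltry.
Qed.

Lemma in_V_resid_le l f v : (J0 <= l)%N -> ebd U f -> ebd U v -> in_V W l v ->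
  resid (phi l) f f <= inner (fun x => f x - v x) (fun x => f x - v x).
Proof.
move=> l0 hf hv [a va].
have hphi m := @ebd_scaling l m l0.
have on (m m' : Z l) := scaling_orthonormal hW m m' l0.
apply: (le_trans (resid_le_dist hphi on a hf)).
have hl := ebd_lin hphi a.
rewrite le_eqVlt; apply/orP; left; apply/eqP.
have h1 : ebd U (fun x => f x - lin (phi l) a x) by ebd2.
have h2 : ebd U (fun x => f x - v x) by ebd2.
apply: ae_eq_mean; [exact: (ebdM h1 h1).1|exact: (ebdM h2 h2).1|].
by apply: filterS va => x ->.
Qed.

Lemma resid_antitone l l' f : (J0 <= l)%N -> (l <= l')%N -> ebd U f ->
  resid (phi l') f f <= resid (phi l) f f.
Proof.
move=> l0 ll' hf; rewrite -(subnKC ll'); elim: (l' - l)%N => [|k IHk].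
  by rewrite addn0.
rewrite addnS; apply: le_trans IHk.
rewrite (@resid_step (l + k))//; last by rewrite (leq_trans l0)// leq_addr.
rewrite lerDl; apply: sumr_ge0 => i _; apply: sumr_ge0 => m _.
by rewrite -expr2 sqr_ge0.
Qed.

(** A finite combination of basis functions close to f lies in some V_L, and
projection is the best approximation. *)
Lemma resid_vanishes f e : ebd U f -> 0 < e ->
  exists2 L, (J0 <= L)%N & resid (phi L) f f <= e ^+ 2.
Proof.
move=> hf e0; have [L [a [c]]] := basis_total hW (Lfun2_ebd hf) e0.
have hc := ebd_combination L a c.
have hfc : ebd U (f \- basis_combination L a c) by exact: ebdB.
rewrite Lnorm2E// lte_fin => fe.
exists (maxn J0 L); first exact: leq_maxl.
apply: (le_trans (in_V_resid_le _ hf hc _)); [exact: leq_maxl| |].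
  by apply: in_V_combination; [exact: leq_maxl|exact: leq_maxr].
have n0 := inner_ge0 hfc.
have E (x : R) : 0 <= x -> x = (x `^ 2^-1) ^+ 2.
  by move=> x0; rewrite -powR_mulrn ?powR_ge0// -powRrM mulVf// powRr1.
by rewrite [leLHS]E// lerXn2r ?nnegrE ?powR_ge0// ltW.
Qed.

(** Telescoping [resid_step]; what remains at a high level is small by
[resid_vanishes]. *)
Lemma resid_tail_le l f g (w : nat -> R) (K : R) : (J0 <= l)%N ->
  ebd U f -> ebd U g ->
  (forall k, (l <= k)%N -> `|\sum_(i : subband d) \sum_(m : Z k)
        inner f (wavelet i m) * inner g (wavelet i m)| <= w k) ->
  (forall L, \sum_(l <= k < l + L) w k <= K) ->
  `|resid (phi l) f g| <= K.
Proof.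
move=> l0 hf hg fgw wK.
have tele L : `|resid (phi l) f g| <=
    `|resid (phi (l + L)%N) f g| + \sum_(l <= k < l + L) w k.
  elim: L => [|L IHL]; first by rewrite addn0 big_geq// addr0.
  apply: (le_trans IHL); rewrite addnS big_nat_recr ?leq_addr//=.
  rewrite [X in _ <= _ + X]addrC addrA lerD2r.
  have lL : (J0 <= l + L)%N by rewrite (leq_trans l0)// leq_addr.
  rewrite (resid_step lL hf hg) (le_trans (ler_normD _ _))// lerD2l fgw//.
  exact: leq_addr.
apply/ler_addgt0Pr => e e0.
pose B := inner g g + 1.
have B0 : 0 < B by rewrite ltr_wpDl// inner_ge0.
have [L L0 Le] := resid_vanishes hf (divr_gt0 e0 B0).
apply: (le_trans (tele L)); rewrite addrC; apply: lerD; first exact: wK.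
have lL : (J0 <= l + L)%N by rewrite (leq_trans l0)// leq_addr.
have hphi m := @ebd_scaling (l + L)%N m lL.
have on (m m' : Z (l + L)%N) := scaling_orthonormal hW m m' lL.
rewrite -(@ler_pXn2r _ 2) ?nnegrE//; last exact: ltW.
rewrite real_normK ?num_real//.
apply: (le_trans (resid_CS hphi on hf hg)).
have gB : inner g g <= B ^+ 2.
  by rewrite /B; have := inner_ge0 hg; move: (inner g g) => t t0; nra.
apply: (@le_trans _ _ ((e / B) ^+ 2 * B ^+ 2)); last first.
  by rewrite -exprMn divfK// gt_eqF.
apply: ler_pM => //; [exact: resid_ge0|exact: inner_ge0|].
apply: le_trans Le; apply: resid_antitone => //.
exact: leq_addl.
Qed.

(** The supremum is traded for a universal quantifier; the scaling part of the
norm stays added to each wavelet coefficient. *)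
Lemma holder_ballP a M h : holder_ball W J0 a M h <->
  unif_continuous_on_cube h /\
  forall l (i : subband d) (m : Z l), (J0 <= l)%N ->
   2 `^ (J0%:R * (a + d%:R / 2)) * \big[Num.max/0]_(m : Z J0) `|inner h (scaling m)|
   + 2 `^ (l%:R * (a + d%:R / 2)) * `|inner h (wavelet i m)| <= M.
Proof.
rewrite /holder_ball /holder_norm/=; set s := 2 `^ (_ * _) * _.
split=> -[uc hM]; split=> //.
- move=> l i m l0; rewrite -lee_fin EFinD; apply: le_trans hM.
  rewrite leeD2l//; apply: ereal_sup_ubound => /=.
  by exists l, i, m.
- rewrite -leeBrDl//; apply: ge_ereal_sup => _ [l [i [m [l0 ->]]]].
  by rewrite leeBrDl// -EFinD lee_fin; exact: hM.
Qed.

Lemma holder_coef_le a M h l (i : subband d) (m : Z l) : (J0 <= l)%N ->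
  holder_ball W J0 a M h ->
  `|inner h (wavelet i m)| <= M * 2 `^ (- (l%:R * (a + d%:R / 2))).
Proof.
move=> l0 /holder_ballP[_ /(_ l i m l0)].
set s := 2 `^ (_ * _) * _ => sM.
have s0 : 0 <= s.
  rewrite mulr_ge0 ?powR_ge0//; elim/big_ind: _ => // x y x0 y0.
  by rewrite le_max x0.
rewrite powRN ler_pdivlMr ?powR_gt0// mulrC.
by apply: le_trans sM; rewrite lerDr.
Qed.

(** At level k there are O(2^(kd)) products of coefficients, each at most
M ^ 2 2^(-k (a + b + d)): the tail is a geometric series of ratio 2^(-(a + b)). *)
Lemma approx_bias_le (a b M : R) : 0 < a + b -> exists2 C : R, 0 < C &
  forall f g l, (J0 <= l)%N -> ebd U f -> ebd U g ->
    holder_ball W J0 a M f -> holder_ball W J0 b M g ->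
    `|resid (phi l) f g| <= C * 2 `^ (- (l%:R * (a + b))).
Proof.
move=> ab0; have [C0 C00 Zcard] := idx_card hW.
pose D := #|{: subband d}|%:R * C0 * M ^+ 2.
pose q : R := 2 `^ (- (a + b)).
have q0 : 0 < q by exact: powR_gt0.
have q1 : q < 1 by rewrite /q -[ltRHS](powRr0 2); apply: gt1_ltr_powR; lra.
have D0 : 0 <= D by rewrite /D mulr_ge0 ?sqr_ge0// mulr_ge0// ltW.
exists ((D + 1) / (1 - q)); first by rewrite divr_gt0 ?subr_gt0// ltr_wpDl.
move=> f g l l0 hf hg fa gb.
have qE k : 2 `^ (- (k%:R * (a + b))) = q ^+ k.
  by rewrite -powR_mulrn ?ltW// /q -powRrM; congr powR; ring.
rewrite qE.
apply: (resid_tail_le (w := fun k => (D + 1) * q ^+ k) l0 hf hg).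
- move=> k lk; have k0 := leq_trans l0 lk.
  apply: (@le_trans _ _ (\sum_(i : subband d) \sum_(m : Z k)
     M ^+ 2 * (q ^+ k / (resolution d k)%:R))).
    apply: (le_trans (ler_norm_sum _ _ _)); apply: ler_sum => i _.
    apply: (le_trans (ler_norm_sum _ _ _)); apply: ler_sum => m _.
    rewrite normrM.
    have -> : M ^+ 2 * (q ^+ k / (resolution d k)%:R) =
       (M * 2 `^ (- (k%:R * (a + d%:R / 2)))) * (M * 2 `^ (- (k%:R * (b + d%:R / 2)))).
      rewrite [RHS]mulrACA -[M * M]expr2; congr (_ * _).
      rewrite -powRD; last by rewrite pnatr_eq0 implybT.
      rewrite -qE /resolution natrX -powR_mulrn// -powRN -powRD ?pnatr_eq0 ?implybT//.
      by congr powR; rewrite natrM; field.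
    by apply: ler_pM => //; exact: holder_coef_le.
  rewrite (sum_cst (Z k)) sum_cst.
  have [_ cle] := andP (Zcard k k0).
  have r0 : 0 < (resolution d k)%:R :> R by rewrite ltr0n expn_gt0.
  apply: (@le_trans _ _ (D * q ^+ k)); last first.
    by rewrite ler_wpM2r ?exprn_ge0 ?(ltW q0)// lerDl.
  rewrite /D [leLHS](_ : _ = #|{: subband d}|%:R * (#|Z k|%:R / (resolution d k)%:R) * M ^+ 2 * q ^+ k); last by ring.
  rewrite ler_wpM2r ?exprn_ge0 ?(ltW q0)// ler_wpM2r ?sqr_ge0// ler_wpM2l//.
  by rewrite ler_pdivrMr.
- move=> L; rewrite -mulr_sumr -mulrA [X in _ <= _ * X]mulrC ler_wpM2l ?addr_ge0//.
  rewrite ler_pdivlMr ?subr_gt0//.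
  have -> : \sum_(l <= k < l + L) q ^+ k = q ^+ l * \sum_(k < L) q ^+ k.
    rewrite -{1}[l]add0n big_addn addKn big_mkord mulr_sumr.
    by apply: eq_bigr => k _; rewrite exprD mulrC.
  rewrite -mulrA ler_piMr ?exprn_ge0 ?(ltW q0)//.
  have := subrXX 1 q L; rewrite expr1n => E.
  have -> : (\sum_(k < L) q ^+ k) * (1 - q) = 1 - q ^+ L.
    rewrite E mulrC; congr (_ * _); apply: eq_bigr => k _.
    by rewrite expr1n mul1r.
  by rewrite gerBl exprn_ge0// (ltW q0).
Qed.

End wavelets.

(** * Upper bound for the maximal risk *)

Lemma ebd_EFin d (T : measurableType d) (R : realType) (P : probability T R)
    (f : T -> R) : ebd P f -> (\int[P]_x (f x)%:E = (mean P f)%:E)%E.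
Proof.
move=> hf; rewrite /mean /Rintegral fineK//.
by apply: integrable_fin_num => //; exact: (ebd_integrable hf).
Qed.

Section estimator.
Context (R : realType) (d : nat) (W : wavelet_system R d) (S J0 : nat).
Hypothesis hW : cdv_basis W S J0.
Local Notation U := (unif_cube R d).
Local Notation Z := (idx W).
Local Notation phi l := (@scaling R d W l).

Definition AY (o : obs R d) : R := obsA o * obsY o.
Definition Aphi j (m : Z j) (o : obs R d) : R := obsA o * scaling m (obsX o).
Definition Yphi j (m : Z j) (o : obs R d) : R := obsY o * scaling m (obsX o).

(** The projection kernel is a sum over m of products, so that the double sum
over observations factorises for each m. *)
Lemma psi_NR_plugin j n (D : n.-tuple (obs R d)) :
  psi_NR W j D = plugin AY (@Aphi j) (@Yphi j) D.
Proof.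
rewrite /psi_NR /plugin /Ssum.
have -> : \sum_(i < n) obsA (tnth D i) *
     (obsY (tnth D i) - b_hat W j D (obsX (tnth D i)))
   = \sum_(i < n) AY (tnth D i)
     - \sum_(i < n) obsA (tnth D i) * b_hat W j D (obsX (tnth D i)).
  by rewrite -sumrB; apply: eq_bigr => i _; rewrite mulrBr.
rewrite mulrBr; congr (_ - _); rewrite /b_hat /projection_kernel.
transitivity (n%:R^-1 * (n%:R^-1 * (\sum_m (\sum_i @Aphi j m (tnth D i))
    * (\sum_i @Yphi j m (tnth D i))))).
  congr (_ * _).
  under eq_bigr => i _.
    rewrite mulrCA mulr_sumr.
    under eq_bigr => i' _.
      rewrite mulrCA mulr_sumr mulr_sumr.
      over.
    over.
  rewrite -mulr_sumr; congr (_ * _).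
  under [RHS]eq_bigr do rewrite big_distrlr/=.
  rewrite exchange_big/= [RHS]exchange_big/=.
  under [RHS]eq_bigr do rewrite exchange_big/=.
  rewrite exchange_big/=; apply: eq_bigr => i _; apply: eq_bigr => i' _.
  by apply: eq_bigr => m _; rewrite /Aphi /Yphi; ring.
rewrite mulrA mulr_sumr; apply: eq_bigr => m _; ring.
Qed.

(** At each point at most C scaling functions are nonzero, each at most C sqrt k. *)
Lemma kernel_diag_le : exists2 C : R, 0 < C &
  forall l x, (J0 <= l)%N -> cube x ->
    \sum_(m : Z l) scaling m x ^+ 2 <= C * (resolution d l)%:R.
Proof.
have [C C0 HC] := scaling_localized hW.
exists (C * C ^+ 2); first by rewrite mulr_gt0// exprn_gt0.
move=> l x l0 xc; have [bd _ nb] := HC l l0.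
rewrite (bigID [pred m | scaling m x != 0])/= [X in _ + X]big1 ?addr0; last first.
  by move=> m; rewrite negbK => /eqP ->; rewrite expr0n.
apply: (@le_trans _ _ (\sum_(m | scaling m x != 0) C ^+ 2 * (resolution d l)%:R)).
  apply: ler_sum => m _.
  rewrite -(@sqr_sqrtr _ (resolution d l)%:R)// -exprMn -real_normK ?num_real//.
  rewrite lerXn2r ?nnegrE ?mulr_ge0 ?sqrtr_ge0 ?(ltW C0)//.
  exact: bd.
rewrite sumr_const -[_ *+ #|_|]mulr_natl -[leRHS]mulrA ler_wpM2r//; last exact: nb.
by rewrite mulr_ge0// exprn_ge0// ltW.
Qed.

Section model_law.
Context (C1 C2 alpha beta M : R) (P : probability (obs R d) R).
Hypothesis hP : model W J0 C1 C2 alpha beta M P.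

Let PX B : measurable B -> P (@obsX R d @^-1` B) = U B.
Proof. by case: hP => h _ _ _; exact: h. Qed.

Definition Cb : R := Num.max `|C1| `|C2|.

Lemma Cb_ge0 : 0 <= Cb.
Proof. by rewrite le_max normr_ge0. Qed.

Lemma itv_Cb (t : R) : C1 <= t <= C2 -> `|t| <= Cb.
Proof.
move=> /andP[t1 t2]; rewrite /Cb le_max.
have [t0|t0] := leP 0 t.
  by rewrite (ger0_norm t0) (le_trans t2 (ler_norm _)) orbT.
rewrite (ltr0_norm t0) (@le_trans _ _ (- C1))//; first by rewrite lerN2.
by rewrite -normrN ler_norm.
Qed.

Lemma ae_A : {ae P, forall o, `|obsA o| <= Cb}.
Proof.
by case: hP => _ + _ _; apply: filterS => o [+ _]; exact: itv_Cb.
Qed.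

Lemma ae_Y : {ae P, forall o, `|obsY o| <= Cb}.
Proof.
by case: hP => _ + _ _; apply: filterS => o [_]; exact: itv_Cb.
Qed.

Lemma ebd_A : ebd P (@obsA R d).
Proof. by split; [exact: measurable_obsA|exists Cb; exact: ae_A]. Qed.

Lemma ebd_Y : ebd P (@obsY R d).
Proof. by split; [exact: measurable_obsY|exists Cb; exact: ae_Y]. Qed.

Lemma ebd_AY : ebd P AY.
Proof. by apply: ebdM; [exact: ebd_A|exact: ebd_Y]. Qed.

Lemma ebd_phiX j (m : Z j) : (J0 <= j)%N -> ebd P (fun o => scaling m (obsX o)).
Proof. by move=> j0; apply: ebd_X => //; exact: (ebd_scaling hW). Qed.

Lemma ebd_Aphi j (m : Z j) : (J0 <= j)%N -> ebd P (Aphi m).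
Proof. by move=> j0; apply: ebdM; [exact: ebd_A|exact: ebd_phiX]. Qed.

Lemma ebd_Yphi j (m : Z j) : (J0 <= j)%N -> ebd P (Yphi m).
Proof. by move=> j0; apply: ebdM; [exact: ebd_Y|exact: ebd_phiX]. Qed.

Lemma risk_EFin j n (c : R) : (J0 <= j)%N ->
  ('E_(pow_prob P n)[fun D => ((psi_NR W j D - c) ^+ 2)%R]
   = (mean (pow_prob P n)
        (fun D => (plugin AY (@Aphi j) (@Yphi j) D - c) ^+ 2))%:E)%E.
Proof.
move=> j0; rewrite unlock.
under eq_integral do rewrite psi_NR_plugin.
apply: ebd_EFin; apply: ebdX; apply: ebdB; last exact: ebd_cst.
apply: ebd_plugin; [exact: ebd_AY| |] => m.
- exact: ebd_Aphi.
- exact: ebd_Yphi.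
Qed.

Lemma mean_Aphi p j (m : Z j) : (J0 <= j)%N -> is_cond_exp P (@obsA R d) p ->
  mean P (Aphi m) = inner p (scaling m).
Proof.
by move=> j0 Ap; apply: (cond_exp_mul PX ebd_A Ap); exact: (ebd_scaling hW).
Qed.

Lemma mean_Yphi b j (m : Z j) : (J0 <= j)%N -> is_cond_exp P (@obsY R d) b ->
  mean P (Yphi m) = inner b (scaling m).
Proof.
by move=> j0 Yb; apply: (cond_exp_mul PX ebd_Y Yb); exact: (ebd_scaling hW).
Qed.

(** By Bessel, projecting g on V_j does not increase its norm, which is at most
Cb; the weight V costs another factor Cb. *)
Lemma weighted_proj_le (V : obs R d -> R) T g j : (J0 <= j)%N ->
  ebd P V -> {ae P, forall o, `|V o| <= Cb} ->
  ebd P T -> {ae P, forall o, `|T o| <= Cb} -> is_cond_exp P T g ->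
  mean P (fun o => (\sum_(m : Z j) inner g (scaling m)
     * (V o * scaling m (obsX o))) ^+ 2) <= Cb ^+ 4.
Proof.
move=> j0 hV VC hT TC Tg; have hg := cond_exp_ebd PX hT Tg.
have hphi (m : Z j) := ebd_scaling hW m j0.
have on (m m' : Z j) := scaling_orthonormal hW m m' j0.
pose w := lin (phi j) (fun m => inner g (scaling m)).
have hw : ebd U w by exact: ebd_lin.
have hwX := ebd_X PX hw.
have hphX (m : Z j) := ebd_phiX m j0.
apply: (@le_trans _ _ (mean P (fun o => Cb ^+ 2 * (w (obsX o) * w (obsX o))))).
  apply: le_mean; [by ebd2|by ebd2|].
  apply: filterS VC => o Vo.
  have -> : \sum_(m : Z j) inner g (scaling m) * (V o * scaling m (obsX o))
      = V o * w (obsX o).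
    by rewrite /w /lin mulr_sumr; apply: eq_bigr => m _; rewrite mulrCA.
  rewrite exprMn -expr2 ler_wpM2r ?sqr_ge0//.
  rewrite -real_normK ?num_real// lerXn2r// nnegrE//.
  exact: Cb_ge0.
rewrite meanZ; last by ebd2.
rewrite (mean_X PX (ebdM hw hw)) -[mean U _]/(inner w w) inner_lin_lin//.
rewrite -[Cb ^+ 4]/(Cb ^+ (2 + 2)) exprD ler_wpM2l ?sqr_ge0//.
apply: (@le_trans _ _ (inner g g)).
  by under eq_bigr do rewrite -expr2; exact: bessel.
rewrite -[leRHS](mean_cst U); apply: le_mean; [by ebd2|by ebd2|].
have h1 : {ae U, forall x, g x <= Cb}.
  by apply: (cond_exp_ub PX Tg); apply: filterS TC => o; rewrite ler_norml => /andP[].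
have h2 : {ae U, forall x, - Cb <= g x}.
  by apply: (cond_exp_lb PX Tg); apply: filterS TC => o; rewrite ler_norml => /andP[].
apply: filterS2 h1 h2 => x x1 x2.
rewrite -expr2 -real_normK ?num_real// lerXn2r// ?nnegrE ?Cb_ge0//.
by rewrite ler_norml x2 x1.
Qed.

End model_law.

(** [risk_le], where the bias is controlled by [approx_bias_le] and the
constant B there is of order k by [kernel_diag_le]. *)
Lemma max_risk_le (C1 C2 alpha beta M : R) : 0 < alpha + beta ->
  exists2 C : R, 0 < C & forall j n, (0 < n)%N -> (J0 <= j n)%N ->
    (max_risk W J0 C1 C2 alpha beta M j n <=
     (C * ((2 `^ (- ((j n)%:R * (alpha + beta)))) ^+ 2 + n%:R^-1
           + ((resolution d (j n))%:R / n%:R) ^+ 2))%:E)%E.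
Proof.
move=> ab0; have [Ca Ca0 HCa] := approx_bias_le hW M ab0.
have [Ck Ck0 HCk] := kernel_diag_le.
pose c := Cb C1 C2; have c0 : 0 <= c by exact: Cb_ge0.
pose C := 5 * (Ca ^+ 2 + 3 * c ^+ 4 + 48 * (c ^+ 2 * Ck) ^+ 2) + 1.
have p0 (x : R) n : 0 <= x -> 0 <= x ^+ n by exact: exprn_ge0.
exists C.
  rewrite /C ltr_wpDl// mulr_ge0//.
  have := sqr_ge0 Ca; have := p0 _ 4 c0; have := sqr_ge0 (c ^+ 2 * Ck); lra.
move=> j n n0 j0; apply: ge_ereal_sup => _ [P hP <-].
rewrite (risk_EFin hP)// lee_fin.
have [PX _ [p Ap pH] [b Yb bH]] := hP.
have hA := ebd_A hP; have hY := ebd_Y hP.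
have hp := cond_exp_ebd PX hA Ap; have hb := cond_exp_ebd PX hY Yb.
set k : R := (resolution d (j n))%:R.
have k0 : 0 <= k by [].
have kernel (V : obs R d -> R) : {ae P, forall o, `|V o| <= c} ->
    {ae P, forall o, \sum_(m : Z (j n)) (V o * scaling m (obsX o)) ^+ 2
       <= c ^+ 2 * Ck * k}.
  move=> Vc; have cX : {ae P, forall o, cube (obsX o : Rpt R d)}.
    exact: (ae_pushforward (@measurable_obsX R d) PX (ae_cube R d)).
  apply: filterS2 Vc cX => o Vo oc.
  under eq_bigr do rewrite exprMn.
  rewrite -mulr_sumr -mulrA; apply: ler_pM; rewrite ?sqr_ge0//.
  - by apply: sumr_ge0 => m _; exact: sqr_ge0.
  - by rewrite -real_normK ?num_real// lerXn2r// nnegrE.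
  - exact: HCk.
have h1 := fun m : Z (j n) => ebd_Aphi hP m j0.
have h2 := fun m : Z (j n) => ebd_Yphi hP m j0.
apply: (le_trans (risk_le (ebd_AY hP) h1 h2 (psi P) n0 (kernel _ (ae_A hP))
   (kernel _ (ae_Y hP)))).
have -> : mean P AY - \sum_m mean P (Aphi m) * mean P (@Yphi (j n) m) - psi P
    = resid (phi (j n)) p b.
  rewrite (psiE PX hA hY Ap Yb) /resid -/(inner p b).
  under eq_bigr do rewrite (mean_Aphi hP _ j0 Ap) (mean_Yphi hP _ j0 Yb).
  rewrite -[mean P (fun o => obsA o * obsY o)]/(mean P AY) -[mean U _]/(inner p b).
  by ring.
have b1 : resid (phi (j n)) p b ^+ 2 <=
    Ca ^+ 2 * (2 `^ (- ((j n)%:R * (alpha + beta)))) ^+ 2.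
  rewrite -exprMn -real_normK ?num_real// lerXn2r ?nnegrE ?mulr_ge0 ?powR_ge0 ?(ltW Ca0)//.
  exact: HCa.
have b2 : mean P (fun o => AY o ^+ 2) <= c ^+ 4.
  have hAY := ebd_AY hP.
  rewrite -[leRHS](mean_cst P); apply: le_mean; [by ebd2|by ebd2|].
  apply: filterS2 (ae_A hP) (ae_Y hP) => o Ao Yo.
  rewrite /AY exprMn -[c ^+ 4]/(c ^+ (2 + 2)) exprD.
  by apply: ler_pM; rewrite ?sqr_ge0// -real_normK ?num_real// lerXn2r// nnegrE.
have b3 : mean P (fun o => (\sum_m mean P (Aphi m) * @Yphi (j n) m o) ^+ 2) <= c ^+ 4.
  under eq_mean => o.
    under eq_bigr => m _ do rewrite (mean_Aphi hP _ j0 Ap).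
    over.
  exact: (weighted_proj_le hP j0 hY (ae_Y hP) hA (ae_A hP) Ap).
have b4 : mean P (fun o => (\sum_m mean P (Yphi m) * @Aphi (j n) m o) ^+ 2) <= c ^+ 4.
  under eq_mean => o.
    under eq_bigr => m _ do rewrite (mean_Yphi hP _ j0 Yb).
    over.
  exact: (weighted_proj_le hP j0 hA (ae_A hP) hY (ae_Y hP) Yb).
have ni : 0 <= n%:R^-1 :> R by rewrite invr_ge0.
set t := (2 `^ _) ^+ 2 in b1 *; have t0 : 0 <= t by rewrite p0// powR_ge0.
set u := n%:R^-1 in ni *.
have b5 : u * (mean P (fun o => AY o ^+ 2)
   + mean P (fun o => (\sum_m mean P (Aphi m) * @Yphi (j n) m o) ^+ 2)
   + mean P (fun o => (\sum_m mean P (Yphi m) * @Aphi (j n) m o) ^+ 2))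
   <= u * (3 * c ^+ 4).
  by rewrite ler_wpM2l//; lra.
have -> : 48 * (c ^+ 2 * Ck * k * u) ^+ 2
  = 48 * (c ^+ 2 * Ck) ^+ 2 * (k * u) ^+ 2 by ring.
have v0 : 0 <= (k * u) ^+ 2 by exact: sqr_ge0.
have x1 : 0 <= Ca ^+ 2 by exact: sqr_ge0.
have x2 : 0 <= 3 * c ^+ 4 by rewrite mulr_ge0// p0.
have x3 : 0 <= 48 * (c ^+ 2 * Ck) ^+ 2 by rewrite mulr_ge0// sqr_ge0.
rewrite /C; move: b1 b5 x1 x2 x3 v0.
move: (resid _ _ _ ^+ 2) (u * _) (Ca ^+ 2) (3 * c ^+ 4) (48 * (c ^+ 2 * Ck) ^+ 2) ((k * u) ^+ 2).
move=> r w y1 y2 y3 v b1 b5 x1 x2 x3 v0.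
apply: (@le_trans _ _ (5 * (y1 * t + u * y2 + y3 * v))).
  by rewrite ler_wpM2l// lerD2r lerD.
have := mulr_ge0 x1 ni; have := mulr_ge0 x1 v0; have := mulr_ge0 x2 t0.
have := mulr_ge0 x2 v0; have := mulr_ge0 x3 t0; have := mulr_ge0 x3 ni.
by lra.
Qed.

End estimator.

(** * Laws with prescribed regression functions and conditional covariance *)

Lemma ae_pushforward_conv d1 d2 (T1 : measurableType d1)
    (T2 : measurableType d2) (R : realType)
    (P : probability T1 R) (Q : probability T2 R) (h : T1 -> T2) (A : set T2) :
  measurable_fun setT h ->
  (forall B, measurable B -> P (h @^-1` B) = Q B) ->
  measurable A -> {ae P, forall x, A (h x)} -> {ae Q, forall y, A y}.
Proof.
move=> mh PQ mA PA; exists (~` A); split => //; first exact: measurableC.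
rewrite -PQ; last exact: measurableC.
apply/negligibleP => //.
by rewrite -[X in measurable X]setTI; apply: mh => //; exact: measurableC.
Qed.

Definition sg (R : pzRingType) (c : bool) : R := if c then 1 else -1.

Lemma sg_sqr (R : pzRingType) c : sg R c * sg R c = 1.
Proof. by case: c; rewrite /sg ?mulr1// mulrNN mulr1. Qed.

Section signs.
Context (R : realType) (q : R).
Hypothesis q01 : 0 <= q <= 1.
Local Notation B1 := [the probability _ _ of bernoulli_prob (2^-1 : R)].
Local Notation B2 := [the probability _ _ of bernoulli_prob q].

(** Independent signs with means 0 and 2 q - 1. *)
Definition signs : probability (bool * bool)%type R :=
  [the probability _ _ of (B1 \x B2)%E].

Lemma ebd_sg (P : probability bool R) : ebd P (sg R).
Proof.
split; first by move=> _ B mB.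
by exists 1; apply: aeW => -[]; rewrite /sg ?normrN normr1.
Qed.

Lemma mean_bernoulli_sg (r : R) : 0 <= r <= 1 ->
  mean [the probability _ _ of bernoulli_prob r] (sg R) = 2 * r - 1.
Proof.
move=> r01; set P := [the probability _ _ of bernoulli_prob r].
have hs := ebd_sg P.
have -> : mean P (sg R) = mean P (fun c => sg R c + 1) - 1.
  rewrite meanD; [|by ebd2..].
  by rewrite mean_cst addrK.
congr (_ - _); rewrite /mean /Rintegral.
rewrite integral_bernoulli_prob//; last by case; rewrite lee_fin /sg ?addNr// addr_ge0.
by rewrite /sg addNr mule0 adde0 /= mulrC.
Qed.

Lemma ebd_s1 : ebd signs (fun e => sg R e.1).
Proof. exact: (ebd_fst _ (ebd_sg _)). Qed.

Lemma ebd_s2 : ebd signs (fun e => sg R e.2).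
Proof. exact: (ebd_snd _ (ebd_sg _)). Qed.

Lemma mean_s1 : mean signs (fun e => sg R e.1) = 0.
Proof.
rewrite /signs (mean_fst _ (ebd_sg _)) mean_bernoulli_sg ?divff ?subrr//.
by apply/andP; split; lra.
Qed.

Lemma mean_s2 : mean signs (fun e => sg R e.2) = 2 * q - 1.
Proof. by rewrite /signs (mean_snd _ (ebd_sg _)) mean_bernoulli_sg. Qed.

Lemma mean_s12 : mean signs (fun e => sg R e.1 * sg R e.2) = 0.
Proof.
rewrite /signs (mean_prod (ebd_sg _) (ebd_sg _)) mean_bernoulli_sg.
  by rewrite divff// subrr mul0r.
by apply/andP; split; lra.
Qed.

End signs.

Section law.
Context (R : realType) (d : nat).
Local Notation U := (unif_cube R d).
Variables (p b : Rpt R d -> R) (eta q : R).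
Hypotheses (hp : ebd U p) (hb : ebd U b) (q01 : 0 <= q <= 1).
Local Notation theta := (2 * q - 1).

Definition Om : probability (Rpt R d * (bool * bool))%type R :=
  [the probability _ _ of (U \x signs q)%E].

(** Both noises are centred given X, while their product is eta ^ 2 times the
second sign: q sets the conditional covariance without moving p and b. *)
Definition draw (z : Rpt R d * (bool * bool)) : obs R d :=
  (z.1, p z.1 + eta * sg R z.2.1, b z.1 + eta * (sg R z.2.1 * sg R z.2.2)).

Let ms1 : measurable_fun setT (fun z : Rpt R d * (bool * bool) => sg R z.2.1).
Proof. exact: (ebd_snd U (ebd_s1 q)).1. Qed.

Let ms2 : measurable_fun setT (fun z : Rpt R d * (bool * bool) => sg R z.2.2).
Proof. exact: (ebd_snd U (ebd_s2 q)).1. Qed.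

Lemma measurable_draw : measurable_fun setT draw.
Proof.
have mp := hp.1; have mb := hb.1.
apply: measurable_fun_pair.
  apply: measurable_fun_pair; first exact: measurable_fst.
  apply: measurable_funD; first exact: measurableT_comp.
  by apply: measurable_funM => //; exact: measurable_cst.
apply: measurable_funD; first exact: measurableT_comp.
apply: measurable_funM; first exact: measurable_cst.
exact: measurable_funM.
Qed.

HB.instance Definition _ := @isMeasurableFun.Build _ _ _ _ draw measurable_draw.

Definition law : probability (obs R d) R :=
  [the probability _ _ of distribution Om [the {mfun _ >-> _} of draw]].

Lemma lawE B : measurable B -> Om (draw @^-1` B) = law B.
Proof. by []. Qed.

Lemma law_X B : measurable B -> law (@obsX R d @^-1` B) = U B.
Proof. by move=> mB; rewrite -(prod_fst U (signs q) mB). Qed.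

(** Every moment needed below comes from expanding F in the four products of
signs, of which only the constant and the second sign have a nonzero mean. *)
Lemma law_mean (F : obs R d -> R) w0 w1 w2 w3 : measurable_fun setT F ->
  ebd U w0 -> ebd U w1 -> ebd U w2 -> ebd U w3 ->
  (forall z, F (draw z) = w0 z.1 + w1 z.1 * sg R z.2.1 + w2 z.1 * sg R z.2.2
       + w3 z.1 * (sg R z.2.1 * sg R z.2.2)) ->
  ebd law F /\ mean law F = mean U w0 + mean U w2 * theta.
Proof.
move=> mF h0 h1 h2 h3 FE.
have e1 := ebd_s1 q; have e2 := ebd_s2 q.
have h1' : ebd Om (fun z => w1 z.1 * sg R z.2.1).
  by apply: ebdM; [exact: ebd_fst|exact: (ebd_snd U e1)].
have h2' : ebd Om (fun z => w2 z.1 * sg R z.2.2).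
  by apply: ebdM; [exact: ebd_fst|exact: (ebd_snd U e2)].
have h3' : ebd Om (fun z => w3 z.1 * (sg R z.2.1 * sg R z.2.2)).
  by apply: ebdM; [exact: ebd_fst|exact: (ebd_snd U (ebdM e1 e2))].
have h0' : ebd Om (fun z => w0 z.1) by exact: ebd_fst.
have hFd : ebd Om (fun z => F (draw z)).
  by rewrite (funext FE); apply: ebdD => //; apply: ebdD => //; exact: ebdD.
have hF : ebd law F.
  split => //; have [_ [C FC]] := hFd; exists C.
  apply: (ae_pushforward_conv measurable_draw lawE _ FC).
  rewrite -[X in measurable X]setTI.
  apply: (measurable_fun_le (f := fun o => `|F o|) (g := fun=> C)) => //.
  - exact: measurableT_comp.
split => //.
rewrite -(mean_pushforward measurable_draw lawE hF) (funext FE).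
rewrite meanD; [|by repeat apply: ebdD|by []].
rewrite meanD; [|by repeat apply: ebdD|by []].
rewrite meanD; [|by []|by []].
rewrite (mean_fst _ h0) (mean_prod h1 e1) (mean_prod h2 e2).
rewrite (@mean_prod _ _ _ _ _ U (signs q) w3 (fun e => sg R e.1 * sg R e.2) h3 (ebdM e1 e2)).
by rewrite mean_s1 mean_s2// mean_s12; ring.
Qed.

Let mw (w : Rpt R d -> R) : ebd U w -> measurable_fun setT (fun o : obs R d => w (obsX o)).
Proof. by move=> [mw _]; apply: measurableT_comp => //; exact: measurable_obsX. Qed.

Let mA := @measurable_obsA R d.
Let mY := @measurable_obsY R d.

Let e0 : ebd U (fun=> 0). Proof. exact: ebd_cst. Qed.

Lemma law_Aw w : ebd U w -> ebd law (fun o => obsA o * w (obsX o)) /\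
  mean law (fun o => obsA o * w (obsX o)) = mean U (fun x => p x * w x).
Proof.
move=> hw; have := law_mean (F := fun o => obsA o * w (obsX o))
  (measurable_funM mA (mw hw)) (ebdM hp hw) (ebdM (ebd_cst U eta) hw) e0 e0.
rewrite mean_cst mul0r addr0; apply => z.
by rewrite /draw/= /obsA /obsX/=; ring.
Qed.

Lemma law_Yw w : ebd U w -> ebd law (fun o => obsY o * w (obsX o)) /\
  mean law (fun o => obsY o * w (obsX o)) = mean U (fun x => b x * w x).
Proof.
move=> hw; have := law_mean (F := fun o => obsY o * w (obsX o))
  (measurable_funM mY (mw hw)) (ebdM hb hw) e0 e0 (ebdM (ebd_cst U eta) hw).
rewrite mean_cst mul0r addr0; apply => z.
by rewrite /draw/= /obsY /obsX/=; ring.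
Qed.

(** The product of the noises is eta ^ 2 times the second sign, because the
square of the first one is 1. *)
Lemma law_AYw w : ebd U w ->
  mean law (fun o => obsA o * obsY o * w (obsX o))
  = mean U (fun x => p x * b x * w x) + eta ^+ 2 * theta * mean U w.
Proof.
move=> hw; have := law_mean (F := fun o => obsA o * obsY o * w (obsX o))
  (measurable_funM (measurable_funM mA mY) (mw hw)) (ebdM (ebdM hp hb) hw)
  (ebdM (ebdM (ebd_cst U eta) hb) hw) (ebdM (ebd_cst U (eta ^+ 2)) hw)
  (ebdM (ebdM (ebd_cst U eta) hp) hw).
move=> H; have [|_ ->] := H.
  move=> z; rewrite /draw/= /obsA /obsY /obsX/=.
  set s1 := sg R z.2.1; set s2 := sg R z.2.2.
  have s11 : s1 * s1 = 1 by exact: sg_sqr.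
  rewrite -[eta ^+ 2 * _]mulr1 -s11; ring.
by rewrite meanZ//; ring.
Qed.

Lemma ebd_lawA : ebd law (@obsA R d).
Proof.
have [+ _] := law_Aw (ebd_cst U 1).
by under eq_fun do rewrite mulr1.
Qed.

Lemma ebd_lawY : ebd law (@obsY R d).
Proof.
have [+ _] := law_Yw (ebd_cst U 1).
by under eq_fun do rewrite mulr1.
Qed.

Lemma law_cond_exp (T : obs R d -> R) g : ebd law T -> ebd U g ->
  (forall w, ebd U w -> mean law (fun o => T o * w (obsX o))
     = mean U (fun x => g x * w x)) -> is_cond_exp law T g.
Proof.
move=> hT hg TgE; have hgX := ebd_X law_X hg; split.
- exact: ebd_integrable.
- exact: hg.1.
- exact: (ebd_integrable hgX).
move=> B mB; have h1 := ebd_indic U mB.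
rewrite -(mean_indic_X law_X hT mB) -(mean_indic_X law_X hgX mB) TgE//.
by congr EFin; rewrite -(mean_X law_X (ebdM hg h1)).
Qed.

Lemma law_condA : is_cond_exp law (@obsA R d) p.
Proof.
by apply: law_cond_exp => //; [exact: ebd_lawA|move=> w /law_Aw[]].
Qed.

Lemma law_condY : is_cond_exp law (@obsY R d) b.
Proof.
by apply: law_cond_exp => //; [exact: ebd_lawY|move=> w /law_Yw[]].
Qed.

Lemma law_psi : psi law = eta ^+ 2 * theta.
Proof.
rewrite (psiE law_X ebd_lawA ebd_lawY law_condA law_condY).
have := law_AYw (ebd_cst U 1).
under eq_mean do rewrite mulr1.
under [X in _ = X + _]eq_mean do rewrite mulr1.
by move=> ->; rewrite mean_cst mulr1 addrAC subrr add0r.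
Qed.

Section conditional_independence.
Hypothesis q2 : q = 2^-1.

(** The score for the conditional covariance: for q = 1/2 it is centred and
uncorrelated with A and with Y times any function of X. *)
Definition noise (o : obs R d) : R :=
  (obsA o - p (obsX o)) * (obsY o - b (obsX o)).

Lemma noise_draw z : noise (draw z) = eta ^+ 2 * sg R z.2.2.
Proof.
rewrite /noise /draw /obsA /obsY /obsX/= -[RHS]mulr1 -(sg_sqr R z.2.1).
by ring.
Qed.

Lemma measurable_noise : measurable_fun setT noise.
Proof.
by apply: measurable_funM; apply: measurable_funB => //; exact: mw.
Qed.

Let th0 : theta = 0.
Proof. by rewrite q2 divff ?subrr. Qed.

Lemma ebd_noise : ebd law noise.
Proof.
have [|//] := law_mean measurable_noise e0 e0 (ebd_cst U (eta ^+ 2)) e0.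
by move=> z; rewrite noise_draw; ring.
Qed.

Lemma mean_noise : mean law noise = 0.
Proof.
have [|_ ->] := law_mean measurable_noise e0 e0 (ebd_cst U (eta ^+ 2)) e0.
  by move=> z; rewrite noise_draw; ring.
by rewrite mean_cst th0; ring.
Qed.

Lemma mean_noise2 : mean law (fun o => noise o ^+ 2) = eta ^+ 4.
Proof.
have mn := measurable_noise.
have [|_ ->] := law_mean (F := fun o => noise o ^+ 2)
  (measurable_funX 2 mn) (ebd_cst U (eta ^+ 4)) e0 e0 e0.
  move=> z; rewrite noise_draw expr2 mulrACA sg_sqr; ring.
by rewrite !mean_cst; ring.
Qed.

Lemma mean_Aw_noise w : ebd U w ->
  mean law (fun o => obsA o * w (obsX o) * noise o) = 0.
Proof.
move=> hw; have mn := measurable_noise.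
have [|_ ->] := law_mean (F := fun o => obsA o * w (obsX o) * noise o)
  (measurable_funM (measurable_funM mA (mw hw)) mn) e0 e0
  (ebdM (ebd_cst U (eta ^+ 2)) (ebdM hp hw)) (ebdM (ebd_cst U (eta ^+ 3)) hw).
  by move=> z; rewrite noise_draw /draw /obsA /obsX/=; ring.
by rewrite mean_cst th0; ring.
Qed.

Lemma mean_Yw_noise w : ebd U w ->
  mean law (fun o => obsY o * w (obsX o) * noise o) = 0.
Proof.
move=> hw; have mn := measurable_noise.
have [|_ ->] := law_mean (F := fun o => obsY o * w (obsX o) * noise o)
  (measurable_funM (measurable_funM mY (mw hw)) mn) e0
  (ebdM (ebd_cst U (eta ^+ 3)) hw) (ebdM (ebd_cst U (eta ^+ 2)) (ebdM hb hw)) e0.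
  move=> z; rewrite noise_draw /draw /obsY /obsX/=.
  have s22 := sg_sqr R z.2.2.
  rewrite -[X in _ = _ + X * _ + _ + _]mulr1 -s22; ring.
by rewrite mean_cst th0; ring.
Qed.

Lemma mean_AYw_noise w : ebd U w ->
  mean law (fun o => obsA o * obsY o * w (obsX o) * noise o)
  = eta ^+ 4 * mean U w.
Proof.
move=> hw; have mn := measurable_noise.
have [|_ ->] := law_mean (F := fun o => obsA o * obsY o * w (obsX o) * noise o)
  (measurable_funM (measurable_funM (measurable_funM mA mY) (mw hw)) mn)
  (ebdM (ebd_cst U (eta ^+ 4)) hw)
  (ebdM (ebd_cst U (eta ^+ 3)) (ebdM hp hw))
  (ebdM (ebd_cst U (eta ^+ 2)) (ebdM (ebdM hp hb) hw))
  (ebdM (ebd_cst U (eta ^+ 3)) (ebdM hb hw)).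
  move=> z; rewrite noise_draw /draw /obsA /obsY /obsX/=.
  have s22 := sg_sqr R z.2.2; have s11 := sg_sqr R z.2.1.
  set s1 := sg R z.2.1 in s11 *; set s2 := sg R z.2.2 in s22 *.
  transitivity (eta ^+ 4 * w z.1 * (s1 * s1) * (s2 * s2)
    + eta ^+ 3 * (p z.1 * w z.1) * s1 * (s2 * s2)
    + eta ^+ 2 * (p z.1 * b z.1 * w z.1) * s2
    + eta ^+ 3 * (b z.1 * w z.1) * (s1 * s2)); first by ring.
  by rewrite s11 s22 !mulr1.
by rewrite th0 mulr0 addr0 meanZ.
Qed.

End conditional_independence.
End law.

(** * Risk of the estimator under such a law *)

Section lower.
Context (R : realType) (d : nat) (W : wavelet_system R d) (S J0 : nat).
Hypothesis hW : cdv_basis W S J0.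
Variables (C1 C2 alpha beta M : R).
Local Notation U := (unif_cube R d).
Local Notation Z := (idx W).
Local Notation phi l := (@scaling R d W l).

Section one_law.
Variables (p b : Rpt R d -> R) (eta q : R).
Hypotheses (hp : ebd U p) (hb : ebd U b) (q01 : 0 <= q <= 1) (eta0 : 0 <= eta).
Hypotheses (pC : {ae U, forall x, C1 + eta <= p x <= C2 - eta})
  (bC : {ae U, forall x, C1 + eta <= b x <= C2 - eta}).
Hypotheses (pH : holder_ball W J0 alpha M p) (bH : holder_ball W J0 beta M b).
Local Notation P := (law eta q hp hb).

Lemma law_model : model W J0 C1 C2 alpha beta M P.
Proof.
split.
- exact: law_X.
- have mI (f : obs R d -> R) : measurable_fun setT f ->
      measurable [set o | C1 <= f o <= C2].
    move=> mf; have -> : [set o | C1 <= f o <= C2] = f @^-1` `[C1, C2]%classic.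
      by apply/seteqP; split => o /=; rewrite in_itv.
    by rewrite -[X in measurable X]setTI; exact: mf.
  apply: (ae_pushforward_conv (measurable_draw eta q hp hb) (@lawE _ _ _ _ eta q hp hb)).
    have -> : (fun o : obs R d => C1 <= obsA o <= C2 /\ C1 <= obsY o <= C2)
      = [set o | C1 <= obsA o <= C2] `&` [set o | C1 <= obsY o <= C2] by [].
    apply: measurableI; apply: mI; [exact: measurable_obsA|exact: measurable_obsY].
  have := ae_pushforward measurable_fst (prod_fst U (signs q)) pC.
  have := ae_pushforward measurable_fst (prod_fst U (signs q)) bC.
  apply: filterS2 => -[x [s1 s2]] /= /andP[b1 b2] /andP[p1 p2].
  rewrite /draw /obsA /obsY/=.
  have sgE s : sg R s = 1 \/ sg R s = -1 by case: s; [left|right].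
  move: b1 b2 p1 p2; move: (p x) (b x) eta0 => px bx e0 b1 b2 p1 p2.
  by case: (sgE s1) => ->; case: (sgE s2) => ->; split; apply/andP; split; lra.
- by exists p => //; exact: law_condA.
- by exists b => //; exact: law_condY.
Qed.

Lemma risk_ge_plugin j n (c : R) : (J0 <= j n)%N ->
  c <= mean (pow_prob P n)
    (fun D => (plugin (@AY R d) (@Aphi _ _ W (j n)) (@Yphi _ _ W (j n)) D - psi P) ^+ 2) ->
  (c%:E <= max_risk W J0 C1 C2 alpha beta M j n)%E.
Proof.
move=> j0 cE.
apply: (@le_trans _ _ ('E_(pow_prob P n)[fun D => ((psi_NR W (j n) D - psi P) ^+ 2)%R])%E).
  by rewrite (risk_EFin hW law_model)// lee_fin.
by apply: ereal_sup_ubound => /=; exists P => //; exact: law_model.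
Qed.

(** The part of the bias that is bilinear in the two regression functions; the
rest is proportional to psi #|Z j| / n, see [law_bias]. *)
Definition plugin_bias (j n : nat) (f g : Rpt R d -> R) : R :=
  inner f g - (1 - n%:R^-1) * (\sum_(m : Z j) inner f (scaling m) * inner g (scaling m))
  - n%:R^-1 * \sum_(m : Z j) mean U (fun x => f x * g x * scaling m x ^+ 2).

Lemma mean_phi2 j (m : Z j) : (J0 <= j)%N -> mean U (fun x => scaling m x ^+ 2) = 1.
Proof.
move=> j0; transitivity (inner (phi j m) (phi j m)); last first.
  by rewrite (scaling_orthonormal hW)// eqxx.
by apply: eq_mean => x; rewrite expr2.
Qed.

Lemma ebd_phi2 j (m : Z j) : (J0 <= j)%N -> ebd U (fun x => scaling m x ^+ 2).
Proof. by move=> j0; apply: ebdX; exact: (ebd_scaling hW). Qed.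

(** The diagonal pairs contribute the mean of A Y phi_m ^ 2, which contains
psi once for each m because phi_m has norm one. *)
Lemma law_bias j n : (0 < n)%N -> (J0 <= j)%N ->
  mean (pow_prob P n) (plugin (@AY R d) (@Aphi _ _ W j) (@Yphi _ _ W j) (n := n))
  - psi P = plugin_bias j n p b - n%:R^-1 * (eta ^+ 2 * (2 * q - 1) * #|Z j|%:R).
Proof.
move=> n0 j0; have hP := law_model.
have h1 := fun m : Z j => ebd_Aphi hW hP m j0.
have h2 := fun m : Z j => ebd_Yphi hW hP m j0.
rewrite (mean_plugin (ebd_AY hP) h1 h2 n0) (law_psi eta hp hb q01).
under eq_bigr do rewrite (mean_Aphi hW hP _ j0 (law_condA eta hp hb q01))
  (mean_Yphi hW hP _ j0 (law_condY eta hp hb q01)).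
have -> : mean P (@AY R d) = inner p b + eta ^+ 2 * (2 * q - 1).
  have := law_AYw eta hp hb q01 (ebd_cst U 1); rewrite mean_cst mulr1 => E.
  transitivity (mean P (fun o => obsA o * obsY o * 1)).
    by apply: eq_mean => o; rewrite mulr1.
  by rewrite E; congr (_ + _); apply: eq_mean => x; rewrite mulr1.
have -> : \sum_(m : Z j) mean P (fun o => Aphi m o * Yphi m o) =
   \sum_(m : Z j) mean U (fun x => p x * b x * scaling m x ^+ 2)
   + eta ^+ 2 * (2 * q - 1) * #|Z j|%:R.
  rewrite [X in _ = _ + X]mulrC -(sum_cst (Z j) (eta ^+ 2 * (2 * q - 1))) -big_split/=.
  apply: eq_bigr => m _.
  have := law_AYw eta hp hb q01 (ebd_phi2 m j0); rewrite mean_phi2// mulr1 => <-.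
  by apply: eq_mean => o; rewrite /Aphi /Yphi; ring.
by rewrite /plugin_bias; ring.
Qed.

Lemma risk_ge_bias2 j n : (0 < n)%N -> (J0 <= j n)%N ->
  (((plugin_bias (j n) n p b - n%:R^-1 * (eta ^+ 2 * (2 * q - 1) * #|Z (j n)|%:R)) ^+ 2)%:E
    <= max_risk W J0 C1 C2 alpha beta M j n)%E.
Proof.
move=> n0 j0; apply: risk_ge_plugin => //; have hP := law_model.
have h1 := fun m : Z (j n) => ebd_Aphi hW hP m j0.
have h2 := fun m : Z (j n) => ebd_Yphi hW hP m j0.
by rewrite -law_bias//; apply: (risk_ge_bias (ebd_AY hP) h1 h2).
Qed.

(** The covariance of the estimator with the sum of the noise is
eta ^ 4 (1 - #|Z j| / n), and that sum has variance n eta ^ 4. *)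
Lemma risk_ge_variance j n : (0 < n)%N -> (J0 <= j n)%N -> q = 2^-1 -> 0 < eta ->
  ((eta ^+ 4 * (1 - #|Z (j n)|%:R / n%:R) ^+ 2 / n%:R)%:E
    <= max_risk W J0 C1 C2 alpha beta M j n)%E.
Proof.
move=> n0 j0 q2 eta0'; apply: risk_ge_plugin => //; have hP := law_model.
have h1 := fun m : Z (j n) => ebd_Aphi hW hP m j0.
have h2 := fun m : Z (j n) => ebd_Yphi hW hP m j0.
have hphi := fun m : Z (j n) => ebd_scaling hW m j0.
have hn := ebd_noise eta hp hb q01.
have mn := mean_noise eta hp hb q01 q2.
have := risk_ge_cov (ebd_AY hP) h1 h2 (psi P) n0 hn mn.
rewrite (mean_plugin_cov (ebd_AY hP) h1 h2 n0 hn mn); last first.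
- by move=> m; exact: (mean_Yw_noise eta hp hb q01 q2 (hphi m)).
- by move=> m; exact: (mean_Aw_noise eta hp hb q01 q2 (hphi m)).
rewrite (mean_noise2 eta hp hb q01).
have -> : mean P (fun o => AY o * noise p b o) = eta ^+ 4.
  have := mean_AYw_noise eta hp hb q01 q2 (ebd_cst U 1); rewrite mean_cst mulr1 => <-.
  by apply: eq_mean => o; rewrite mulr1.
have -> : \sum_(m : Z (j n)) mean P (fun o => Aphi m o * Yphi m o * noise p b o)
    = #|Z (j n)|%:R * eta ^+ 4.
  rewrite -sum_cst; apply: eq_bigr => m _.
  have := mean_AYw_noise eta hp hb q01 q2 (ebd_phi2 m j0); rewrite mean_phi2// mulr1 => <-.
  by apply: eq_mean => o; rewrite /Aphi /Yphi; ring.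
have n0' : 0 < n%:R :> R by rewrite ltr0n.
have e4 : 0 < eta ^+ 4 by exact: exprn_gt0.
set r := mean _ _ => H.
rewrite ler_pdivrMr// -(@ler_pM2r _ (eta ^+ 4))//.
apply: le_trans (_ : r * (n%:R * eta ^+ 4) <= _); last by rewrite mulrA.
apply: le_trans H; rewrite le_eqVlt; apply/orP; left; apply/eqP; ring.
Qed.

End one_law.
End lower.

(** * Uniformly continuous functions and polynomial bumps *)

Section uniform_continuity.
Context (R : realType) (d : nat).
Local Notation X := (Rpt R d).
Local Notation uc := (@unif_continuous_on_cube R d).

(** Walking from the origin to x in N equal steps changes f by less than 1 at each
step. *)
Lemma uc_bounded f : uc f -> exists2 C : R, 0 < C & forall x, cube x -> `|f x| <= C.
Proof.
move=> /(_ 1 ltr01)[r r0 fr].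
pose N := (Num.truncn r^-1).+1.
have N0 : 0 < N%:R :> R by [].
have Nr : N%:R^-1 < r.
  rewrite -[ltRHS]invrK ltf_pV2 ?posrE ?invr_gt0//.
  have r1 : 0 <= r^-1 by rewrite invr_ge0 ltW.
  by have /andP[] := truncn_itv r1.
pose y (x : X) k : X := [tuple (k%:R / N%:R) * tnth x i | i < d].
exists (`|f (y [tuple 0 | _ < d] 0%N)| + N%:R); first by rewrite ltr_wpDl.
move=> x xc.
have yc k : (k <= N)%N -> cube (y x k).
  move=> kN i; rewrite tnth_mktuple; have /andP[x0 x1] := xc i.
  apply/andP; split; first by rewrite mulr_ge0// divr_ge0.
  by rewrite mulr_ile1 ?divr_ge0// ler_pdivrMr// mul1r ler_nat.
have step k : (k <= N)%N -> `|f (y x k) - f (y x 0%N)| <= k%:R.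
  elim: k => [|k IHk] kN; first by rewrite subrr normr0.
  have := fr (y x k.+1) (y x k) (yc _ kN) (yc _ (ltnW kN)).
  move=> H; have {}H : `|f (y x k.+1) - f (y x k)| < 1.
    apply: H => i; rewrite !tnth_mktuple -mulrBl -mulrBl -natr1 addrAC subrr add0r.
    have /andP[x0 x1] := xc i.
    rewrite ger0_norm; last by rewrite mulr_ge0// mul1r invr_ge0.
    by apply: le_lt_trans Nr; rewrite mul1r ler_piMr ?invr_ge0.
  rewrite -natr1; have := IHk (ltnW kN).
  have := ler_normD (f (y x k.+1) - f (y x k)) (f (y x k) - f (y x 0%N)).
  rewrite addrA subrK; lra.
have yN : y x N = x.
  by apply: eq_from_tnth => i; rewrite tnth_mktuple divff ?gt_eqF// mul1r.
have y0 : y x 0%N = y [tuple 0 | _ < d] 0%N.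
  by apply: eq_from_tnth => i; rewrite !tnth_mktuple !mul0r.
have := step N (leqnn N); rewrite yN y0.
have := ler_normD (f x - f (y [tuple 0 | _ < d] 0%N)) (f (y [tuple 0 | _ < d] 0%N)).
rewrite subrK; lra.
Qed.

Lemma uc_cst c : uc (fun=> c).
Proof. by move=> e e0; exists 1 => // x y _ _ _; rewrite subrr normr0. Qed.

Lemma uc_coord i : uc (fun x => tnth x i).
Proof. by move=> e e0; exists e => // x y _ _; exact. Qed.

Lemma ucD f g : uc f -> uc g -> uc (fun x => f x + g x).
Proof.
move=> hf hg e e0; have e20 : 0 < e / 2 by rewrite divr_gt0.
have [r r0 fr] := hf _ e20; have [s s0 gs] := hg _ e20.
exists (Num.min r s); first by rewrite lt_min r0.
move=> x y xc yc xy.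
have fxy : `|f x - f y| < e / 2.
  by apply: fr => // i; apply: (lt_le_trans (xy i)); rewrite ge_min lexx.
have gxy : `|g x - g y| < e / 2.
  by apply: gs => // i; apply: (lt_le_trans (xy i)); rewrite ge_min lexx orbT.
rewrite opprD addrACA (le_lt_trans (ler_normD _ _))// [ltRHS]splitr.
exact: ltrD.
Qed.

Lemma ucM f g : uc f -> uc g -> uc (fun x => f x * g x).
Proof.
move=> hf hg e e0.
have [C C0 fC] := uc_bounded hf; have [D D0 gD] := uc_bounded hg.
have eD : 0 < e / 2 / D by rewrite !divr_gt0.
have eC : 0 < e / 2 / C by rewrite !divr_gt0.
have [r r0 fr] := hf _ eD; have [s s0 gs] := hg _ eC.
exists (Num.min r s); first by rewrite lt_min r0.
move=> x y xc yc xy.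
have fxy : `|f x - f y| < e / 2 / D.
  by apply: fr => // i; apply: (lt_le_trans (xy i)); rewrite ge_min lexx.
have gxy : `|g x - g y| < e / 2 / C.
  by apply: gs => // i; apply: (lt_le_trans (xy i)); rewrite ge_min lexx orbT.
have -> : f x * g x - f y * g y = (f x - f y) * g x + f y * (g x - g y) by ring.
rewrite (le_lt_trans (ler_normD _ _))// [ltRHS]splitr !normrM.
apply: ltr_leD.
  apply: (@le_lt_trans _ _ (`|f x - f y| * D)); first by rewrite ler_wpM2l// gD.
  by rewrite -ltr_pdivlMr.
apply: (@le_trans _ _ (C * `|g x - g y|)); first by rewrite ler_wpM2r// fC.
by rewrite mulrC -ler_pdivlMr// ltW.
Qed.

Lemma uc_sum (I : Type) (r : seq I) (Q : pred I) (F : I -> X -> R) :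
  (forall i, uc (F i)) -> uc (fun x => \sum_(i <- r | Q i) F i x).
Proof.
move=> hF; elim: r => [|i r IHr].
  by under eq_fun do rewrite big_nil; exact: uc_cst.
by under eq_fun do rewrite big_cons; case: (Q i) => //; exact: ucD.
Qed.

Lemma uc_prod (I : Type) (r : seq I) (F : I -> X -> R) :
  (forall i, uc (F i)) -> uc (fun x => \prod_(i <- r) F i x).
Proof.
move=> hF; elim: r => [|i r IHr].
  by under eq_fun do rewrite big_nil; exact: uc_cst.
by under eq_fun do rewrite big_cons; exact: ucM.
Qed.

Lemma ucX f n : uc f -> uc (fun x => f x ^+ n).
Proof.
move=> hf; elim: n => [|n IHn].
  by under eq_fun do rewrite expr0; exact: uc_cst.
by under eq_fun do rewrite exprS; exact: ucM.
Qed.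

Lemma uc_max0 f : uc f -> uc (fun x => Num.max 0 (f x)).
Proof.
move=> hf e e0; have [r r0 fr] := hf e e0; exists r => // x y xc yc xy.
apply: le_lt_trans (fr x y xc yc xy).
rewrite /Num.max; case: ltP => h1; case: ltP => h2; rewrite ?subrr ?normr0 ?normr_ge0// ?sub0r ?subr0 ?normrN.
- rewrite !ger0_norm//; [|lra|lra]; lra.
- rewrite (ltr0_norm (x := f x - f y)); last by lra.
  by rewrite gtr0_norm//; lra.
Qed.

End uniform_continuity.

Section bumps.
Context (R : realType) (d S J : nat).
Hypothesis S1 : (1 <= S)%N.
Local Notation X := (Rpt R d).
Local Notation U := (unif_cube R d).

Definition hat (t : R) : R := Num.max 0 (t * (1 - t)).

Definition cells := {ffun 'I_d -> 'I_(2 ^ J)}.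

Local Notation D := (2 ^+ J : R).

Let D0 : 0 < D. Proof. exact: exprn_gt0. Qed.

(** Coordinates in which the cell c is the unit cube. *)
Definition loc (c : cells) (x : X) i : R := D * tnth x i - (c i)%:R.

(** On its cell a polynomial that vanishes to order S at the faces, zero outside:
as smooth as wavelets of regularity S can detect. *)
Definition cell_bump (c : cells) (x : X) : R := \prod_i hat (loc c x i) ^+ S.

Definition in_cell (c : cells) (x : X) := forall i, 0 <= loc c x i <= 1.

Lemma hat_ge0 t : 0 <= hat t.
Proof. by rewrite /hat le_max lexx. Qed.

Lemma hat_le1 t : hat t <= 1.
Proof. by rewrite /hat ge_max ler01/=; have := sqr_ge0 (t - 1 / 2); nra. Qed.

Lemma hat_out t : t <= 0 \/ 1 <= t -> hat t = 0.
Proof. by move=> h; rewrite /hat max_l//; case: h => h; nra. Qed.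

Lemma hat_in t : 0 <= t <= 1 -> hat t = t * (1 - t).
Proof. by move=> /andP[t0 t1]; rewrite /hat max_r// mulr_ge0// subr_ge0. Qed.

Lemma bump_ge0 c x : 0 <= cell_bump c x.
Proof. by apply: prodr_ge0 => i _; rewrite exprn_ge0 ?hat_ge0. Qed.

Lemma bump_le c x i : cell_bump c x <= hat (loc c x i) ^+ S.
Proof.
rewrite /cell_bump (bigD1 i)//= ler_piMr ?exprn_ge0 ?hat_ge0//.
by apply: prodr_ile1 => k _; rewrite exprn_ge0 ?hat_ge0//= exprn_ile1 ?hat_ge0 ?hat_le1.
Qed.

Lemma bump_le1 c x : cell_bump c x <= 1.
Proof.
by apply: prodr_ile1 => k _; rewrite exprn_ge0 ?hat_ge0//= exprn_ile1 ?hat_ge0 ?hat_le1.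
Qed.

Lemma bump_in_cell c x : cell_bump c x != 0 -> in_cell c x.
Proof.
move=> cx i; apply/negPn/negP => ci; move/eqP: cx; apply.
rewrite /cell_bump (bigD1 i)//= hat_out ?expr0n ?gtn_eqF// ?mul0r//.
by move: ci; rewrite negb_and -!ltNge => /orP[|] h; [left|right]; exact: ltW.
Qed.

Lemma bump_other c c' x : c' != c -> in_cell c x -> cell_bump c' x = 0.
Proof.
move=> cc' cx; have [i ci] : exists i, c' i != c i.
  apply/existsP; apply: contraNT cc'; rewrite negb_exists => /forallP h.
  by apply/eqP/ffunP => i; apply/eqP; have := h i; rewrite negbK.
rewrite /cell_bump (bigD1 i)//= hat_out ?expr0n ?gtn_eqF// ?mul0r//.
have /andP[] := cx i; rewrite /loc => h0 h1.
have : (c' i < c i)%N \/ (c i < c' i)%N.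
  by apply/orP; rewrite -neq_ltn.
case=> cl; [right|left].
- have : (c' i)%:R + 1 <= (c i)%:R :> R by rewrite natr1 ler_nat.
  by move: h0 h1; move: (c i : nat) (c' i : nat) => a b; lra.
- have : (c i)%:R + 1 <= (c' i)%:R :> R by rewrite natr1 ler_nat.
  by move: h0 h1; move: (c i : nat) (c' i : nat) => a b; lra.
Qed.

Lemma cell_exists x : cube x -> exists c, in_cell c x.
Proof.
move=> xc.
have cl i : (minn (Num.truncn (D * tnth x i)) (2 ^ J).-1 < 2 ^ J)%N.
  by rewrite gtn_min prednK ?leqnn ?orbT// expn_gt0.
exists [ffun i => Ordinal (cl i)] => i; rewrite /loc ffunE/=.
have /andP[x0 x1] := xc i.
have y0 : 0 <= D * tnth x i by rewrite mulr_ge0// ltW.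
have /andP[t0 t1] := truncn_itv y0.
have y1 : D * tnth x i <= (2 ^ J)%N%:R.
  by rewrite natrX ler_piMr// ltW.
set T := Num.truncn _ in t0 t1 *.
have [TJ|TJ] := leqP T (2 ^ J).-1.
  rewrite subr_ge0 t0/= lerBlDl.
  by rewrite natr1 ltW.
rewrite subr_ge0.
have E : (2 ^ J).-1%:R + 1 = (2 ^ J)%N%:R :> R by rewrite natr1 prednK// expn_gt0.
rewrite lerBlDl E y1 andbT (le_trans _ t0)// ler_nat.
exact: ltnW.
Qed.

Lemma uc_bump c : unif_continuous_on_cube (cell_bump c).
Proof.
apply: uc_prod => i; apply: ucX; apply: uc_max0.
have ucl : unif_continuous_on_cube (fun x : X => loc c x i).
  apply: ucD; last exact: uc_cst.
  by apply: ucM; [exact: uc_cst|exact: uc_coord].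
apply: ucM => //; apply: ucD; first exact: uc_cst.
have -> : (fun x : X => - loc c x i) = (fun x => -1 * loc c x i).
  by apply/funext => x; rewrite mulN1r.
by apply: ucM => //; exact: uc_cst.
Qed.

Lemma measurable_bump c : measurable_fun setT (cell_bump c).
Proof.
apply: measurable_prod => i _; apply: measurable_funX.
have ml : measurable_fun setT (fun x : X => loc c x i).
  apply: measurable_funB; last exact: measurable_cst.
  by apply: measurable_funM; [exact: measurable_cst|exact: measurable_coord].
apply: measurable_maxr; first exact: measurable_cst.
by apply: measurable_funM => //; apply: measurable_funB => //; exact: measurable_cst.
Qed.

Lemma cbd_bump c : cbd (cell_bump c).
Proof.
split; first exact: measurable_bump.
by exists 1 => x _; rewrite ger0_norm ?bump_ge0// bump_le1.
Qed.

Lemma ebd_bump c : ebd U (cell_bump c).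
Proof. by apply: cbd_ebd; exact: cbd_bump. Qed.

Lemma inner_bump_neq c c' : c != c' -> inner (cell_bump c) (cell_bump c') = 0.
Proof.
move=> cc'; rewrite innerE (eq_mean _ (g := fun=> 0)) ?mean_cst// => x.
have [->|/bump_in_cell cx] := eqVneq (cell_bump c x) 0; first by rewrite mul0r.
by rewrite (@bump_other c c') ?mulr0// eq_sym.
Qed.

Lemma inner_bump_le c : inner (cell_bump c) (cell_bump c) <= (D^-1) ^+ d.
Proof.
pose lo i : R := (c i)%:R / D; pose hi i : R := ((c i)%:R + 1) / D.
apply: (@le_trans _ _ (mean U (\1_(box lo hi)))); last first.
  by apply: mean_box_le => [|i]; [rewrite invr_ge0 ltW|rewrite /hi /lo -mulrBl addrAC subrr add0r mul1r].
have hb := ebd_bump c.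
apply: le_mean; [by ebd2|by apply: ebd_indic; exact: measurable_box|].
apply: aeW => x; rewrite indicE.
have [xb|xb] := boolP (x \in box lo hi).
  by rewrite mulr_ile1 ?bump_ge0 ?bump_le1.
have [->|/bump_in_cell cx] := eqVneq (cell_bump c x) 0; first by rewrite mul0r.
move/negP: xb; case; rewrite inE => i; have := cx i.
rewrite /loc /lo /hi subr_ge0 lerBlDl ler_pdivrMr// ler_pdivlMr//.
by rewrite [tnth x i * _]mulrC.
Qed.

(** In the middle half of each side the hat is at least 3/16; the division by 2 is
the length of that half. *)
Definition bump_mass : R := ((3 / 16) ^+ S) ^+ 2 / 2.

Lemma inner_bump_ge c : (bump_mass * D^-1) ^+ d <= inner (cell_bump c) (cell_bump c).
Proof.
pose lo i : R := ((c i)%:R + 1 / 4) / D; pose hi i : R := ((c i)%:R + 3 / 4) / D.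
have cD i : (c i)%:R + 1 <= D.
  by rewrite natr1 -natrX ler_nat.
have E : mean U (\1_(box lo hi)) = (D^-1 / 2) ^+ d.
  rewrite mean_box.
  - rewrite (eq_bigr (fun=> D^-1 / 2)) ?prodr_const ?card_ord// => i _.
    by rewrite /hi /lo; field; rewrite gt_eqF.
  - by move=> i; apply: divr_ge0; [rewrite addr_ge0// divr_ge0|exact: ltW].
  - by move=> i; rewrite /lo /hi ler_pM2r ?invr_gt0//; lra.
  - by move=> i; rewrite /hi ler_pdivrMr// mul1r; have := cD i; lra.
have hb := ebd_bump c.
have hi1 := ebd_indic U (measurable_box lo hi).
have -> : (bump_mass * D^-1) ^+ d = (((3 / 16) ^+ S) ^+ 2) ^+ d * mean U (\1_(box lo hi)).
  by rewrite E -exprMn /bump_mass; congr (_ ^+ _); rewrite mulrAC -!mulrA.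
rewrite -meanZ//; apply: le_mean; [by ebd2|by ebd2|].
apply: aeW => x; rewrite indicE.
have [|xb] := boolP (x \in box lo hi); last first.
  by rewrite mulr0 mulr_ge0 ?bump_ge0.
rewrite inE mulr1 => xb.
have h i : 3 / 16 <= hat (loc c x i).
  have /andP[] := xb i; rewrite /lo /hi ler_pdivrMr// ler_pdivlMr// => x1 x2.
  have l1 : 1 / 4 <= loc c x i by rewrite /loc; lra.
  have l2 : loc c x i <= 3 / 4 by rewrite /loc; lra.
  rewrite hat_in; last by apply/andP; split; lra.
  nra.
rewrite -expr2 exprAC lerXn2r ?nnegrE ?bump_ge0 ?exprn_ge0//; try lra.
rewrite -[d in X in X <= _]card_ord -prodr_const; apply: ler_prod => i _.
by rewrite exprn_ge0 ?lerXn2r ?nnegrE ?hat_ge0//=; lra.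
Qed.

End bumps.

(** * Wavelet coefficients of localised functions *)

Section wavelet_coefficients.
Context (R : realType) (d : nat) (W : wavelet_system R d) (S J0 : nat).
Hypothesis hW : cdv_basis W S J0.
Local Notation U := (unif_cube R d).
Local Notation Z := (idx W).
Local Notation X := (Rpt R d).

(** The monomial lies in V_l, which is orthogonal to the wavelets of level l. *)
Lemma wavelet_orth_monomial l i (m : Z l) (e : 'I_d -> nat) : (J0 <= l)%N ->
  (\sum_k e k < S)%N ->
  inner (fun x : X => \prod_k tnth x k ^+ e k) (wavelet i m) = 0.
Proof.
move=> l0 eS; have [a ae] := polynomial_reproduction hW l0 eS.
have hphi m' := @ebd_scaling _ _ _ _ _ hW l m' l0.
have hl := ebd_lin hphi a.
rewrite (ae_innerl _ hl (ebd_wavelet hW i m l0) ae); last first.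
  apply: measurable_prod => k _; apply: measurable_funX; exact: measurable_coord.
rewrite (inner_lin _ hphi (ebd_wavelet hW i m l0)) big1// => m' _.
by rewrite (scaling_orth_wavelet hW)// mulr0.
Qed.

Lemma cbd_poly (P : 'I_d -> {poly R}) : cbd (fun x : X => \prod_k (P k).[tnth x k]).
Proof.
have uc : unif_continuous_on_cube (fun x : X => \prod_k (P k).[tnth x k]).
  apply: uc_prod => k.
  under eq_fun do rewrite horner_coef.
  apply: uc_sum => r; apply: ucM; first exact: uc_cst.
  by apply: ucX; exact: uc_coord.
split.
  apply: measurable_prod => k _.
  under eq_fun do rewrite horner_coef.
  apply: measurable_sum => r; apply: measurable_funM; first exact: measurable_cst.
  by apply: measurable_funX; exact: measurable_coord.
by have [C _ hC] := uc_bounded uc; exists C.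
Qed.

Lemma wavelet_orth_poly l i (m : Z l) (P : 'I_d -> {poly R}) : (J0 <= l)%N ->
  (\sum_k (size (P k)).-1 < S)%N ->
  inner (fun x : X => \prod_k (P k).[tnth x k]) (wavelet i m) = 0.
Proof.
move=> l0 PS.
pose N := (\max_k size (P k)).
have PE x k : (P k).[x] = \sum_(r < N) (P k)`_r * x ^+ r.
  exact: (horner_coef_wide x (leq_bigmax k)).
have -> : (fun x : X => \prod_k (P k).[tnth x k]) = (fun x =>
    \sum_(e : {ffun 'I_d -> 'I_N}) (\prod_k (P k)`_(e k)) * \prod_k tnth x k ^+ e k).
  apply/funext => x; under eq_bigr do rewrite PE.
  rewrite bigA_distr_bigA/=; apply: eq_bigr => e _.
  by rewrite big_split.
have hmon (e : {ffun 'I_d -> 'I_N}) : ebd U (fun x : X => \prod_k tnth x k ^+ e k).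
  have -> : (fun x : X => \prod_k tnth x k ^+ e k) = (fun x => \prod_k ('X^(e k)).[tnth x k]).
    by apply/funext => x; apply: eq_bigr => k _; rewrite hornerXn.
  by apply: cbd_ebd; exact: cbd_poly.
rewrite (inner_lin _ hmon (ebd_wavelet hW i m l0)) big1// => e _.
have [/forallP h|] := boolP [forall k, (e k < size (P k))%N].
  rewrite wavelet_orth_monomial ?mulr0//.
  apply: leq_ltn_trans PS; apply: leq_sum => k _.
  by rewrite -ltnS prednK// (leq_trans _ (h k)).
rewrite negb_forall => /existsP[k]; rewrite -leqNgt => ek.
by rewrite (bigD1 k)//= nth_default// !mul0r.
Qed.

(** Height O(sqrt k) times volume O(1/k). One constant serves for both the norm and
the support. *)
Lemma localized_L1 (I : nat -> finType) (F : forall l, I l -> X -> R) :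
  (forall l m, (J0 <= l)%N -> ebd U (F l m)) -> compactly_localized F J0 ->
  exists2 C : R, 0 < C & forall l m, (J0 <= l)%N ->
    mean U (fun x => `|F l m x|) <= C / Num.sqrt (resolution d l)%:R /\
    exists z : X, forall x, cube x -> F l m x != 0 ->
      forall i, `|tnth x i - tnth z i| <= C / 2 ^+ l.
Proof.
move=> hF [C C0 HC].
exists (C * (2 * C) ^+ d + C); first by rewrite addr_gt0// mulr_gt0// exprn_gt0// mulr_gt0.
move=> l m l0; have [bd loc _] := HC l l0.
have two0 : 0 < 2 ^+ l :> R by exact: exprn_gt0.
have Cl0 : 0 <= C / 2 ^+ l by rewrite divr_ge0// ltW.
have [z zF] := loc m; split; last first.
  exists z => x xc Fx i; apply: (le_trans (zF x xc Fx i)).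
  apply: ler_wpM2r; first by rewrite invr_ge0 ltW.
  rewrite lerDr; apply: mulr_ge0; first exact: ltW.
  by apply: exprn_ge0; apply: mulr_ge0 => //; exact: ltW.
set k : R := (resolution d l)%:R.
have k0 : 0 < k by rewrite ltr0n expn_gt0.
have kE : k = 2 ^+ l ^+ d by rewrite /k /resolution natrX exprM.
pose lo i := tnth z i - C / 2 ^+ l; pose hi i := tnth z i + C / 2 ^+ l.
have hFn := ebd_norm (hF l m l0).
have hb := ebd_indic U (measurable_box lo hi).
have hFc : {ae U, forall x, `|F l m x| <= C * Num.sqrt k * \1_(box lo hi) x}.
  apply: filterS (ae_cube R d) => x xc; rewrite indicE.
  have [xb|xb] := boolP (x \in box lo hi); first by rewrite mulr1; exact: bd.
  have [->|Fx] := eqVneq (F l m x) 0; first by rewrite normr0 mulr0.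
  move/negP: xb; case; rewrite inE => i.
  have := zF x xc Fx i; rewrite ler_norml /lo /hi => /andP[h1 h2].
  by apply/andP; split; lra.
apply: (@le_trans _ _ (C * Num.sqrt k * mean U (\1_(box lo hi)))).
  by rewrite -meanZ//; apply: le_mean => //; ebd2.
apply: (@le_trans _ _ (C * Num.sqrt k * (2 * (C / 2 ^+ l)) ^+ d)).
  rewrite ler_wpM2l ?mulr_ge0 ?sqrtr_ge0 ?(ltW C0)//.
  apply: mean_box_le; first by rewrite mulr_ge0.
  by move=> i; rewrite /lo /hi; lra.
have sk : 0 < Num.sqrt k by rewrite sqrtr_gt0.
rewrite ler_pdivlMr//.
have -> : C * Num.sqrt k * (2 * (C / 2 ^+ l)) ^+ d * Num.sqrt k
   = C * (2 * C) ^+ d * (Num.sqrt k ^+ 2 / k).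
  by rewrite mulrA expr_div_n -kE expr2; field; rewrite gt_eqF.
by rewrite sqr_sqrtr ?(ltW k0)// divff ?gt_eqF// mulr1 lerDl ltW.
Qed.

(** Subtracting g leaves the coefficient unchanged. *)
Lemma wavelet_coef_local l i (m : Z l) (f g : X -> R) (E : R) : (J0 <= l)%N ->
  ebd U f -> ebd U g -> inner g (wavelet i m) = 0 ->
  (forall x, cube x -> wavelet i m x != 0 -> `|f x - g x| <= E) ->
  `|inner f (wavelet i m)| <= E * mean U (fun x => `|wavelet i m x|).
Proof.
move=> l0 hf hg g0 fgE; have hw := ebd_wavelet hW i m l0.
have hwn := ebd_norm hw.
rewrite -[inner f _]subr0 -g0 -innerBl//.
have h1 : ebd U (fun x => (f x - g x) * wavelet i m x) by ebd2.
have h2 := ebd_norm h1.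
apply: (le_trans (ler_norm_mean h1)); rewrite -meanZ//.
apply: le_mean; [by []|by ebd2|].
apply: filterS (ae_cube R d) => x xc; rewrite normrM.
have [->|wx] := eqVneq (wavelet i m x) 0; first by rewrite normr0 !mulr0.
by rewrite ler_wpM2r// fgE.
Qed.

End wavelet_coefficients.

Section bilinear_signs.
Context (R : realType) (d : nat) (I : finType) (u : I -> Rpt R d -> R).
Local Notation U := (unif_cube R d).
Hypotheses (hu : forall i, ebd U (u i)).

Lemma resid_sym f g : resid u f g = resid u g f.
Proof.
rewrite /resid innerC; congr (_ - _).
by apply: eq_bigr => i _; rewrite mulrC.
Qed.

Lemma residDl f f' g : ebd U f -> ebd U f' -> ebd U g ->
  resid u (fun x => f x + f' x) g = resid u f g + resid u f' g.
Proof.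
move=> hf hf' hg; rewrite /resid innerDl//.
under eq_bigr do rewrite innerDl// mulrDl.
by rewrite big_split/=; ring.
Qed.

Lemma residZl c f g : ebd U f -> ebd U g ->
  resid u (fun x => c * f x) g = c * resid u f g.
Proof.
move=> hf hg; rewrite /resid innerZl//.
under eq_bigr do rewrite innerZl// -mulrA.
by rewrite -mulr_sumr mulrBr.
Qed.

(** The signs are chosen one after the other, each making the cross term with the
previous sum nonnegative. *)
Lemma signs_exist (K : finType) (F : K -> Rpt R d -> R) :
  (forall k, ebd U (F k)) -> exists eps : K -> R, (forall k, `|eps k| = 1) /\
    \sum_k resid u (F k) (F k) <=
    resid u (fun x => \sum_k eps k * F k x) (fun x => \sum_k eps k * F k x).
Proof.
move=> hF; elim: (index_enum K) (index_enum_uniq K) => [_|k s IHs].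
  exists (fun=> 1); split; first by move=> k; rewrite normr1.
  rewrite big_nil.
  have -> : (fun x => \sum_(k <- [::]) 1 * F k x) = (fun=> 0 : R).
    by apply/funext => x; rewrite big_nil.
  rewrite /resid innerE (eq_mean _ (g := fun=> 0)) ?mean_cst; last by move=> x; rewrite mulr0.
  rewrite big1 ?subr0// => i _.
  by rewrite innerE (eq_mean _ (g := fun=> 0)) ?mean_cst ?mul0r// => x; rewrite mul0r.
rewrite cons_uniq => /andP[ks us]; have [eps [e1 Hs]] := IHs us.
pose f x := \sum_(k <- s) eps k * F k x.
have hf : ebd U f by rewrite /f; ebd2.
pose sgn : R := if 0 <= resid u f (F k) then 1 else -1.
have sgn2 : sgn * sgn = 1 by rewrite /sgn; case: ifP; rewrite ?mulr1// mulrNN mulr1.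
have sgnp : 0 <= sgn * resid u f (F k).
  by rewrite /sgn; case: ifPn => h; rewrite ?mul1r// mulN1r oppr_ge0 ltW// ltNge.
exists (fun k' => if k' == k then sgn else eps k'); split.
  by move=> k'; case: ifP => // _; rewrite /sgn; case: ifP; rewrite ?normrN normr1.
have E : (fun x => \sum_(k' <- k :: s) (if k' == k then sgn else eps k') * F k' x)
    = (fun x => sgn * F k x + f x).
  apply/funext => x; rewrite big_cons eqxx; congr (_ + _).
  rewrite /f big_seq [RHS]big_seq; apply: eq_bigr => k' k's.
  by case: eqP => // kk'; move: ks; rewrite -kk' k's.
rewrite E big_cons.
have hk := hF k.
have hs : ebd U (fun x => sgn * F k x) by ebd2.
have hsf : ebd U (fun x => sgn * F k x + f x) by ebd2.
rewrite residDl// residZl// ![resid u _ (fun x => _ + _)]resid_sym !residDl// !residZl//.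
rewrite [resid u (F k) f]resid_sym.
move: Hs sgnp; rewrite -/f; move: (\sum_(_ <- _) _) => a.
move: (resid u f (F k)) (resid u (F k) (F k)) (resid u f f) => r A B.
by rewrite -[A in A + a]mul1r -sgn2; lra.
Qed.

End bilinear_signs.

(** * Signed sums of bumps *)

Lemma horner_unit_bound (R : realType) (p : {poly R}) (u : R) : 0 <= u <= 1 ->
  `|p.[u]| <= \sum_(k < size p) `|p`_k|.
Proof.
move=> /andP[u0 u1]; rewrite horner_coef; apply: (le_trans (ler_norm_sum _ _ _)).
apply: ler_sum => k _; rewrite normrM ler_piMr// normrX exprn_ile1//.
by rewrite ger0_norm.
Qed.

Section combination.
Context (R : realType) (d S J : nat).
Hypothesis S1 : (1 <= S)%N.
Local Notation X := (Rpt R d).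
Local Notation U := (unif_cube R d).

Local Notation D := (2 ^+ J : R).
Implicit Types (c : cells d J) (x z : X).
Variable eps : cells d J -> R.
Hypothesis eps1 : forall c, `|eps c| <= 1.

Definition combo (x : X) : R := \sum_c eps c * cell_bump S c x.

Lemma combo_in_cell c x : in_cell c x -> combo x = eps c * cell_bump S c x.
Proof.
move=> cx; rewrite /combo (bigD1 c)//= big1 ?addr0// => c' cc'.
by rewrite (bump_other S1 cc' cx) mulr0.
Qed.

Lemma combo_le_bump c x : in_cell c x -> `|combo x| <= cell_bump S c x.
Proof.
move=> cx; rewrite (combo_in_cell cx) normrM [`|cell_bump _ _ _|]ger0_norm ?bump_ge0//.
by rewrite ler_piMl ?bump_ge0.
Qed.

Lemma combo_le1 x : cube x -> `|combo x| <= 1.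
Proof.
move=> /(@cell_exists R d J)[c cx].
by rewrite (le_trans (combo_le_bump cx))// bump_le1.
Qed.

Lemma uc_combo : unif_continuous_on_cube combo.
Proof. by apply: uc_sum => c; apply: ucM; [exact: uc_cst|exact: uc_bump]. Qed.

Lemma measurable_combo : measurable_fun setT combo.
Proof.
apply: measurable_sum => c; apply: measurable_funM; first exact: measurable_cst.
exact: measurable_bump.
Qed.

Lemma cbd_combo : cbd combo.
Proof. by split; [exact: measurable_combo|exists 1; exact: combo_le1]. Qed.

Lemma ebd_combo : ebd U combo.
Proof. by apply: cbd_ebd; exact: cbd_combo. Qed.

(** The faces of the cells lie on integer hyperplanes of the rescaled coordinate,
so x, even when in another cell than z, is within 2 rho of a face of its own
cell, where the bump vanishes to order S. *)
Lemma combo_near_face z x c i (rho : R) : cube x -> in_cell c z ->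
  (loc c z i < rho \/ 1 - rho < loc c z i) ->
  `|D * (tnth x i - tnth z i)| <= rho -> `|combo x| <= (2 * rho) ^+ S.
Proof.
move=> xc cz face xz.
have rho0 : 0 <= rho by exact: le_trans xz.
have [c' cx] := @cell_exists R d J x xc.
apply: (le_trans (combo_le_bump cx)); apply: (le_trans (bump_le S c' x i)).
rewrite lerXn2r ?nnegrE ?hat_ge0 ?mulr_ge0//.
have /andP[t0 t1] := cx i; have /andP[u0 u1] := cz i.
rewrite hat_in; last by rewrite t0.
move: xz; rewrite ler_norml mulrBr => /andP[xz1 xz2].
(* n is the integer hyperplane of the face near z; the cell of x lies on one side. *)
have [n nz] : exists n : int, `|D * tnth z i - n%:~R| <= rho.
  case: face => f.
    exists (c i : nat)%:Z; rewrite -/(loc c z i) ger0_norm//; exact: ltW.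
  exists ((c i : nat)%:Z + 1); rewrite intrD opprD addrA -/(loc c z i).
  rewrite ler0_norm; last by move: u1; rewrite /loc; lra.
  by move: f; rewrite /loc; lra.
move: nz; rewrite ler_norml => /andP[nz1 nz2].
pose k : int := n - (c' i : nat)%:Z.
have kE : k%:~R = n%:~R - (c' i)%:R :> R by rewrite /k intrB.
have [k0|k0] := lerP k 0.
  have {}k0 : k%:~R <= 0 :> R by rewrite lerz0.
  have : loc c' x i <= 2 * rho by rewrite /loc; move: k0; rewrite kE; lra.
  by move: t0 t1; move: (loc c' x i) => t t0 t1; nra.
have {}k0 : 1 <= k%:~R :> R by rewrite ler1z.
have : 1 - loc c' x i <= 2 * rho by rewrite /loc; move: k0; rewrite kE; lra.
by move: t0 t1; move: (loc c' x i) => t t0 t1; nra.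
Qed.

Definition profile : {poly R} := ('X * (1 - 'X)) ^+ S.

Lemma profileE t : 0 <= t <= 1 -> hat t ^+ S = profile.[t].
Proof.
by move=> t01; rewrite hat_in// /profile horner_exp hornerM hornerD hornerN hornerX hornerC.
Qed.

Local Notation N := (size profile).

(** A bound, uniform over the unit interval, for all normalised derivatives of
the profile. *)
Definition taylor_bound : R :=
  \sum_(r < N) \sum_(k < size profile^`N(r)) `|profile^`N(r)`_k|.

Lemma taylor_coef_le (r : 'I_N) u : 0 <= u <= 1 -> `|profile^`N(r).[u]| <= taylor_bound.
Proof.
move=> u01; apply: (le_trans (horner_unit_bound _ u01)).
rewrite /taylor_bound (bigD1 r)//= lerDl; apply: sumr_ge0 => i _.
by apply: sumr_ge0 => k _.
Qed.

Lemma taylor_bound_ge0 : 0 <= taylor_bound.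
Proof. by apply: sumr_ge0 => i _; apply: sumr_ge0 => k _. Qed.

(** The factor in coordinate i of the term of multidegree e of the Taylor
expansion at z. *)
Definition taylor_factor (c : cells d J) (z : X) (e : {ffun 'I_d -> 'I_N}) (i : 'I_d) :
  {poly R} := profile^`N(e i).[loc c z i] *: (D *: ('X - (tnth z i)%:P)) ^+ e i.

Definition taylor_term c z e (x : X) : R :=
  \prod_i (taylor_factor c z e i).[tnth x i].

Lemma taylor_termE c z e x : taylor_term c z e x =
  \prod_i (profile^`N(e i).[loc c z i] * (D * (tnth x i - tnth z i)) ^+ e i).
Proof.
apply: eq_bigr => i _.
by rewrite /taylor_factor hornerZ horner_exp hornerZ hornerXsubC.
Qed.

Lemma size_taylor_factor c z e i : ((size (taylor_factor c z e i)).-1 <= e i)%N.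
Proof.
rewrite /taylor_factor.
have h1 : (size (D *: ('X - (tnth z i)%:P)) <= 2)%N.
  by rewrite (leq_trans (size_scale_leq _ _))// size_XsubC.
set q := D *: _ in h1 *.
apply: (@leq_trans (size (q ^+ e i)).-1).
  by rewrite -!subn1 leq_sub2r// size_scale_leq.
apply: (@leq_trans ((size q).-1 * e i)%N).
  by rewrite -subn1 leq_subLR add1n size_poly_exp_leq.
by rewrite -[leqRHS]mul1n leq_mul2r -subn1 leq_subLR h1 orbT.
Qed.

Lemma bump_taylor c z x : in_cell c x ->
  cell_bump S c x = \sum_(e : {ffun 'I_d -> 'I_N}) taylor_term c z e x.
Proof.
move=> cx; rewrite /cell_bump.
under eq_bigr => i _.
  rewrite (profileE (cx i)).
  have -> : loc c x i = loc c z i + D * (tnth x i - tnth z i) by rewrite /loc; ring.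
  rewrite nderiv_taylor; last exact: mulrC.
  over.
rewrite bigA_distr_bigA/=; apply: eq_bigr => e _.
by rewrite taylor_termE.
Qed.

(** The truncation at total degree S makes it orthogonal to the wavelets. *)
Definition taylor_poly c z (x : X) : R :=
  \sum_(e : {ffun 'I_d -> 'I_N} | (\sum_i e i < S)%N) taylor_term c z e x.

Definition taylor_const : R := #|{ffun 'I_d -> 'I_N}|%:R * taylor_bound ^+ d.

Lemma taylor_const_ge0 : 0 <= taylor_const.
Proof. by rewrite mulr_ge0// exprn_ge0// taylor_bound_ge0. Qed.

(** Only terms of total degree at least S remain, each at most rho ^ S since
rho <= 1. *)
Lemma bump_taylor_le c z x (rho : R) : in_cell c x -> in_cell c z -> rho <= 1 ->
  (forall i, `|D * (tnth x i - tnth z i)| <= rho) ->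
  0 <= rho -> `|cell_bump S c x - taylor_poly c z x| <= taylor_const * rho ^+ S.
Proof.
move=> cx cz rho1 xz rho0; rewrite (bump_taylor z cx) /taylor_poly.
rewrite (bigID (fun e : {ffun 'I_d -> 'I_N} => (\sum_i e i < S)%N))/= addrAC subrr add0r.
apply: (le_trans (ler_norm_sum _ _ _)).
apply: (@le_trans _ _ (\sum_(e : {ffun 'I_d -> 'I_N} | ~~ (\sum_i e i < S)%N)
    taylor_bound ^+ d * rho ^+ S)).
  apply: ler_sum => e; rewrite -leqNgt => Se.
  rewrite taylor_termE normr_prod.
  under eq_bigr do rewrite normrM normrX.
  rewrite big_split/=; apply: ler_pM.
  - by apply: prodr_ge0 => i _.
  - by apply: prodr_ge0 => i _; exact: exprn_ge0.
  - rewrite -[d in X in _ <= X]card_ord -prodr_const; apply: ler_prod => i _.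
    by rewrite normr_ge0/= taylor_coef_le.
  - apply: (@le_trans _ _ (\prod_i rho ^+ e i)).
      by apply: ler_prod => i _; rewrite exprn_ge0//= lerXn2r ?nnegrE.
    by rewrite prodrXr; apply: ler_wiXn2l.
rewrite /taylor_const -mulrA -sum_cst.
rewrite [leRHS](bigID (fun e : {ffun 'I_d -> 'I_N} => (\sum_i e i < S)%N))/= lerDr.
by apply: sumr_ge0 => e _; rewrite mulr_ge0 ?exprn_ge0// taylor_bound_ge0.
Qed.

End combination.

(** * Rough functions in a Hoelder ball *)

Section perturbation.
Context (R : realType) (d : nat) (W : wavelet_system R d) (S J0 : nat).
Hypotheses (hW : cdv_basis W S J0) (S1 : (1 <= S)%N) (d0 : (0 < d)%N).
Local Notation U := (unif_cube R d).
Local Notation Z := (idx W).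
Local Notation X := (Rpt R d).
Local Notation phi l := (@scaling R d W l).

Lemma wavelet_orth_taylor J l i (m : Z l) (c : cells d J) z : (J0 <= l)%N ->
  ebd U (@taylor_poly R d S J c z) /\ inner (@taylor_poly R d S J c z) (wavelet i m) = 0.
Proof.
move=> l0; have hw := ebd_wavelet hW i m l0.
have ht (e : {ffun 'I_d -> 'I_(size (profile R S))}) : ebd U (@taylor_term R d S J c z e).
  by apply: cbd_ebd; exact: cbd_poly.
split; first by apply: ebd_sum => e.
rewrite inner_suml// big1// => e eS.
apply: (wavelet_orth_poly hW) => //; apply: leq_ltn_trans eS.
by apply: leq_sum => k _; exact: size_taylor_factor.
Qed.

(** The first bound only uses that the sum of bumps is at most 1. For the second
one, rho bounds the diameter of the support of the wavelet, measured in cells.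
The first bound suffices if rho >= 1. Otherwise, either the support lies inside
one cell, where the sum of bumps is a polynomial within O(rho ^ S) of its Taylor
polynomial, or it meets a neighbourhood of a face, and the sum of bumps itself is
O(rho ^ S). *)
Lemma combo_coef_le : exists2 K : R, 0 < K &
  forall J (eps : cells d J -> R), (forall c, `|eps c| <= 1) ->
  forall l i (m : Z l), (J0 <= l)%N ->
    `|inner (combo S eps) (wavelet i m)| * Num.sqrt (resolution d l)%:R <= K /\
    `|inner (combo S eps) (wavelet i m)| * Num.sqrt (resolution d l)%:R
       <= K * (2 ^+ J / 2 ^+ l) ^+ S.
Proof.
have /choice[Cf HCf] : forall i : subband d, exists C : R, 0 < C /\
    forall l (m : Z l), (J0 <= l)%N ->
    mean U (fun x => `|wavelet i m x|) <= C / Num.sqrt (resolution d l)%:R /\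
    exists z : X, forall x, cube x -> wavelet i m x != 0 ->
      forall k, `|tnth x k - tnth z k| <= C / 2 ^+ l.
  move=> i; have [|C C0 HC] := localized_L1 (J0 := J0) _ (wavelet_localized hW i).
    by move=> l m l0; exact: (ebd_wavelet hW).
  by exists C.
pose C := \sum_i Cf i + 1.
have Cf0 i : 0 < Cf i by have [] := HCf i.
have CfC i : Cf i <= C.
  rewrite /C (bigD1 i)//= -addrA lerDl addr_ge0// sumr_ge0// => i' _.
  exact: ltW.
have C0 : 0 < C by rewrite ltr_wpDl// sumr_ge0// => i _; exact: ltW.
pose B : R := 1 + 2 ^+ S + taylor_const R d S.
have tc0 := taylor_const_ge0 R d S.
have s0 : 0 < 2 ^+ S :> R by exact: exprn_gt0.
have B1 : 1 <= B by rewrite /B; lra.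
have C2S : 0 <= (2 * C) ^+ S by rewrite exprn_ge0// mulr_ge0// ltW.
exists (B * C * (1 + (2 * C) ^+ S)).
  rewrite mulr_gt0 ?mulr_gt0//; [by apply: lt_le_trans B1|by rewrite ltr_pwDl].
move=> J eps eps1 l i m l0.
have hq := ebd_combo S1 eps1; have hw := ebd_wavelet hW i m l0.
have two0 : 0 < 2 ^+ l :> R by exact: exprn_gt0.
have twoJ : 0 < 2 ^+ J :> R by exact: exprn_gt0.
set k : R := (resolution d l)%:R.
have k0 : 0 < k by rewrite ltr0n expn_gt0.
have sk : 0 < Num.sqrt k by rewrite sqrtr_gt0.
have [_ /(_ l m l0)[L1 [z0 supp]]] := HCf i.
have {}L1 : mean U (fun x => `|wavelet i m x|) * Num.sqrt k <= C.
  by rewrite -ler_pdivlMr// (le_trans L1)// ler_pM2r ?invr_gt0.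
pose rho : R := 2 * C * (2 ^+ J / 2 ^+ l).
have rho0 : 0 <= rho by rewrite mulr_ge0 ?divr_ge0 ?mulr_ge0 ?(ltW C0) ?(ltW two0) ?(ltW twoJ).
(* It suffices to approximate on the support, to accuracy E, by a function
   orthogonal to the wavelet. *)
have reduce (E : R) (g : X -> R) : 0 <= E -> ebd U g -> inner g (wavelet i m) = 0 ->
    (forall x, cube x -> wavelet i m x != 0 -> `|combo S eps x - g x| <= E) ->
    `|inner (combo S eps) (wavelet i m)| * Num.sqrt k <= E * C.
  move=> E0 hg g0 gE.
  have := wavelet_coef_local hW l0 hq hg g0 gE.
  rewrite -(ler_pM2r sk) => /le_trans; apply.
  by rewrite -mulrA ler_wpM2l.
have zero : ebd U (fun=> 0 : R) /\ inner (fun=> 0) (wavelet i m) = 0.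
  split; first exact: ebd_cst.
  by rewrite innerE (eq_mean _ (g := fun=> 0)) ?mean_cst// => x; rewrite mul0r.
have crude : `|inner (combo S eps) (wavelet i m)| * Num.sqrt k <= B * C.
  apply: (reduce B (fun=> 0)); [by lra|exact: zero.1|exact: zero.2|].
  by move=> x xc _; rewrite subr0 (le_trans (combo_le1 S1 eps1 xc)).
have BC : 0 <= B * C by rewrite mulr_ge0 ?(ltW C0)//; lra.
split; first by apply: (le_trans crude); rewrite ler_peMr// lerDl.
apply: (@le_trans _ _ (B * C * rho ^+ S)); last first.
  rewrite /rho exprMn; set y := (2 ^+ J / 2 ^+ l) ^+ S.
  have y0 : 0 <= y by rewrite exprn_ge0 ?divr_ge0 ?(ltW two0) ?(ltW twoJ).
  rewrite -subr_ge0.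
  have -> : B * C * (1 + (2 * C) ^+ S) * y - B * C * ((2 * C) ^+ S * y) = B * C * y.
    by ring.
  exact: mulr_ge0.
rewrite mulrAC.
have [rho1|rho1] := lerP 1 rho.
  apply: (le_trans crude); rewrite ler_wpM2r ?(ltW C0)// ler_peMr//; first by lra.
  by rewrite exprn_ege1.
have rhoS0 : 0 <= rho ^+ S by exact: exprn_ge0.
have BrS : 0 <= B * rho ^+ S by rewrite mulr_ge0//; lra.
have [[z [zc wz]]|noz] := pselect (exists z, cube z /\ wavelet i m z != 0); last first.
  apply: (reduce _ (fun=> 0)) => //; [exact: zero.1|exact: zero.2|].
  by move=> x xc wx; exfalso; apply: noz; exists x.
have supz x : cube x -> wavelet i m x != 0 ->
    forall t, `|2 ^+ J * (tnth x t - tnth z t)| <= rho.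
  move=> xc wx t; rewrite normrM gtr0_norm// /rho.
  have -> : 2 * C * (2 ^+ J / 2 ^+ l) = 2 ^+ J * (2 * (C / 2 ^+ l)) by ring.
  rewrite ler_pM2l//.
  have := supp x xc wx t; have := supp z zc wz t.
  have : Cf i / 2 ^+ l <= C / 2 ^+ l by rewrite ler_pM2r ?invr_gt0.
  rewrite !ler_norml => h0 /andP[h1 h2] /andP[h3 h4]; apply/andP; split; lra.
have [c cz] := @cell_exists R d J z zc.
have [/forallP inside|] := boolP [forall t, rho <= loc c z t <= 1 - rho]; last first.
  rewrite negb_forall => /existsP[t]; rewrite negb_and -!ltNge => /orP face.
  apply: (reduce _ (fun=> 0)) => //; [exact: zero.1|exact: zero.2|].
  move=> x xc wx; rewrite subr0.
  apply: (le_trans (combo_near_face S1 eps1 xc cz face (supz x xc wx t))).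
  by rewrite exprMn ler_wpM2r// /B; lra.
have [hp p0] := wavelet_orth_taylor i m c z l0.
have he : ebd U (fun x => eps c * @taylor_poly R d S J c z x).
  by apply: ebdM => //; exact: ebd_cst.
apply: (reduce _ (fun x => eps c * @taylor_poly R d S J c z x)) => //.
  by rewrite innerZl// p0 mulr0.
move=> x xc wx.
have cx : in_cell c x.
  move=> t; have /andP[i1 i2] := inside t.
  have := supz x xc wx t; rewrite ler_norml => /andP[h1 h2].
  rewrite /loc in i1 i2 *; apply/andP; split; lra.
rewrite (combo_in_cell S1 eps cx) -mulrBr normrM.
apply: (@le_trans _ _ (1 * (taylor_const R d S * rho ^+ S))).
  apply: ler_pM => //; apply: bump_taylor_le => //.
  - exact: ltW.
  - exact: supz.
by rewrite mul1r ler_wpM2r// /B; lra.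
Qed.

(** The squared norms of the bumps add up to at least a constant g, whatever the
level. Their squared projections on V_j add up, by Bessel applied to each
scaling function, to at most #|Z j| 2^(-(j + L) d), which is below g / 2 for
large L. Signs from [signs_exist] merge the bumps into one function. *)
Lemma rough_function : exists (L : nat) (gam : R), 0 < gam /\
  forall j, (J0 <= j)%N -> exists eps : cells d (j + L) -> R,
    (forall c, `|eps c| <= 1) /\
    gam <= resid (phi j) (combo S eps) (combo S eps).
Proof.
have [C C0 Zcard] := idx_card hW.
pose g : R := bump_mass R S ^+ d.
have b0 : 0 < bump_mass R S.
  by rewrite /bump_mass divr_gt0// !exprn_gt0// divr_gt0.
have g0 : 0 < g by exact: exprn_gt0.
pose L := (Num.truncn (2 * C / g)).+1.
have LC : 2 * C / g <= 2 ^+ (L * d).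
  have CG : 0 <= 2 * C / g by rewrite divr_ge0 ?mulr_ge0 ?(ltW C0) ?(ltW g0).
  have /andP[_ h] := truncn_itv CG.
  apply: (le_trans (ltW h)); rewrite -natrX ler_nat -/L.
  by apply: (leq_trans (ltnW (ltn_expl L (ltnSn 1)))); rewrite leq_exp2l// leq_pmulr.
exists L, (g / 2); split; first by rewrite divr_gt0.
move=> j j0; pose J := (j + L)%N.
have hphi m := @ebd_scaling _ _ _ _ _ hW j m j0.
have on (m m' : Z j) := scaling_orthonormal hW m m' j0.
pose b (c : cells d J) := @cell_bump R d S J c.
have hb c : ebd U (b c) by exact: ebd_bump.
have [eps [eps1 Heps]] := signs_exist hphi hb.
exists eps; split; first by move=> c; rewrite eps1.
apply: le_trans Heps.
pose D : R := 2 ^+ J; have D0 : 0 < D by exact: exprn_gt0.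
have ccard : #|{: cells d J}|%:R = D ^+ d :> R.
  by rewrite card_ffun !card_ord 2!natrX.
have sum_norm : g <= \sum_c inner (b c) (b c).
  apply: (@le_trans _ _ (\sum_(c : cells d J) (bump_mass R S * D^-1) ^+ d)).
    rewrite sum_cst ccard exprMn mulrCA -exprMn divff ?gt_eqF// expr1n mulr1.
    by rewrite /g.
  by apply: ler_sum => c _; exact: inner_bump_ge.
(* The normalised bumps form an orthonormal family. *)
have sum_proj (m : Z j) : \sum_c inner (b c) (scaling m) ^+ 2 <= D^-1 ^+ d.
  pose nb c : R := inner (b c) (b c).
  have nb0 c : 0 < nb c.
    apply: lt_le_trans (inner_bump_ge R S c).
    by rewrite exprn_gt0// mulr_gt0// invr_gt0.
  pose u c x := (Num.sqrt (nb c))^-1 * b c x.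
  have hu c : ebd U (u c) by rewrite /u; ebd2.
  have uon c c' : inner (u c) (u c') = (c == c')%:R.
    rewrite innerZl// innerC innerZl// innerC.
    have [->|cc'] := eqVneq c c'; last by rewrite inner_bump_neq// !mulr0.
    rewrite -/(nb c') mulrA -expr2 exprVn sqr_sqrtr ?ltW//.
    by rewrite mulVf// gt_eqF.
  have := bessel hu uon (hphi m); rewrite on eqxx/= => bes.
  apply: (@le_trans _ _ (\sum_c D^-1 ^+ d * inner (scaling m) (u c) ^+ 2)).
    apply: ler_sum => c _.
    have -> : inner (b c) (scaling m) ^+ 2 = nb c * inner (scaling m) (u c) ^+ 2.
      rewrite [inner (scaling m) _]innerC innerZl// exprMn exprVn sqr_sqrtr ?ltW//.
      by rewrite mulrA divff ?mul1r// gt_eqF.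
    by rewrite ler_wpM2r ?sqr_ge0//; exact: inner_bump_le.
  by rewrite -mulr_sumr ler_piMr// exprn_ge0// invr_ge0 ltW.
rewrite /resid sumrB; under [X in _ - X]eq_bigr do under eq_bigr do rewrite -expr2.
rewrite exchange_big/=.
have : \sum_(m : Z j) \sum_c inner (b c) (scaling m) ^+ 2 <= g / 2; last first.
  by move: sum_norm; lra.
apply: (@le_trans _ _ (\sum_(m : Z j) D^-1 ^+ d)); first exact: ler_sum.
rewrite sum_cst.
have /andP[_ Zle] := Zcard j j0.
have Dd : D ^+ d = (resolution d j)%:R * 2 ^+ (L * d).
  by rewrite /D /J /resolution natrX -exprM mulnDl exprD.
have r0 : 0 < (resolution d j)%:R :> R by rewrite ltr0n expn_gt0.
have l0 : 0 < 2 ^+ (L * d) :> R by exact: exprn_gt0.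
rewrite exprVn Dd ler_pdivrMr ?mulr_gt0//.
apply: (le_trans Zle); rewrite mulrCA [leLHS]mulrC ler_pM2l//.
by move: LC; rewrite ler_pdivrMr//; lra.
Qed.

(** For l <= j the first bound of [combo_coef_le] suffices; for l > j the decay
of order S in the second one compensates the weight 2^((l - j) a), as a <= S. *)
Lemma scaled_coef_le : forall L : nat, exists2 K : R, 0 < K &
  forall j (eps : cells d (j + L) -> R), (forall c, `|eps c| <= 1) ->
  forall a, 0 < a -> a <= S%:R ->
  forall l i (m : Z l), (J0 <= l)%N ->
  2 `^ (l%:R * (a + d%:R / 2)) * (2 `^ (- (j%:R * a)) * `|inner (combo S eps) (wavelet i m)|) <= K.
Proof.
move=> L; have [K K0 HK] := combo_coef_le.
exists (K * 2 ^+ (L * S)); first by rewrite mulr_gt0// exprn_gt0.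
move=> j eps eps1 a a0 aS l i m l0.
have [k1 k2] := HK _ eps eps1 l i m l0.
set v := `|inner _ _|%R in k1 k2 *; have v0 : 0 <= v by exact: normr_ge0.
have p2 x : 0 < 2 `^ x :> R by exact: powR_gt0.
have two : (2 : R) != 0 by [].
have sq : Num.sqrt (resolution d l)%:R = 2 `^ (l%:R * (d%:R / 2)) :> R.
  rewrite -powR12_sqrt// /resolution natrX -powR_mulrn// -powRrM natrM.
  by congr powR; ring.
have -> : 2 `^ (l%:R * (a + d%:R / 2)) * (2 `^ (- (j%:R * a)) * v)
   = 2 `^ ((l%:R - j%:R) * a) * (v * Num.sqrt (resolution d l)%:R).
  rewrite sq mulrA -powRD ?two ?implybT//.
  have -> : l%:R * (a + d%:R / 2) + - (j%:R * a)
    = (l%:R - j%:R) * a + l%:R * (d%:R / 2) by ring.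
  by rewrite powRD ?two ?implybT// -mulrA [v * _]mulrC.
have [lj|jl] := leqP l j.
  apply: (@le_trans _ _ (1 * K)).
    apply: ler_pM; [exact: ltW|by rewrite mulr_ge0 ?sqrtr_ge0| |exact: k1].
    rewrite -[leRHS](powRr0 2); apply: ler_powR; first by rewrite ler1n.
    rewrite -[leRHS](mul0r a) ler_wpM2r ?(ltW a0)// subr_le0 ler_nat//.
  by rewrite mul1r ler_peMr ?(ltW K0)// exprn_ege1// ler1n.
apply: (@le_trans _ _ (2 `^ ((l%:R - j%:R) * S%:R) * (K * (2 ^+ (j + L) / 2 ^+ l) ^+ S))).
  apply: ler_pM; [exact: ltW|by rewrite mulr_ge0 ?sqrtr_ge0| |exact: k2].
  apply: ler_powR; first by rewrite ler1n.
  by rewrite ler_wpM2l// subr_ge0 ler_nat ltnW.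
have -> : (2 ^+ (j + L) / 2 ^+ l) ^+ S = 2 `^ ((j%:R + L%:R - l%:R) * S%:R) :> R.
  rewrite powRrM powR_mulrn ?(ltW (p2 _))//; congr (_ ^+ _).
  by rewrite -!powR_mulrn// -powRB ?two ?implybT// natrD.
rewrite mulrCA -powRD ?two ?implybT//.
have -> : (l%:R - j%:R) * S%:R + (j%:R + L%:R - l%:R) * S%:R = (L * S)%:R :> R.
  by rewrite natrM; ring.
by rewrite powR_mulrn.
Qed.

End perturbation.

(** * Lower bounds for the maximal risk *)

Section lower_bounds.
Context (R : realType) (d : nat) (W : wavelet_system R d) (S J0 : nat).
Hypotheses (hW : cdv_basis W S J0) (S1 : (1 <= S)%N) (d0 : (0 < d)%N).
Local Notation U := (unif_cube R d).
Local Notation Z := (idx W).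
Local Notation X := (Rpt R d).
Local Notation phi l := (@scaling R d W l).

(** A constant is a monomial of degree 0 < S. *)
Lemma one_coef l i (m : Z l) : (J0 <= l)%N -> inner (fun=> 1) (wavelet i m) = 0.
Proof.
move=> l0; have := wavelet_orth_monomial hW i m l0 (e := fun=> 0%N).
rewrite big1// => /(_ S1) <-; apply: eq_mean => x.
by rewrite big1.
Qed.

Lemma inner_le1 f l (m : Z l) : (J0 <= l)%N -> ebd U f ->
  {ae U, forall x, `|f x| <= 1} -> `|inner f (scaling m)| <= 1.
Proof.
move=> l0 hf f1; have hm := ebd_scaling hW m l0.
rewrite -(@ler_pXn2r _ 2) ?nnegrE// real_normK ?num_real// expr1n.
apply: (le_trans (inner_CS hf hm)); rewrite (scaling_orthonormal hW)// eqxx mulr1.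
rewrite -[leRHS](mean_cst U); apply: le_mean; [by ebd2|by ebd2|].
apply: filterS f1 => x fx; rewrite -expr2 -real_normK ?num_real//.
by rewrite exprn_ile1.
Qed.

(** A regression function of the model is first moved towards the midpoint of
[C1, C2], which makes room for the noise and for the rough perturbation. *)
Definition perturbed (C1 C2 e del a : R) (h0 : X -> R) j L
    (eps : cells d (j + L) -> R) (x : X) : R :=
  (1 - e) * h0 x + e * ((C1 + C2) / 2) + del * 2 `^ (- (j%:R * a)) * combo S eps x.

Lemma ebd_perturbed C1 C2 e del a h0 j L (eps : cells d (j + L) -> R) :
  (forall c, `|eps c| <= 1) -> ebd U h0 -> ebd U (perturbed C1 C2 e del a h0 eps).
Proof.
move=> eps1 hh0; have hq := ebd_combo S1 eps1.
by rewrite /perturbed; ebd2.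
Qed.

Lemma perturbed_range C1 C2 e del a h0 j L (eps : cells d (j + L) -> R) :
  C1 < C2 -> 0 <= e -> e <= 1 -> 0 <= del -> del <= e * (C2 - C1) / 4 -> 0 < a ->
  (forall c, `|eps c| <= 1) -> {ae U, forall x, C1 <= h0 x <= C2} ->
  {ae U, forall x, C1 + e * (C2 - C1) / 4 <= perturbed C1 C2 e del a h0 eps x
     <= C2 - e * (C2 - C1) / 4}.
Proof.
move=> C12 e0 e1 del0 dele a0 eps1; apply: filterS2 (ae_cube R d) => x xc /andP[h1 h2].
have q1 := combo_le1 S1 eps1 xc.
have t1 : 2 `^ (- (j%:R * a)) <= 1 :> R.
  rewrite -[leRHS](powRr0 2); apply: ler_powR; first by rewrite ler1n.
  by rewrite oppr_le0 mulr_ge0// ltW.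
have t0 : 0 <= 2 `^ (- (j%:R * a)) :> R by exact: powR_ge0.
have : `|del * 2 `^ (- (j%:R * a)) * combo S eps x| <= e * (C2 - C1) / 4.
  apply: le_trans dele; rewrite normrM ger0_norm ?mulr_ge0//.
  rewrite -mulrA ler_piMr// -[leRHS](mulr1 1); exact: ler_pM.
rewrite /perturbed ler_norml; move: (del * _ * _) => y /andP[y1 y2].
have p1 : (1 - e) * C1 <= (1 - e) * h0 x by rewrite ler_wpM2l// subr_ge0.
have p2 : (1 - e) * h0 x <= (1 - e) * C2 by rewrite ler_wpM2l// subr_ge0.
move: p1 p2; move: ((1 - e) * h0 x) => w p1 p2.
by apply/andP; split; lra.
Qed.

(** The slack between M0 and M pays half for the move towards the constant, half
for the rough perturbation. *)
Lemma perturbed_holder C1 C2 a M0 M h0 L : 0 < a -> a <= S%:R -> M0 < M ->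
  ebd U h0 -> holder_ball W J0 a M0 h0 ->
  exists2 e0 : R, 0 < e0 & forall e, 0 <= e -> e <= e0 -> e <= 1 ->
  exists2 del0 : R, 0 < del0 & forall del, 0 <= del -> del <= del0 ->
    forall j (eps : cells d (j + L) -> R), (forall c, `|eps c| <= 1) ->
    holder_ball W J0 a M (perturbed C1 C2 e del a h0 eps).
Proof.
move=> a0 aS MM hh0 /holder_ballP[uc0 H0].
have [K K0 HK] := scaled_coef_le hW S1 L.
pose A : R := 2 `^ (J0%:R * (a + d%:R / 2)).
have A0 : 0 < A by exact: powR_gt0.
pose cc : R := (C1 + C2) / 2.
pose B := `|cc| * A + `|M0| + 1.
have B0 : 0 < B by rewrite ltr_wpDl// addr_ge0// mulr_ge0// ltW.
exists ((M - M0) / 2 / B); first by rewrite !divr_gt0// subr_gt0.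
move=> e e0 eB e1; exists ((M - M0) / 2 / (A + K)).
  by apply: divr_gt0; [rewrite divr_gt0// subr_gt0|exact: addr_gt0].
move=> del del0 delB j eps eps1.
have hq := ebd_combo S1 eps1.
have t0 : 0 <= 2 `^ (- (j%:R * a)) :> R by exact: powR_ge0.
have t1 : 2 `^ (- (j%:R * a)) <= 1 :> R.
  rewrite -[leRHS](powRr0 2); apply: ler_powR; first by rewrite ler1n.
  by rewrite oppr_le0 mulr_ge0// ltW.
set t := 2 `^ _ in t0 t1.
have hc1 : ebd U (fun=> 1 : R) by exact: ebd_cst.
have innerP g : ebd U g -> inner (perturbed C1 C2 e del a h0 eps) g =
    (1 - e) * inner h0 g + e * cc * inner (fun=> 1) g + del * t * inner (combo S eps) g.
  move=> hg; rewrite /perturbed -/cc -/t.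
  have -> : (fun x => (1 - e) * h0 x + e * cc + del * t * combo S eps x)
     = (fun x => (1 - e) * h0 x + (e * cc) * 1 + del * t * combo S eps x).
    by apply/funext => x; rewrite mulr1.
  have g1 : ebd U (fun x => (1 - e) * h0 x) by ebd2.
  have g2 : ebd U (fun x : X => (e * cc) * 1) by exact: ebd_cst.
  have g3 : ebd U (fun x => del * t * combo S eps x) by ebd2.
  have g4 : ebd U (fun x => (1 - e) * h0 x + (e * cc) * 1) by exact: ebdD.
  by rewrite innerDl// innerDl// innerZl// (innerZl (e * cc) hc1)// (innerZl (del * t))//.
apply/holder_ballP; split.
  apply: ucD.
    apply: ucD; last exact: uc_cst.
    by apply: ucM => //; exact: uc_cst.
  by apply: ucM; [exact: uc_cst|exact: uc_combo].
move=> l i m l0; have := H0 l i m l0.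
rewrite -/A; set w : R := 2 `^ (l%:R * _); have w0 : 0 <= w by exact: powR_ge0.
set s0 := \big[Num.max/0]_(_ : Z J0) `|inner h0 _|.
have se : 0 <= 1 - e by rewrite subr_ge0.
have scal : \big[Num.max/0]_(m : Z J0) `|inner (perturbed C1 C2 e del a h0 eps) (scaling m)|
    <= (1 - e) * s0 + e * `|cc| + del.
  have s00 : 0 <= s0.
    by rewrite /s0; elim/big_ind: _ => // x y x0 y0; rewrite le_max x0.
  elim/big_ind: _ => [|x y x0 y0|m' _].
  - by rewrite !addr_ge0 ?mulr_ge0.
  - by rewrite ge_max x0.
  have hm := ebd_scaling hW m' (leqnn J0).
  have c1 : `|inner (fun=> 1) (scaling m')| <= 1.
    by apply: inner_le1 => //; apply: aeW => x; rewrite normr1.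
  have c2 : `|inner (combo S eps) (scaling m')| <= 1.
    by apply: inner_le1 => //; apply: filterS (ae_cube R d) => x; exact: combo_le1.
  have c3 : `|inner h0 (scaling m')| <= s0.
    by rewrite /s0; apply: le_bigmax.
  rewrite innerP//; apply: (le_trans (ler_normD _ _)); apply: lerD.
    apply: (le_trans (ler_normD _ _)); apply: lerD.
      by rewrite normrM (ger0_norm se) ler_wpM2l.
    rewrite !normrM (ger0_norm e0) -mulrA ler_wpM2l// ler_piMr//.
  rewrite normrM ger0_norm ?mulr_ge0// -mulrA ler_piMr//.
  by rewrite -[leRHS](mulr1 1); exact: ler_pM.
have wav : w * `|inner (perturbed C1 C2 e del a h0 eps) (wavelet i m)|
    <= (1 - e) * (w * `|inner h0 (wavelet i m)|) + del * K.
  have hm := ebd_wavelet hW i m l0.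
  rewrite innerP// one_coef// mulr0 addr0.
  apply: (@le_trans _ _ (w * ((1 - e) * `|inner h0 (wavelet i m)|
      + del * t * `|inner (combo S eps) (wavelet i m)|))).
    rewrite ler_wpM2l// (le_trans (ler_normD _ _))//.
    by rewrite !normrM (ger0_norm se) (ger0_norm del0) (ger0_norm t0).
  rewrite mulrDr mulrCA lerD2l.
  have -> : w * (del * t * `|inner (combo S eps) (wavelet i m)|)
    = del * (w * (t * `|inner (combo S eps) (wavelet i m)|)) by ring.
  by rewrite ler_wpM2l//; exact: HK.
move=> H; apply: (le_trans (lerD (ler_wpM2l (ltW A0) scal) wav)).
have x1 : (1 - e) * (A * s0 + w * `|inner h0 (wavelet i m)|) <= (1 - e) * M0.
  by rewrite ler_wpM2l.
have x2 : e * B <= (M - M0) / 2 by rewrite -ler_pdivlMr.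
have x3 : del * (A + K) <= (M - M0) / 2 by rewrite -ler_pdivlMr// addr_gt0.
have x4 : - (e * M0) <= e * `|M0|.
  by rewrite -mulrN ler_wpM2l// -normrN ler_norm.
rewrite /B in x2.
by move: x1 x2 x3 x4; lra.
Qed.

Section bilinear.
Variables (j n : nat).
Hypothesis j0 : (J0 <= j)%N.
Local Notation bias := (@plugin_bias R d W j n).

Lemma biasC f g : bias f g = bias g f.
Proof.
rewrite /plugin_bias innerC; congr (_ - _ * _ - _ * _).
  by apply: eq_bigr => m _; rewrite mulrC.
by apply: eq_bigr => m _; apply: eq_mean => x; rewrite [f x * _]mulrC.
Qed.

Lemma biasDl f f' g : ebd U f -> ebd U f' -> ebd U g ->
  bias (fun x => f x + f' x) g = bias f g + bias f' g.
Proof.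
move=> hf hf' hg; rewrite /plugin_bias.
have hm (m : Z j) := ebd_scaling hW m j0.
rewrite innerDl//.
have -> : \sum_(m : Z j) inner (fun x => f x + f' x) (scaling m) * inner g (scaling m)
  = \sum_(m : Z j) inner f (scaling m) * inner g (scaling m)
   + \sum_(m : Z j) inner f' (scaling m) * inner g (scaling m).
  by rewrite -big_split/=; apply: eq_bigr => m _; rewrite innerDl// mulrDl.
have -> : \sum_(m : Z j) mean U (fun x => (f x + f' x) * g x * scaling m x ^+ 2)
  = \sum_(m : Z j) mean U (fun x => f x * g x * scaling m x ^+ 2)
   + \sum_(m : Z j) mean U (fun x => f' x * g x * scaling m x ^+ 2).
  rewrite -big_split/=; apply: eq_bigr => m _; rewrite -meanD; [|by ebd2..].
  by apply: eq_mean => x; rewrite !mulrDl.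
by ring.
Qed.

Lemma biasZl c f g : ebd U f -> ebd U g ->
  bias (fun x => c * f x) g = c * bias f g.
Proof.
move=> hf hg; rewrite /plugin_bias.
have hm (m : Z j) := ebd_scaling hW m j0.
rewrite innerZl//.
have -> : \sum_(m : Z j) inner (fun x => c * f x) (scaling m) * inner g (scaling m)
  = c * \sum_(m : Z j) inner f (scaling m) * inner g (scaling m).
  by rewrite mulr_sumr; apply: eq_bigr => m _; rewrite innerZl// mulrA.
have -> : \sum_(m : Z j) mean U (fun x => c * f x * g x * scaling m x ^+ 2)
  = c * \sum_(m : Z j) mean U (fun x => f x * g x * scaling m x ^+ 2).
  rewrite mulr_sumr; apply: eq_bigr => m _; rewrite -meanZ; last by ebd2.
  by apply: eq_mean => x; rewrite !mulrA.
by ring.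
Qed.

(** The diagonal pairs are bounded by #|Z j| / n, as f is at most 1 and the
scaling functions are normalised. *)
Lemma bias_diag_ge f : ebd U f -> {ae U, forall x, `|f x| <= 1} ->
  resid (phi j) f f - #|Z j|%:R / n%:R <= bias f f.
Proof.
move=> hf f1; have hm (m : Z j) := ebd_scaling hW m j0.
rewrite /plugin_bias /resid.
have n0 : 0 <= n%:R^-1 :> R by rewrite invr_ge0.
have s0 : 0 <= \sum_(m : Z j) inner f (scaling m) * inner f (scaling m).
  by apply: sumr_ge0 => m _; rewrite -expr2 sqr_ge0.
have k1 : \sum_(m : Z j) mean U (fun x => f x * f x * scaling m x ^+ 2) <= #|Z j|%:R.
  rewrite -[leRHS]mulr1 -sum_cst; apply: ler_sum => m _.
  rewrite -(mean_phi2 hW m j0); apply: le_mean; [by ebd2|by ebd2|].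
  apply: filterS f1 => x fx; rewrite ler_piMl ?sqr_ge0// -expr2.
  by rewrite -real_normK ?num_real// exprn_ile1.
have := ler_wpM2l n0 k1; have := mulr_ge0 n0 s0.
by rewrite mulrBl mul1r [_ / n%:R]mulrC; lra.
Qed.

End bilinear.

Lemma four_terms (x x1 x2 x3 x4 : R) : x = x1 - x2 - x3 + x4 ->
  [\/ x ^+ 2 / 16 <= x1 ^+ 2, x ^+ 2 / 16 <= x2 ^+ 2, x ^+ 2 / 16 <= x3 ^+ 2
    | x ^+ 2 / 16 <= x4 ^+ 2].
Proof.
move=> xE.
have [h1|h1] := lerP (x ^+ 2 / 16) (x1 ^+ 2); first by constructor 1.
have [h2|h2] := lerP (x ^+ 2 / 16) (x2 ^+ 2); first by constructor 2.
have [h3|h3] := lerP (x ^+ 2 / 16) (x3 ^+ 2); first by constructor 3.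
constructor 4; rewrite leNgt; apply/negP => h4.
have : x ^+ 2 <= 4 * (x1 ^+ 2 + x2 ^+ 2 + x3 ^+ 2 + x4 ^+ 2).
  rewrite xE -subr_ge0.
  have -> : 4 * (x1 ^+ 2 + x2 ^+ 2 + x3 ^+ 2 + x4 ^+ 2) - (x1 - x2 - x3 + x4) ^+ 2
    = (x1 + x2) ^+ 2 + (x1 + x3) ^+ 2 + (x1 - x4) ^+ 2 + (x2 - x3) ^+ 2
      + (x2 + x4) ^+ 2 + (x3 + x4) ^+ 2 by ring.
  by rewrite !addr_ge0 ?sqr_ge0.
lra.
Qed.

(** One hypercube of laws, parametrised by the mean of the second sign (through
q) and by the amplitudes s and t of the rough perturbations of p and b, serves for
the three bounds. *)
Lemma risk_lower (C1 C2 alpha beta M : R) : C1 < C2 ->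
  0 < alpha -> 0 < beta -> alpha <= S%:R -> beta <= S%:R ->
  (exists2 M0 : R, M0 < M & model W J0 C1 C2 alpha beta M0 !=set0) ->
  exists2 c : R, 0 < c & forall j n, (0 < n)%N -> (J0 <= j n)%N ->
  [/\ ((c * ((resolution d (j n))%:R / n%:R) ^+ 2)%:E
         <= max_risk W J0 C1 C2 alpha beta M j n)%E,
      ((resolution d (j n))%:R <= c * n%:R ->
        ((c * (2 `^ (- ((j n)%:R * (alpha + beta)))) ^+ 2)%:E
         <= max_risk W J0 C1 C2 alpha beta M j n)%E)
    & ((resolution d (j n))%:R <= c * n%:R ->
        ((c / n%:R)%:E <= max_risk W J0 C1 C2 alpha beta M j n)%E)].
Proof.
move=> C12 a0 b0 aS bS [M0 MM [P0 hP0]].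
have [PX _ [p0 Ap p0H] [q0 Yq q0H]] := hP0.
have hp0 := cond_exp_ebd PX (ebd_A hP0) Ap.
have hq0 := cond_exp_ebd PX (ebd_Y hP0) Yq.
have rng T g : is_cond_exp P0 T g -> {ae P0, forall o, C1 <= T o <= C2} ->
    {ae U, forall x, C1 <= g x <= C2}.
  move=> Tg TC.
  have h1 : {ae U, forall x, g x <= C2}.
    by apply: (cond_exp_ub PX Tg); apply: filterS TC => o /andP[].
  have h2 : {ae U, forall x, C1 <= g x}.
    by apply: (cond_exp_lb PX Tg); apply: filterS TC => o /andP[].
  by apply: filterS2 h1 h2 => x -> ->.
have p0C : {ae U, forall x, C1 <= p0 x <= C2}.
  by apply: (rng _ _ Ap); case: hP0 => _ + _ _; apply: filterS => o [].
have q0C : {ae U, forall x, C1 <= q0 x <= C2}.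
  by apply: (rng _ _ Yq); case: hP0 => _ + _ _; apply: filterS => o [].
have [L [gam [gam0 rough]]] := rough_function hW S1 d0.
have [e1 e10 He1] := perturbed_holder C1 C2 L a0 aS MM hp0 p0H.
have [e2 e20 He2] := perturbed_holder C1 C2 L b0 bS MM hq0 q0H.
pose e := Num.min 1 (Num.min e1 e2).
have e0 : 0 < e by rewrite !lt_min ltr01 e10.
have ele1 : e <= 1 by rewrite ge_min lexx.
have ee1 : e <= e1 by rewrite /e ge_min [X in _ || X]ge_min lexx orbT.
have ee2 : e <= e2 by rewrite /e ge_min [X in _ || X]ge_min lexx !orbT.
have [d1 d10 Hd1] := He1 e (ltW e0) ee1 ele1.
have [d2 d20 Hd2] := He2 e (ltW e0) ee2 ele1.
pose eta := e * (C2 - C1) / 4.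
have eta0 : 0 < eta by rewrite /eta divr_gt0// mulr_gt0// subr_gt0.
pose del := Num.min eta (Num.min d1 d2).
have del0 : 0 < del by rewrite !lt_min eta0 d10.
have dele : del <= eta by rewrite ge_min lexx.
have dd1 : del <= d1 by rewrite /del ge_min [X in _ || X]ge_min lexx orbT.
have dd2 : del <= d2 by rewrite /del ge_min [X in _ || X]ge_min lexx !orbT.
have [CZ CZ0 Zcard] := idx_card hW.
pose pp s j (eps : cells d (j + L) -> R) := perturbed C1 C2 e s alpha p0 eps.
pose bb s j (eps : cells d (j + L) -> R) := perturbed C1 C2 e s beta q0 eps.
have risks q s t j n (eps : cells d (j n + L) -> R) : 0 <= q <= 1 ->
    0 <= s -> s <= del -> 0 <= t -> t <= del -> (forall c, `|eps c| <= 1) ->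
    (0 < n)%N -> (J0 <= j n)%N ->
    (((@plugin_bias R d W (j n) n (pp s _ eps) (bb t _ eps)
       - n%:R^-1 * (eta ^+ 2 * (2 * q - 1) * #|Z (j n)|%:R)) ^+ 2)%:E
    <= max_risk W J0 C1 C2 alpha beta M j n)%E /\
    (q = 2^-1 -> ((eta ^+ 4 * (1 - #|Z (j n)|%:R / n%:R) ^+ 2 / n%:R)%:E
    <= max_risk W J0 C1 C2 alpha beta M j n)%E).
  move=> q01 s0 sd t0 td eps1 n0 j0.
  have hp := ebd_perturbed C1 C2 e s alpha eps1 hp0.
  have hb := ebd_perturbed C1 C2 e t beta eps1 hq0.
  have pR := perturbed_range C12 (ltW e0) ele1 s0 (le_trans sd dele) a0 eps1 p0C.
  have bR := perturbed_range C12 (ltW e0) ele1 t0 (le_trans td dele) b0 eps1 q0C.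
  have pH := Hd1 s s0 (le_trans sd dd1) _ eps eps1.
  have bH := Hd2 t t0 (le_trans td dd2) _ eps eps1.
  split.
    exact: (risk_ge_bias2 hW hp hb q01 (ltW eta0) pR bR pH bH n0 j0).
  move=> q2.
  exact: (risk_ge_variance hW hp hb q01 (ltW eta0) pR bR pH bH n0 j0 q2 eta0).
clearbody eta del.
have half : (0 : R) <= (2^-1 : R) <= (1 : R).
  by rewrite invr_ge0 ler0n invf_le1 ?ler1n ?ltr0n.
(* c1, c2, c3 are the constants of the three bounds; k <= c4 n makes #|Z j| / n
   at most gam / 2 and 1/2. *)
pose c1 := (eta ^+ 2 / CZ) ^+ 2.
pose c2 := (del ^+ 2 * (gam / 2)) ^+ 2 / 16.
pose c3 := eta ^+ 4 / 4.
pose c4 := Num.min (gam / 2) 2^-1 / CZ.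
have c10 : 0 < c1 by rewrite exprn_gt0// divr_gt0// exprn_gt0.
have c20 : 0 < c2 by rewrite divr_gt0// exprn_gt0// mulr_gt0 ?exprn_gt0// divr_gt0.
have c30 : 0 < c3 by rewrite divr_gt0// exprn_gt0.
have c40 : 0 < c4 by rewrite divr_gt0// lt_min divr_gt0//=; lra.
pose c := Num.min (Num.min c1 c2) (Num.min c3 c4).
have c0 : 0 < c by rewrite !lt_min c10 c20 c30.
have cc1 : c <= c1 by rewrite !ge_min lexx.
have cc2 : c <= c2 by rewrite !ge_min lexx orbT.
have cc3 : c <= c3 by rewrite !ge_min lexx !orbT.
have cc4 : c <= c4 by rewrite !ge_min lexx !orbT.
exists c => // j n n0 j0.
have /andP[Zge Zle] := Zcard _ j0.
have nn0 : 0 < n%:R :> R by rewrite ltr0n.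
set k : R := (resolution d (j n))%:R in Zge Zle *.
have k0 : 0 <= k by [].
have z1 : forall c : cells d (j n + L), `|(fun=> 0 : R) c| <= 1 by move=> ?; rewrite normr0.
split.
- apply: (@le_trans _ _ ((n%:R^-1 * (eta ^+ 2 * #|Z (j n)|%:R)) ^+ 2)%:E).
    rewrite lee_fin; apply: (@le_trans _ _ (c1 * (k / n%:R) ^+ 2)).
      by rewrite ler_wpM2r ?sqr_ge0.
    rewrite -exprMn lerXn2r ?nnegrE ?mulr_ge0 ?sqr_ge0 ?invr_ge0 ?(ltW CZ0) ?(ltW eta0) ?(ltW nn0)//.
    have -> : eta ^+ 2 / CZ * (k / n%:R) = n%:R^-1 * (eta ^+ 2 * (CZ^-1 * k)) by ring.
    by rewrite !ler_wpM2l ?sqr_ge0 ?invr_ge0 ?(ltW nn0).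
  set t := n%:R^-1 * _; have t0 : 0 <= t.
    by rewrite /t !mulr_ge0 ?sqr_ge0 ?invr_ge0 ?(ltW nn0) ?(ltW eta0) ?ler0n.
  have o1 : 0 <= (1 : R) <= 1 by rewrite ler01 lexx.
  have o0 : 0 <= (0 : R) <= 1 by rewrite ler01 lexx.
  (* The laws q = 1 and q = 0 have the same bilinear bias and opposite diagonal
     terms, so for one of them the two parts of the bias do not cancel. *)
  have [r1 _] := risks 1 0 0 j n _ o1 (lexx 0) (ltW del0) (lexx 0) (ltW del0) z1 n0 j0.
  have [r0 _] := risks 0 0 0 j n _ o0 (lexx 0) (ltW del0) (lexx 0) (ltW del0) z1 n0 j0.
  move: r1 r0; set b := @plugin_bias _ _ _ _ _ _ _.
  have -> : n%:R^-1 * (eta ^+ 2 * (2 * 1 - 1) * #|Z (j n)|%:R) = t by rewrite /t; ring.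
  have -> : n%:R^-1 * (eta ^+ 2 * (2 * 0 - 1) * #|Z (j n)|%:R) = - t by rewrite /t; ring.
  move=> r1 r0; clearbody b t; have [b0'|b0'] := lerP 0 b.
    apply: le_trans r0; rewrite lee_fin opprK lerXn2r ?nnegrE ?addr_ge0//.
    by rewrite lerDr.
  apply: le_trans r1; rewrite lee_fin -(sqrrN (b - t)) opprB.
  rewrite lerXn2r ?nnegrE// ?subr_ge0 ?(le_trans (ltW b0'))//.
  by rewrite lerBrDr gerDl ltW.
- move=> kn.
  have Zn : #|Z (j n)|%:R / n%:R <= gam / 2.
    rewrite ler_pdivrMr//; apply: (le_trans Zle).
    apply: (@le_trans _ _ (CZ * (c4 * n%:R))).
      by rewrite ler_pM2l// (le_trans kn)// ler_wpM2r// ltW.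
    rewrite mulrA ler_wpM2r ?(ltW nn0)// /c4 mulrCA divff ?gt_eqF// mulr1.
    by rewrite ge_min lexx.
  have [eps [eps1 geps]] := rough _ j0.
  have hq := ebd_combo S1 eps1.
  pose u : R := del * 2 `^ (- ((j n)%:R * alpha)).
  pose v : R := del * 2 `^ (- ((j n)%:R * beta)).
  have ppE s x : pp s _ eps x = pp 0 _ eps x + s * 2 `^ (- ((j n)%:R * alpha)) * combo S eps x.
    by rewrite /pp /perturbed; ring.
  have bbE s x : bb s _ eps x = bb 0 _ eps x + s * 2 `^ (- ((j n)%:R * beta)) * combo S eps x.
    by rewrite /bb /perturbed; ring.
  have hpp : ebd U (pp 0 _ eps) by exact: ebd_perturbed.
  have hbb : ebd U (bb 0 _ eps) by exact: ebd_perturbed.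
  have hppd : ebd U (pp del _ eps) by exact: ebd_perturbed.
  have hbbd : ebd U (bb del _ eps) by exact: ebd_perturbed.
  have huq : ebd U (fun x => u * combo S eps x) by ebd2.
  have hvq : ebd U (fun x => v * combo S eps x) by ebd2.
  set bs := @plugin_bias R d W (j n) n.
  have b1 g : ebd U g -> bs (pp del _ eps) g = bs (pp 0 _ eps) g + u * bs (combo S eps) g.
    move=> hg; rewrite /bs -(biasZl n j0 u)// -biasDl//.
    by congr (@plugin_bias _ _ _ _ _ _ _); apply/funext => x; rewrite ppE.
  have b2 f : ebd U f -> bs f (bb del _ eps) = bs f (bb 0 _ eps) + v * bs f (combo S eps).
    move=> hf; rewrite /bs ![@plugin_bias _ _ _ _ _ f _]biasC -(biasZl n j0 v)// -biasDl//.
    by congr (@plugin_bias _ _ _ _ _ _ _); apply/funext => x; rewrite bbE.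
  (* Mixed second difference of the bilinear bias; the diagonal term vanishes
     at q = 1/2. *)
  have key : u * v * bs (combo S eps) (combo S eps) = bs (pp del _ eps) (bb del _ eps)
      - bs (pp del _ eps) (bb 0 _ eps) - bs (pp 0 _ eps) (bb del _ eps)
      + bs (pp 0 _ eps) (bb 0 _ eps).
    by rewrite !b1// !b2//; ring.
  have bqq : gam / 2 <= bs (combo S eps) (combo S eps).
    have q1 : {ae U, forall x, `|combo S eps x| <= 1}.
      by apply: filterS (ae_cube R d) => x; exact: combo_le1.
    apply: le_trans (bias_diag_ge n j0 hq q1).
    by rewrite lerBrDr (le_trans _ geps)// [leRHS]splitr lerD2l.
  have uvE : u * v = del ^+ 2 * 2 `^ (- ((j n)%:R * (alpha + beta))).
    rewrite /u /v mulrACA -expr2 -powRD ?pnatr_eq0 ?implybT//.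
    by congr (_ * powR _ _); ring.
  have main : c * (2 `^ (- ((j n)%:R * (alpha + beta)))) ^+ 2
      <= (u * v * bs (combo S eps) (combo S eps)) ^+ 2 / 16.
    apply: (@le_trans _ _ (c2 * (2 `^ (- ((j n)%:R * (alpha + beta)))) ^+ 2)).
      by rewrite ler_wpM2r ?sqr_ge0.
    rewrite /c2 mulrAC ler_pM2r ?invr_gt0// -exprMn uvE.
    set w := 2 `^ _; have w0 : 0 <= w by exact: powR_ge0.
    have dw : 0 <= del ^+ 2 * w by rewrite mulr_ge0 ?sqr_ge0.
    have g2 : 0 <= gam / 2 by rewrite divr_ge0// ltW.
    have db : del ^+ 2 * w * (gam / 2) <= del ^+ 2 * w * bs (combo S eps) (combo S eps).
      by rewrite ler_wpM2l.
    have dg : 0 <= del ^+ 2 * w * (gam / 2) by rewrite mulr_ge0.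
    by rewrite mulrAC lerXn2r// nnegrE (le_trans dg db).
  have fin s t : 0 <= s -> s <= del -> 0 <= t -> t <= del ->
      ((bs (pp s _ eps) (bb t _ eps) ^+ 2)%:E <= max_risk W J0 C1 C2 alpha beta M j n)%E.
    move=> s0 sd t0 td; have [+ _] := risks 2^-1 s t j n eps half s0 sd t0 td eps1 n0 j0.
    by rewrite divff// subrr mulr0 mul0r mulr0 subr0.
  have dd0 := ltW del0.
  have [] := four_terms key => h; apply: (@le_trans _ _ _ _ _ _ (fin _ _ _ _ _ _));
    rewrite ?lee_fin; try exact: (le_trans main h); by [].
- move=> kn; have [_ /(_ erefl)] := risks 2^-1 0 0 j n _ half (lexx 0) (ltW del0) (lexx 0) (ltW del0) z1 n0 j0.
  apply: le_trans; rewrite lee_fin ler_pM2r ?invr_gt0//.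
  apply: (le_trans cc3); rewrite /c3 ler_pM2l ?exprn_gt0//.
  have Zn : #|Z (j n)|%:R / n%:R <= (2^-1 : R).
    rewrite ler_pdivrMr//; apply: (le_trans Zle).
    apply: (@le_trans _ _ (CZ * (c4 * n%:R))).
      by rewrite ler_pM2l// (le_trans kn)// ler_wpM2r// ltW.
    rewrite mulrA ler_wpM2r ?(ltW nn0)// /c4 mulrCA divff ?gt_eqF// mulr1.
    by rewrite ge_min lexx orbT.
  have Z2 : (2^-1 : R) <= 1 - #|Z (j n)|%:R / n%:R.
    by rewrite lerBrDr [leRHS]splitr div1r lerD2l.
  have -> : (4^-1 : R) = 2^-1 ^+ 2 by rewrite exprVn -natrX.
  have h0 : (0 : R) <= 2^-1 by rewrite invr_ge0.
  by rewrite lerXn2r// nnegrE (le_trans h0 Z2).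
Qed.

End lower_bounds.

(** * Rates *)

Section powers.
Context (R : realType).
Implicit Types (x y a b : R).

Lemma natr_ge1 n : (0 < n)%N -> 1 <= n%:R :> R.
Proof. by rewrite ler1n. Qed.

Lemma powR_addp x a b : 0 < x -> x `^ (a + b) = x `^ a * x `^ b.
Proof. by move=> x0; rewrite powRD// (gt_eqF x0) implybT. Qed.

Lemma powR_antitone x y a : 0 < x -> x <= y -> 0 <= a -> y `^ (- a) <= x `^ (- a).
Proof.
move=> x0 xy a0; have y0 := lt_le_trans x0 xy.
rewrite !powRN lef_pV2 ?posrE ?powR_gt0//.
by rewrite ge0_ler_powR// nnegrE ltW.
Qed.

(** Otherwise n^(a - b) would be bounded. *)
Lemma powR_exponent_le (C a b : R) :
  (\forall n \near \oo, n%:R `^ a <= C * n%:R `^ b) -> a <= b.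
Proof.
case=> n0 _ H; rewrite leNgt; apply/negP => ba.
have r0 : 0 < a - b by rewrite subr_gt0.
pose t : R := (`|C| + 1) `^ (a - b)^-1.
pose n := (maxn n0 (Num.truncn t).+1).
have n0n : (n0 <= n)%N by rewrite leq_maxl.
have tn : t <= n%:R.
  apply: (@le_trans _ _ (Num.truncn t).+1%:R); first exact/ltW/truncnS_gt.
  by rewrite ler_nat leq_maxr.
have n1 : (0 : R) < n%:R by rewrite ltr0n /n leq_max orbT.
have := H n n0n.
rewrite /= -{1}(subrK b a) powR_addp// ler_pM2r ?powR_gt0// leNgt => /negP; apply.
apply: (@lt_le_trans _ _ (`|C| + 1)).
  by rewrite (le_lt_trans (ler_norm C))// ltrDl.
have -> : `|C| + 1 = t `^ (a - b).
  by rewrite -powRrM mulVf ?gt_eqF// powRr1// addr_ge0.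
by rewrite ge0_ler_powR ?nnegrE ?powR_ge0 ?(ltW r0) ?(ltW n1).
Qed.

Lemma resolution_powR d l : (resolution d l)%:R = 2 `^ (l%:R * d%:R) :> R.
Proof. by rewrite /resolution -natrM powR_mulrn// natrX. Qed.

Lemma resolution_gt0 d l : 0 < (resolution d l)%:R :> R.
Proof. by rewrite ltr0n expn_gt0. Qed.

Lemma level_powR d l (s : R) : (0 < d)%N ->
  (2 `^ (- (l%:R * s))) ^+ 2 = (resolution d l)%:R `^ (- (2 * s / d%:R)).
Proof.
move=> d0; have dn : d%:R != 0 :> R by rewrite pnatr_eq0 -lt0n.
rewrite expr2 -powR_addp// resolution_powR -powRrM.
by congr (_ `^ _); field.
Qed.

(** The level is log2 (n^a) / d rounded down, and at least J0; rounding costs at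
most a factor 2^d and the floor J0 at most 2^(d J0). *)
Lemma level_exists d J0 a : (0 < d)%N -> 0 <= a ->
  exists2 j, levels J0 j & exists2 C : R, 0 < C &
    forall n, (0 < n)%N ->
      n%:R `^ a <= C * (resolution d (j n))%:R /\
      (resolution d (j n))%:R <= C * n%:R `^ a.
Proof.
move=> d0 a0; have dn : 0 < d%:R :> R by rewrite ltr0n.
have l2 : 0 < ln 2 :> R by rewrite ln_gt0// ltr1n.
pose t n : R := a * ln n%:R / (d%:R * ln 2).
have tE n : (0 < n)%N -> n%:R `^ a = 2 `^ (t n * d%:R).
  move=> n0; rewrite /powR !gt_eqF ?ltr0n//; congr expR.
  by rewrite /t; field; rewrite !gt_eqF.
have t0 n : (0 < n)%N -> 0 <= t n.
  by move=> n0; rewrite !mulr_ge0 ?ln_ge0 ?ler1n// invr_ge0 mulr_ge0 ?(ltW l2)// ler0n.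
have two : (1 : R) <= 2 by rewrite ler1n.
exists (fun n => maxn J0 (Num.truncn (t n))); first by move=> n; exact: leq_maxl.
exists (2 `^ (d%:R * J0.+1%:R)); first by rewrite powR_gt0.
move=> n n0; rewrite tE// resolution_powR -!powR_addp//; split; apply: ler_powR => //.
  rewrite (mulrC d%:R) -mulrDl ler_pM2r//.
  apply: (le_trans (ltW (truncnS_gt (t n)))).
  rewrite -natrD ler_nat addSn ltnS.
  by rewrite (leq_trans (leq_maxr J0 _))// leq_addl.
rewrite (mulrC d%:R) -mulrDl ler_pM2r//.
have : ((maxn J0 (Num.truncn (t n)))%:R : R) <= J0%:R + (Num.truncn (t n))%:R.
  by rewrite -natrD ler_nat geq_max leq_addr leq_addl.
have : (Num.truncn (t n))%:R <= t n by have /andP[] := trunc_itv (t0 n n0).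
have : (J0%:R : R) <= J0.+1%:R by rewrite ler_nat.
lra.
Qed.

End powers.

Section rates.
Context (R : realType) (d J0 : nat) (g : R).
Variable risk : (nat -> nat) -> nat -> \bar R.
Notation k l := ((resolution d l)%:R : R).

Hypotheses (d0 : (0 < d)%N) (g0 : 0 < g).

(* With g = 2 (alpha + beta) / d, these are the two bounds on the maximal risk. *)
Hypothesis upper : exists2 C : R, 0 < C & forall j n,
  (0 < n)%N -> (J0 <= j n)%N ->
  (risk j n <= (C * (k (j n) `^ (- g) + n%:R^-1
                     + (k (j n) / n%:R) ^+ 2))%:E)%E.

Hypothesis lower : exists2 c : R, 0 < c & forall j n,
  (0 < n)%N -> (J0 <= j n)%N ->
  [/\ ((c * (k (j n) / n%:R) ^+ 2)%:E <= risk j n)%E,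
      (k (j n) <= c * n%:R -> ((c * k (j n) `^ (- g))%:E <= risk j n)%E)
    & (k (j n) <= c * n%:R -> ((c / n%:R)%:E <= risk j n)%E)].

Lemma sqr_ratio_powR n a : (0 < n)%N ->
  (n%:R `^ a / n%:R) ^+ 2 = n%:R `^ (2 * a - 2) :> R.
Proof.
move=> n0; have nn : 0 < n%:R :> R by rewrite ltr0n.
rewrite -{2}[n%:R](powRr1 (ltW nn)) -powRN -powR_addp// expr2 -powR_addp//.
by congr (_ `^ _); ring.
Qed.

Lemma achieves_of_exponents a rho j : levels J0 j ->
  realizes d j (fun n => n%:R `^ a) ->
  rho <= 1 -> rho <= g * a -> rho <= 2 - 2 * a ->
  achieves risk (fun n => n%:R `^ (- rho)) j.
Proof.
move=> Lj [[C1 C10 H1] [C2 C20 H2]] r1 ra rb; have [C C0 HC] := upper.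
pose B := C2 `^ g + 1 + C1 ^+ 2.
have B0 : 0 < B.
  by rewrite ltr_wpDr ?exprn_ge0 ?(ltW C10)// ltr_wpDl// powR_ge0.
exists (C * B); first by rewrite mulr_gt0.
near=> n.
have n0 : (0 < n)%N by near: n; exists 1%N.
have n1 := natr_ge1 R n0; have nn : 0 < n%:R :> R by rewrite ltr0n.
have K1 : k (j n) <= C1 * n%:R `^ a.
  by rewrite -lee_fin EFinM; near: n.
have K2 : n%:R `^ a <= C2 * k (j n).
  by rewrite -lee_fin EFinM; near: n.
apply: (le_trans (HC j n n0 (Lj n))); rewrite /= -EFinM lee_fin -(mulrA C).
rewrite ler_pM2l// /B !mulrDl mul1r.
apply: lerD; first apply: lerD.
- apply: (@le_trans _ _ (C2 `^ g * n%:R `^ (- (g * a)))).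
    have -> : C2 `^ g * n%:R `^ (- (g * a)) = (C2^-1 * n%:R `^ a) `^ (- g).
      rewrite powRM ?invr_ge0 ?powR_ge0 ?(ltW C20)//.
      rewrite -powR_inv1 ?(ltW C20)// -!powRrM.
      by congr (_ `^ _ * _ `^ _); ring.
    apply: powR_antitone; rewrite ?(ltW g0)//; first by rewrite mulr_gt0 ?invr_gt0 ?powR_gt0.
    by rewrite ler_pdivrMl.
  by rewrite ler_wpM2l ?powR_ge0// ler_powR// lerN2.
- rewrite -powR_inv1 ?(ltW nn)// ler_powR// lerN2 //.
- apply: (@le_trans _ _ ((C1 * (n%:R `^ a / n%:R)) ^+ 2)).
    rewrite lerXn2r ?nnegrE ?mulr_ge0 ?divr_ge0 ?powR_ge0 ?(ltW C10) ?(ltW nn)//.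
    by rewrite mulrA ler_pM2r// invr_gt0.
  rewrite exprMn sqr_ratio_powR// ler_pM2l ?exprn_gt0// ler_powR//.
  lra.
Unshelve. all: by end_near. Qed.

Lemma eventually_le_linear (C c a : R) : 0 < C -> 0 < c -> a < 1 ->
  \forall n \near \oo, C * n%:R `^ a <= c * n%:R.
Proof.
move=> C0 c0 a1; pose t := (C / c) `^ (1 - a)^-1.
have ha : 0 < 1 - a by rewrite subr_gt0.
near=> n.
have n0 : (0 < n)%N by near: n; exists 1%N.
have nn : 0 < n%:R :> R by rewrite ltr0n.
have tn : t <= n%:R.
  apply: (@le_trans _ _ (Num.truncn t).+1%:R); first exact/ltW/truncnS_gt.
  by rewrite ler_nat; near: n; exact: nbhs_infty_ge.
have nE : n%:R = n%:R `^ (1 - a) * n%:R `^ a :> R.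
  by rewrite -powR_addp// subrK powRr1// ltW.
rewrite [leRHS](congr1 (fun x => c * x) nE) mulrA ler_pM2r ?powR_gt0//.
rewrite -ler_pdivrMl//.
have -> : c^-1 * C = t `^ (1 - a).
  by rewrite -powRrM mulVf ?gt_eqF// powRr1 1?mulrC// mulrC divr_ge0 ?ltW.
by rewrite ge0_ler_powR ?nnegrE ?powR_ge0 ?(ltW ha) ?(ltW nn).
Unshelve. all: by end_near. Qed.

(** Each of the lower bounds in k^(-g) and (k/n)^2 is in force, the former since
k = O(n^a) is eventually at most c n. *)
Lemma exponents_of_achieves a rho j : levels J0 j -> a < 1 ->
  realizes d j (fun n => n%:R `^ a) ->
  achieves risk (fun n => n%:R `^ (- rho)) j ->
  rho <= g * a /\ rho <= 2 - 2 * a.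
Proof.
move=> Lj a1 [[C1 C10 H1] [C2 C20 H2]] [C C0 HC].
have [c c0 Hc] := lower.
split; rewrite -lerN2.
- pose D := C1 `^ (- g); have D0 : 0 < D by rewrite powR_gt0.
  apply: (@powR_exponent_le _ ((c * D)^-1 * C)).
  near=> n.
  have n0 : (0 < n)%N by near: n; exists 1%N.
  have nn : 0 < n%:R :> R by rewrite ltr0n.
  have K1 : k (j n) <= C1 * n%:R `^ a.
    by rewrite -lee_fin EFinM; near: n.
  have kc : k (j n) <= c * n%:R.
    by apply: (le_trans K1); near: n; exact: eventually_le_linear.
  have hC : (risk j n <= (C * n%:R `^ (- rho))%:E)%E.
    by rewrite EFinM; near: n.
  have [_ /(_ kc) h2 _] := Hc j n n0 (Lj n).
  have := le_trans h2 hC; rewrite lee_fin => h.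
  rewrite -mulrA ler_pdivlMl ?mulr_gt0//; apply: le_trans h.
  rewrite -mulrA ler_pM2l//.
  have -> : D * n%:R `^ (- (g * a)) = (C1 * n%:R `^ a) `^ (- g).
    by rewrite powRM ?powR_ge0 ?(ltW C10)// -powRrM mulrN (mulrC a).
  by apply: powR_antitone K1 (ltW g0); exact: resolution_gt0.
- have -> : - (2 - 2 * a) = 2 * a - 2 by ring.
  apply: (@powR_exponent_le _ ((c / C2 ^+ 2)^-1 * C)).
  near=> n.
  have n0 : (0 < n)%N by near: n; exists 1%N.
  have nn : 0 < n%:R :> R by rewrite ltr0n.
  have K2 : n%:R `^ a <= C2 * k (j n).
    by rewrite -lee_fin EFinM; near: n.
  have hC : (risk j n <= (C * n%:R `^ (- rho))%:E)%E.
    by rewrite EFinM; near: n.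
  have [h1 _ _] := Hc j n n0 (Lj n).
  have := le_trans h1 hC; rewrite lee_fin => h.
  rewrite -mulrA ler_pdivlMl ?divr_gt0 ?exprn_gt0//; apply: le_trans h.
  rewrite -mulrA ler_pM2l// ler_pdivrMl ?exprn_gt0// -sqr_ratio_powR// -exprMn.
  rewrite lerXn2r ?nnegrE ?mulr_ge0 ?divr_ge0 ?powR_ge0 ?(ltW C20) ?(ltW nn)//.
  by rewrite mulrA ler_pM2r// invr_gt0.
Unshelve. all: by end_near. Qed.

(** At k = n^(2 / (g + 2)) the terms k^(-g) and (k/n)^2 are equal; 1/n is the
floor. *)
Definition best_exponent : R := Num.min 1 (2 * g / (g + 2)).

Lemma best_exponent_ge0 : 0 <= best_exponent.
Proof.
by rewrite le_min ler01/= divr_ge0 ?mulr_ge0 ?addr_ge0 ?(ltW g0).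
Qed.

Lemma best_exponent_attained : exists2 j, levels J0 j &
  achieves risk (fun n => n%:R `^ (- best_exponent)) j.
Proof.
have gg : 0 < g + 2 by rewrite addr_gt0.
have [|j Lj [C C0 HC]] := @level_exists R d J0 (2 / (g + 2)) d0.
  by rewrite divr_ge0 ?(ltW gg).
exists j => //; apply: (@achieves_of_exponents (2 / (g + 2))) => //.
- by split; exists C => //; exists 1%N => // n n0;
    rewrite -EFinM lee_fin; have [] := HC n n0.
- by rewrite ge_min lexx.
- by rewrite ge_min; apply/orP; right; rewrite mulrCA mulrA.
- rewrite ge_min; apply/orP; right.
  have -> : 2 - 2 * (2 / (g + 2)) = 2 * g / (g + 2) by field; rewrite gt_eqF.
  by [].
Qed.

(** k^(-g) is too large below the balancing resolution n^(2 / (g + 2)) and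
(k/n)^2 above it. *)
Lemma best_exponent_optimal j : levels J0 j ->
  lesssim (EFin \o (fun n => n%:R `^ (- best_exponent))) (risk j).
Proof.
move=> Lj; have [c c0 Hc] := lower.
pose C := Num.min c (c ^+ 3).
have C0 : 0 < C by rewrite lt_min c0 exprn_gt0.
exists C^-1; first by rewrite invr_gt0.
exists 1%N => // n n0 /=.
rewrite lee_pdivlMl//.
have [h1 h2 h3] := Hc j n n0 (Lj n).
have n1 := natr_ge1 R n0; have nn : 0 < n%:R :> R by rewrite ltr0n.
have gg : 0 < g + 2 by rewrite addr_gt0.
have pw0 x : 0 <= n%:R `^ x :> R by exact: powR_ge0.
have [kc|kc] := lerP (k (j n)) (c * n%:R); last first.
  apply: le_trans h1; rewrite lee_fin.
  apply: (@le_trans _ _ (c ^+ 3)).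
    rewrite -[leRHS]mulr1; apply: ler_pM; rewrite ?(ltW C0)//.
      by rewrite ge_min lexx orbT.
    by rewrite -[leRHS](powRr0 n%:R) ler_powR// oppr_le0 best_exponent_ge0.
  rewrite exprS ler_pM2l// lerXn2r ?nnegrE ?divr_ge0 ?(ltW c0) ?(ltW nn)//.
  by rewrite ler_pdivlMr// ltW.
have Cc : C <= c by rewrite ge_min lexx.
have [e1|e1] := lerP 1 (2 * g / (g + 2)).
  apply: (le_trans _ (h3 kc)); rewrite lee_fin -powR_inv1 ?(ltW nn)//.
  by rewrite /best_exponent (min_idPl e1) ler_wpM2r.
rewrite /best_exponent (min_idPr (ltW e1)).
pose a := 2 / (g + 2).
have [ka|ka] := lerP (n%:R `^ a) (k (j n)).
  apply: le_trans h1; rewrite lee_fin.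
  apply: (@le_trans _ _ (c * n%:R `^ (- (2 * g / (g + 2))))); first by rewrite ler_wpM2r.
  have -> : - (2 * g / (g + 2)) = 2 * a - 2 by rewrite /a; field; rewrite gt_eqF.
  rewrite ler_pM2l// -sqr_ratio_powR// lerXn2r ?nnegrE ?divr_ge0 ?(ltW nn)//.
  by rewrite ler_pM2r// invr_gt0.
apply: (le_trans _ (h2 kc)); rewrite lee_fin.
apply: (@le_trans _ _ (c * n%:R `^ (- (2 * g / (g + 2))))); first by rewrite ler_wpM2r.
have -> : - (2 * g / (g + 2)) = a * - g by rewrite /a; field; rewrite gt_eqF.
rewrite ler_pM2l// powRrM; apply: powR_antitone (ltW ka) (ltW g0).
exact: resolution_gt0.
Qed.

End rates.

Section conclusion.
Context (R : realType) (d : nat) (alpha beta : R).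
Hypotheses (d0 : (0 < d)%N) (a0 : 0 < alpha) (b0 : 0 < beta).
Let g : R := 2 * (alpha + beta) / d%:R.
Let a : R := d%:R / (2 * beta + d%:R).
Let dn : 0 < d%:R :> R. Proof. by rewrite ltr0n. Qed.

Lemma best_exponentE :
  best_exponent g = Num.min 1 ((2 * alpha + 2 * beta) / (alpha + beta + d%:R)).
Proof.
congr Num.min; rewrite /g; field.
by rewrite !gt_eqF// ?addr_gt0 ?mulr_gt0 ?addr_gt0.
Qed.

Lemma NR_rate_powR n : (0 < n)%N ->
  NR_rate d alpha beta n = n%:R `^ (- best_exponent g).
Proof.
move=> n0; have sd : 0 < alpha + beta + d%:R by rewrite !addr_gt0.
rewrite best_exponentE /NR_rate; case: ifPn => h.
  rewrite (min_idPl _) ?powR_inv1 ?ler0n// ler_pdivlMr// mul1r; lra.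
by rewrite (min_idPr _)// ler_pdivrMr// mul1r; move: h; rewrite -ltNge; lra.
Qed.

(** Here g a = 2 s / (2 beta + d) and 2 - 2 a = 4 beta / (2 beta + d), with
s = alpha + beta. If s >= d the best exponent is 1 and the two inequalities say
d/2 <= alpha and d/2 <= beta; if s < d it is 2 s / (s + d) and they say
beta <= alpha and alpha <= beta, while d/2 <= min is impossible. *)
Lemma prediction_exponent_condition :
  (best_exponent g <= g * a /\ best_exponent g <= 2 - 2 * a) <->
  (d%:R / 2 <= Num.min alpha beta \/ alpha = beta).
Proof.
have sd : 0 < alpha + beta + d%:R by rewrite !addr_gt0.
have bd : 0 < 2 * beta + d%:R by rewrite addr_gt0 ?mulr_gt0.
have -> : g * a = 2 * (alpha + beta) / (2 * beta + d%:R).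
  by rewrite /g /a; field; rewrite !gt_eqF.
have -> : 2 - 2 * a = 4 * beta / (2 * beta + d%:R).
  by rewrite /a; field; rewrite gt_eqF.
rewrite best_exponentE !ge_min !ler_pdivlMr// !mul1r.
rewrite ![_ / _ * _]mulrAC !ler_pdivrMr//.
have -> : ((2 * alpha + 2 * beta) * (2 * beta + d%:R)
            <= 2 * (alpha + beta) * (alpha + beta + d%:R)) = (beta <= alpha).
  rewrite -mulrDr ler_pM2l ?mulr_gt0 ?addr_gt0//.
  by apply/idP/idP; lra.
have -> : ((2 * alpha + 2 * beta) * (2 * beta + d%:R)
            <= 4 * beta * (alpha + beta + d%:R)) = (alpha <= beta).
  by rewrite -[RHS](ler_pM2r dn); apply/idP/idP; lra.
rewrite -[d%:R <= _ * 2]ler_pdivrMr// le_min; split.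
  case=> /orP[h1|h1] /orP[h2|h2]; try (left; apply/andP; split; lra).
  by right; apply/eqP; rewrite eq_le h1 h2.
case=> [/andP[h1 h2]|->]; last by rewrite lexx !orbT.
by split; apply/orP; left; lra.
Qed.

End conclusion.

Lemma lesssim_near (R : realType) (u u' v v' : nat -> \bar R) :
  (\forall n \near \oo, u n = u' n) -> (\forall n \near \oo, v n = v' n) ->
  lesssim u v -> lesssim u' v'.
Proof.
move=> uu vv [C C0 H]; exists C => //; near=> n.
have <- : u n = u' n by near: n.
have <- : v n = v' n by near: n.
by near: n.
Unshelve. all: by end_near. Qed.

Lemma realizes_scale (R : realType) d j (c a : R) : 0 < c ->
  realizes d j (fun n => c * n%:R `^ a) -> realizes d j (fun n => n%:R `^ a).
Proof.
move=> c0 [[C1 C10 H1] [C2 C20 H2]]; split.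
- exists (C1 * c); first by rewrite mulr_gt0.
  by apply: filterS H1 => n; rewrite -!EFinM mulrA.
- exists (c^-1 * C2); first by rewrite mulr_gt0 ?invr_gt0.
  apply: filterS H2 => n; rewrite /= -!EFinM !lee_fin => h.
  by rewrite -mulrA ler_pdivlMl.
Qed.

Unset Implicit Arguments.
Theorem corollary14 (R : realType) (d : nat) (hd : (0 < d)%N)
  (C1 C2 alpha beta M : R)
  (halpha : 0 < alpha) (hbeta : 0 < beta) (hM : 0 < M)
  (S J0 : nat) (hS1 : (1 <= S)%N) (hS : Num.max alpha beta < S%:R)
  (hJ0 : (S <= 2 ^ J0)%N)
  (W : wavelet_system R d) (hW : cdv_basis W S J0)
  (hC : C1 < C2)
  (hmodel : exists2 M0 : R, M0 < M &
     model W J0 C1 C2 alpha beta M0 !=set0) :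
  let risk := max_risk W J0 C1 C2 alpha beta M in
  let r := NR_rate d alpha beta in
  best_rate J0 risk r /\
  forall (c2 : R) (j : nat -> nat), 0 < c2 -> levels J0 j ->
    realizes d j (k2_pred d beta c2) ->
    (achieves risk r j <->
     d%:R / 2 <= Num.min alpha beta \/ alpha = beta).
Proof.
move=> risk r.
have dn : 0 < d%:R :> R by rewrite ltr0n.
have s0 : 0 < alpha + beta by rewrite addr_gt0.
have [aS bS] : alpha <= S%:R /\ beta <= S%:R.
  by move: hS; rewrite gt_max => /andP[/ltW ? /ltW ?].
pose g : R := 2 * (alpha + beta) / d%:R.
have g0 : 0 < g by rewrite divr_gt0 ?mulr_gt0.
pose rho := best_exponent g.
have upper : exists2 C : R, 0 < C & forall j n, (0 < n)%N -> (J0 <= j n)%N ->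
    (risk j n <= (C * ((resolution d (j n))%:R `^ (- g) + n%:R^-1
                       + ((resolution d (j n))%:R / n%:R) ^+ 2))%:E)%E.
  have [C C0 HC] := max_risk_le hW C1 C2 M s0; exists C => // j n n0 Jj.
  by have := HC j n n0 Jj; rewrite (level_powR _ _ hd).
have lower : exists2 c : R, 0 < c & forall j n, (0 < n)%N -> (J0 <= j n)%N ->
    [/\ ((c * ((resolution d (j n))%:R / n%:R) ^+ 2)%:E <= risk j n)%E,
        ((resolution d (j n))%:R <= c * n%:R ->
          ((c * (resolution d (j n))%:R `^ (- g))%:E <= risk j n)%E)
      & ((resolution d (j n))%:R <= c * n%:R ->
          ((c / n%:R)%:E <= risk j n)%E)].
  have [c c0 Hc] := risk_lower hW hS1 hd hC halpha hbeta aS bS hmodel.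
  exists c => // j n n0 Jj.
  by have := Hc j n n0 Jj; rewrite (level_powR _ _ hd).
have rE : \forall n \near \oo, (n%:R `^ (- rho))%:E = (r n)%:E :> \bar R.
  by exists 1%N => // n n0; rewrite /r NR_rate_powR.
have rE' : \forall n \near \oo, (r n)%:E = (n%:R `^ (- rho))%:E :> \bar R.
  by apply: filterS rE => n ->.
have same (u : nat -> \bar R) : \forall n \near \oo, u n = u n by exact: nearW.
split.
  split; last first.
    move=> j Lj; apply: lesssim_near rE (same _) _.
    exact: best_exponent_optimal g0 lower _ Lj.
  have [j Lj Hj] := best_exponent_attained hd g0 upper.
  by exists j => //; apply: lesssim_near (same _) rE Hj.
move=> c2 j c20 Lj /(realizes_scale c20) kj.
rewrite -(prediction_exponent_condition hd halpha hbeta); split.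
  move=> /(lesssim_near (same _) rE').
  apply: (exponents_of_achieves g0 lower Lj _ kj).
  by rewrite ltr_pdivrMr ?mul1r ?ltrDr ?addr_gt0 ?mulr_gt0.
case=> e1 e2; apply: lesssim_near (same _) rE _.
apply: (achieves_of_exponents g0 upper Lj kj _ e1 e2).
by rewrite ge_min lexx.
Qed.
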